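(* Let $T>0$, $d\in\mathbb{N}$, $0<\alpha<1$ and $1\le p\le+\infty$ be such that $\alpha>1/p$ and $\frac1\alpha\notin\mathbb{N}\setminus\{1\}$. Let $K$ be a closed normal subgroup of $G^{[1/\alpha]}(\mathbb{R}^d)$. If $X\in W^\alpha_p([0,T];G^{[1/\alpha]}(\mathbb{R}^d)/K)$, then there exists a path $\mathbf{X}\in W^\alpha_p([0,T];G^{[1/\alpha]}(\mathbb{R}^d))$ such that $\pi_{G^{[1/\alpha]}(\mathbb{R}^d),\,G^{[1/\alpha]}(\mathbb{R}^d)/K}(\mathbf{X}_t)=X_t$ for all $t\in[0,T]$.
   Context: $[r]$ denotes the largest integer $\le r$. For $N\in\mathbb{N}$, $T^N(\mathbb{R}^d)=\bigoplus_{k=0}^N(\mathbb{R}^d)^{\otimes k}$ is the truncated tensor algebra with product $\otimes$ and bracket $[a,b]=a\otimes b-b\otimes a$; $\mathcal{G}^N(\mathbb{R}^d)=W_1\oplus\dots\oplus W_N$ with $W_1=\mathbb{R}^d$, $W_{i+1}=[\mathbb{R}^d,W_i]$ is the free step-$N$ nilpotent Lie algebra, and $G^N(\mathbb{R}^d)=\exp(\mathcal{G}^N(\mathbb{R}^d))$ is the step-$N$ free nilpotent group (product $\otimes$). Every $g\in G^N(\mathbb{R}^d)$ is the step-$N$ signature $S_N(\gamma)_{0,1}$ of some path $\gamma:[0,1]\to\mathbb{R}^d$ of bounded variation, and the Carnot–Carathéodory norm $\|g\|$ is the infimum of the lengths of such $\gamma$. $G^N(\mathbb{R}^d)$ is equipped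 with the metric $d_{cc}(g,h)=\|g^{-1}\otimes h\|$. For a closed normal subgroup $K$ of $G=G^N(\mathbb{R}^d)$, $\pi_{G,G/K}$ is the canonical homomorphism onto $G/K$, and $G/K$ is equipped with the quotient homogeneous norm $\|gK\|_{G/K}=\inf_{k\in K}\|g\otimes k\|$ and the metric $d$ it induces, $d(x,y)=\|x^{-1}y\|_{G/K}$. For a metric space $(E,d)$ and $p<\infty$, $W^\alpha_p([0,T];E)$ is the set of measurable paths $f:[0,T]\to E$ with $\iint_{[0,T]^2}\frac{d(f(s),f(t))^p}{|t-s|^{\alpha p+1}}\,ds\,dt<\infty$; for $p=\infty$ it is the space of $\alpha$-Hölder continuous paths. Since $\alpha>1/p$, elements of these spaces are taken to be continuous paths (continuous representatives). *)

(* Defs.v *)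
From HB Require Import structures.
From mathcomp Require Import all_boot all_order all_algebra.
From mathcomp Require Import all_classical all_reals all_analysis.

Set Implicit Arguments.
Unset Strict Implicit.
Unset Printing Implicit Defensive.

Import Order.TTheory GRing.Theory Num.Theory.
Import numFieldNormedType.Exports.

Local Open Scope classical_set_scope.
Local Open Scope ring_scope.

(* A truncated tensor a is given by its coordinates a(i_1 ... i_k) in the     *)
(* basis e_{i_1} (x) ... (x) e_{i_k}, k <= N, of T^N(R^d): the words of length *)
(* at most N over the alphabet 'I_d.                                          *)
Definition tensor (R : realType) (d N : nat) := {ffun N.-bseq 'I_d -> R}.

Definition conv (R : realType) (I : Type) (f g : seq I -> R) (w : seq I) : R :=
  \sum_(i < (size w).+1) f (take i w) * g (drop i w).

Section ConvTheory.
Context {R : realType} {I : Type}.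
Implicit Types (f g h : seq I -> R) (w : seq I).

Lemma conv_nil f g : conv f g [::] = f [::] * g [::].
Proof. by rewrite /conv big_ord_recl big_ord0 addr0. Qed.

Lemma conv_cons f g x w :
  conv f g (x :: w) = f [::] * g (x :: w) + conv (fun u => f (x :: u)) g w.
Proof. by rewrite /conv big_ord_recl. Qed.

Lemma eq_conv f f' g g' w :
  (forall u, (size u <= size w)%N -> f u = f' u) ->
  (forall u, (size u <= size w)%N -> g u = g' u) ->
  conv f g w = conv f' g' w.
Proof.
move=> ff gg; apply: eq_bigr => i _; rewrite ff ?gg // ?size_drop ?leq_subr //.
by rewrite size_take_min geq_minr.
Qed.

Lemma convDl f1 f2 g w :
  conv (fun u => f1 u + f2 u) g w = conv f1 g w + conv f2 g w.
Proof.
by rewrite /conv -big_split; apply: eq_bigr => i _; rewrite mulrDl.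
Qed.

Lemma convDr f g1 g2 w :
  conv f (fun u => g1 u + g2 u) w = conv f g1 w + conv f g2 w.
Proof.
by rewrite /conv -big_split; apply: eq_bigr => i _; rewrite mulrDr.
Qed.

Lemma convZl c f g w : conv (fun u => c * f u) g w = c * conv f g w.
Proof. by rewrite /conv mulr_sumr; apply: eq_bigr => i _; rewrite mulrA. Qed.

Lemma convZr c f g w : conv f (fun u => c * g u) w = c * conv f g w.
Proof. by rewrite /conv mulr_sumr; apply: eq_bigr => i _; rewrite mulrCA. Qed.

Lemma convA f g h w : conv f (conv g h) w = conv (conv f g) h w.
Proof.
elim: w f => [|x w IH] f; first by rewrite !conv_nil mulrA.
rewrite !conv_cons conv_nil mulrDr mulrA -addrA; congr (_ + _).
rewrite IH -convZl -convDl; apply: eq_conv => // u _.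
by rewrite conv_cons.
Qed.

Lemma conv1l g w : conv (fun u => (nilp u)%:R) g w = g w.
Proof.
rewrite /conv big_ord_recl take0 drop0 mul1r big1 ?addr0 // => i _.
by case: w i => [|x w] [i ltiw] //=; rewrite mul0r.
Qed.

Lemma conv1r f w : conv f (fun u => (nilp u)%:R) w = f w.
Proof.
rewrite /conv big_ord_recr /= take_size drop_size mulr1 big1 ?add0r // => i _.
by rewrite /nilp size_drop subn_eq0 leqNgt ltn_ord mulr0.
Qed.

End ConvTheory.

Section TensorAlgebra.
Context {R : realType} {d N : nat}.
Local Notation TN := (tensor R d N).
Implicit Types (a b c : TN) (w : seq 'I_d).

HB.instance Definition _ := GRing.Lmodule.on TN.

Definition tcoef a w : R := if insub w is Some u then a u else 0.

Definition tone : TN := [ffun w : N.-bseq 'I_d => (nilp w)%:R].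
Definition tmul a b : TN :=
  [ffun w : N.-bseq 'I_d => conv (tcoef a) (tcoef b) w].

Lemma tcoefE a (w : N.-bseq 'I_d) : tcoef a w = a w.
Proof. by rewrite /tcoef valK. Qed.

Lemma tcoef_small (F : seq 'I_d -> R) w : (size w <= N)%N ->
  tcoef [ffun u : N.-bseq 'I_d => F u] w = F w.
Proof. by move=> sw; rewrite /tcoef insubT ffunE. Qed.

Lemma tensorP a b : (forall w, (size w <= N)%N -> tcoef a w = tcoef b w) ->
  a = b.
Proof.
by move=> ab; apply/ffunP => w; rewrite -!tcoefE ab // size_bseq.
Qed.

Lemma tcoefD a b w : tcoef (a + b) w = tcoef a w + tcoef b w.
Proof. by rewrite /tcoef; case: insub => [u|]; rewrite ?ffunE ?addr0. Qed.

Lemma tcoefZ k a w : tcoef (k *: a) w = k * tcoef a w.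
Proof. by rewrite /tcoef; case: insub => [u|]; rewrite ?ffunE ?mulr0. Qed.

Lemma tcoef_mul a b w : (size w <= N)%N ->
  tcoef (tmul a b) w = conv (tcoef a) (tcoef b) w.
Proof. exact: tcoef_small. Qed.

Lemma tcoef_one w : (size w <= N)%N -> tcoef tone w = (nilp w)%:R.
Proof. exact: (tcoef_small (fun w => (nilp w)%:R)). Qed.

Lemma tmulA : associative tmul.
Proof.
move=> a b c; apply: tensorP => w sw; rewrite !tcoef_mul //.
under [RHS]eq_conv => [u su|u _] do
  [rewrite tcoef_mul; last exact: leq_trans su sw| over].
under eq_conv => [u _|u su] do
  [over | rewrite tcoef_mul; last exact: leq_trans su sw].
exact: convA.
Qed.

Lemma tmul1l : left_id tone tmul.
Proof.
move=> a; apply: tensorP => w sw; rewrite tcoef_mul // -[RHS]conv1l.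
by apply: eq_conv => // u su; rewrite tcoef_one // (leq_trans su).
Qed.

Lemma tmul1r : right_id tone tmul.
Proof.
move=> a; apply: tensorP => w sw; rewrite tcoef_mul // -[RHS]conv1r.
by apply: eq_conv => // u su; rewrite tcoef_one // (leq_trans su).
Qed.

Lemma tmulDl : left_distributive tmul +%R.
Proof.
move=> a b c; apply: tensorP => w sw; rewrite tcoefD !tcoef_mul // -convDl.
by apply: eq_conv => // u _; rewrite tcoefD.
Qed.

Lemma tmulDr : right_distributive tmul +%R.
Proof.
move=> a b c; apply: tensorP => w sw; rewrite tcoefD !tcoef_mul // -convDr.
by apply: eq_conv => // u _; rewrite tcoefD.
Qed.

Lemma tone_neq0 : tone != 0.
Proof.
apply/eqP => /ffunP/(_ [bseq])/eqP; rewrite !ffunE /=.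
by rewrite oner_eq0.
Qed.

HB.instance Definition _ := GRing.Zmodule_isNzRing.Build TN
  tmulA tmul1l tmul1r tmulDl tmulDr tone_neq0.

Lemma tscaleAl (k : R) (a b : TN) : k *: (a * b) = (k *: a) * b.
Proof.
apply: tensorP => w sw; rewrite tcoefZ !tcoef_mul // -convZl.
by apply: eq_conv => // u _; rewrite tcoefZ.
Qed.

Lemma tscaleAr (k : R) (a b : TN) : k *: (a * b) = a * (k *: b).
Proof.
apply: tensorP => w sw; rewrite tcoefZ !tcoef_mul // -convZr.
by apply: eq_conv => // u _; rewrite tcoefZ.
Qed.

HB.instance Definition _ := GRing.Lmodule_isLalgebra.Build R TN tscaleAl.
HB.instance Definition _ := GRing.Lalgebra_isAlgebra.Build R TN tscaleAr.

Lemma tcoefM0 a b : tcoef (a * b) [::] = tcoef a [::] * tcoef b [::].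
Proof. by rewrite tcoef_mul // conv_nil. Qed.

Lemma tcoef1_0 : tcoef (1 : TN) [::] = 1.
Proof. exact: tcoef_one. Qed.

Lemma tcoefX_small a k w : tcoef a [::] = 0 -> (size w <= N)%N ->
  (size w < k)%N -> tcoef (a ^+ k) w = 0.
Proof.
move=> a0; elim: k w => [//|k IH] w sw swk.
rewrite exprS tcoef_mul // /conv big1 // => -[[|i] lti] _ /=.
  by rewrite take0 a0 mul0r.
have swd : (size (drop i.+1 w) < size w)%N.
  by rewrite size_drop ltn_subrL /=; case: (w) lti.
by rewrite IH ?mulr0 ?(leq_trans swd) // (leq_trans (ltnW swd)).
Qed.

Lemma texprS_eq0 a : tcoef a [::] = 0 -> a ^+ N.+1 = 0.
Proof.
move=> a0; apply: tensorP => w sw; rewrite tcoefX_small //.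
by rewrite /tcoef insubT ffunE.
Qed.

(* Invertible tensors are those with nonzero scalar part c, and the inverse   *)
(* is the Neumann series c^-1 (1 + z + ... + z^N), z = 1 - c^-1 a nilpotent.   *)
Definition tunit : pred TN := [pred a | tcoef a [::] != 0].
Definition tinv a : TN :=
  if tunit a then
    (tcoef a [::])^-1 *: \sum_(k < N.+1) (1 - (tcoef a [::])^-1 *: a) ^+ k
  else a.

Lemma tneumann a : tunit a ->
  let z := 1 - (tcoef a [::])^-1 *: a in
  (tcoef a [::])^-1 *: a * (\sum_(k < N.+1) z ^+ k) = 1 /\
  (\sum_(k < N.+1) z ^+ k) * ((tcoef a [::])^-1 *: a) = 1.
Proof.
move=> ua z; set y := _ *: a.
have z0 : tcoef z [::] = 0.
  by rewrite tcoefD -scaleN1r !tcoefZ tcoef1_0 mulVf // mulN1r subrr.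
have -> : y = 1 - z by rewrite /z opprB addrC subrK.
have e : (1 - z) * (\sum_(k < N.+1) z ^+ k) = 1.
  have := subrX1 z N.+1; rewrite texprS_eq0 // sub0r => /(congr1 -%R).
  by rewrite opprK -mulNr opprB.
split=> //; rewrite -[RHS]e; apply/commr_sym/commr_sum => k _.
by apply/commrX/commr_sym/commrB; [exact: commr1 | exact: commr_refl].
Qed.

Lemma tmulVr : {in tunit, left_inverse 1 tinv *%R}.
Proof.
move=> a ua; have [_ e] := tneumann ua.
by rewrite /tinv ifT // -scalerAl scalerAr.
Qed.

Lemma tdivrr : {in tunit, right_inverse 1 tinv *%R}.
Proof.
move=> a ua; have [e _] := tneumann ua.
by rewrite /tinv ifT // -scalerAr scalerAl.
Qed.

Lemma tunitP a b : b * a = 1 /\ a * b = 1 -> tunit a.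
Proof.
move=> [_ ab]; apply/negP => /eqP a0; have := tcoef1_0.
by rewrite -ab tcoefM0 a0 mul0r => /esym/eqP; rewrite oner_eq0.
Qed.

Lemma tinv_out : {in [predC tunit], tinv =1 id}.
Proof. by move=> a /negbTE ua; rewrite /tinv [tunit a]ua. Qed.

HB.instance Definition _ := GRing.NzRing_hasMulInverse.Build TN
  tmulVr tdivrr tunitP tinv_out.

End TensorAlgebra.

Section FreeNilpotentGroup.
Context {R : realType} (d N : nat).
Local Notation TN := (tensor R d N).

Definition lin_span (V : lmodType R) (A : set V) : set V :=
  [set v | exists (n : nat) (c : 'I_n -> R) (a : 'I_n -> V),
    (forall i, A (a i)) /\ v = \sum_i c i *: a i].

(* Inclusion R^d -> T^N(R^d); it is zero when N = 0.                          *)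
Definition tensor_of_vec (v : 'rV[R]_d) : TN :=
  [ffun w : N.-bseq 'I_d =>
    if bseqval w is [:: i] then v 0 i else (0 : R)].

Definition bracket (a b : TN) : TN := a * b - b * a.

(* lie_layer i is W_{i+1}.                                                    *)
Fixpoint lie_layer (i : nat) : set TN :=
  if i is j.+1 then
    lin_span [set bracket a b | a in range tensor_of_vec & b in lie_layer j]
  else range tensor_of_vec.

Definition free_nilpotent_lie : set TN :=
  [set x | exists w : 'I_N -> TN,
    (forall i : 'I_N, lie_layer i (w i)) /\ x = \sum_i w i].

(* The exponential series; terms of order > N vanish on free_nilpotent_lie.   *)
Definition texp (x : TN) : TN := \sum_(k < N.+1) (k`!%:R)^-1 *: x ^+ k.

Definition free_nilpotent_group : set TN := texp @` free_nilpotent_lie.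

End FreeNilpotentGroup.

Arguments lie_layer {R} d N i _.
Arguments free_nilpotent_lie {R} d N _.
Arguments free_nilpotent_group {R} d N _.

Section PathsAndSignatures.
Context {R : realType}.

(* A partition a = x_0 < ... < x_n = b is encoded as in itv_partition by      *)
(* s = [:: x_1; ...; x_n].                                                    *)
Definition part_pt (a : R) (s : seq R) (k : nat) : R := nth a (a :: s) k.

Definition is_RSint (f g : R -> R) (a b l : R) : Prop :=
  forall e : R, 0 < e -> exists2 delta : R, 0 < delta &
    forall (s : seq R) (xi : nat -> R), itv_partition a b s ->
      (forall k, (k < size s)%N ->
        part_pt a s k.+1 - part_pt a s k < delta /\
        part_pt a s k <= xi k <= part_pt a s k.+1) ->
      `|\sum_(0 <= k < size s)
          f (xi k) * (g (part_pt a s k.+1) - g (part_pt a s k)) - l| < e.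

Definition RSint (f g : R -> R) (a b : R) : R :=
  get [set l | is_RSint f g a b l].

Section VectorPaths.
Variable d : nat.
Implicit Types gamma : R -> 'rV[R]_d.

(* The norm of 'rV[R]_d in the library is the sup norm.                       *)
Definition eucl_norm (v : 'rV[R]_d) : R := Num.sqrt (\sum_i v 0 i ^+ 2).

Definition path_length (a b : R) gamma : \bar R :=
  ereal_sup [set (\sum_(0 <= k < size s)
    eucl_norm (gamma (part_pt a s k.+1) - gamma (part_pt a s k)))%:E
    | s in [set s | itv_partition a b s]].

Definition bv_path gamma : Prop :=
  {within `[0, 1], continuous gamma} /\ (path_length 0 1 gamma < +oo)%E.

(* iterated_int gamma (rev [:: i_1; ...; i_k]) t is the integral of           *)
(* dgamma^{i_1}(u_1) ... dgamma^{i_k}(u_k) over 0 < u_1 < ... < u_k < t: the   *)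
(* outermost integration is with respect to the last letter.                  *)
Fixpoint iterated_int gamma (w : seq 'I_d) (t : R) : R :=
  if w is i :: w' then
    RSint (iterated_int gamma w') (fun u => gamma u 0 i) 0 t
  else 1.

Definition signature (N : nat) gamma : tensor R d N :=
  [ffun w : N.-bseq 'I_d => iterated_int gamma (rev w) 1].

End VectorPaths.
End PathsAndSignatures.

Section MetricStructure.
Context {R : realType} {d N : nat}.
Local Notation TN := (tensor R d N).
Local Notation G := (@free_nilpotent_group R d N).

Definition cc_norm (g : TN) : R :=
  inf [set fine (path_length 0 1 gamma) | gamma in
        [set gamma : R -> 'rV[R]_d | bv_path gamma /\ signature N gamma = g]].

Definition cc_dist (g h : TN) : R := cc_norm (g^-1 * h).

Definition closed_normal_subgroup (K : set TN) : Prop :=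
  [/\ K `<=` G,
      K 1 /\ (forall g h, K g -> K h -> K (g * h)),
      forall g, K g -> K g^-1,
      forall g k, G g -> K k -> K (g * k * g^-1) &
      forall g, G g ->
        (forall e : R, 0 < e -> exists2 k, K k & cc_dist g k < e) -> K g].

(* Elements of G/K are the cosets gK, as subsets of T^N(R^d).                 *)
Definition quot_proj (K : set TN) (g : TN) : set TN := [set g * k | k in K].

Definition quot_group (K : set TN) : set (set TN) := quot_proj K @` G.

(* The group operations of G/K are the elementwise ones: since K is normal,   *)
(* (gK)^-1 = g^-1 K and (gK)(hK) = ghK.                                       *)
Definition coset_inv (A : set TN) : set TN := [set a^-1 | a in A].
Definition coset_mul (A B : set TN) : set TN :=
  [set a * b | a in A & b in B].

(* For A = gK this is the infimum over k in K of cc_norm (g * k).             *)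
Definition quot_norm (A : set TN) : R := inf [set cc_norm a | a in A].

Definition quot_dist (A B : set TN) : R :=
  quot_norm (coset_mul (coset_inv A) B).

End MetricStructure.

Section SobolevPaths.
Context {R : realType} {U : Type}.

Definition continuous_path (E : set U) (dist : U -> U -> R) (T : R)
    (f : R -> U) : Prop :=
  {in `[0, T], forall t, E (f t)} /\
  {in `[0, T], forall t, forall e : R, 0 < e ->
    exists2 delta : R, 0 < delta &
      {in `[0, T], forall s, `|s - t| < delta -> dist (f s) (f t) < e}}.

(* The continuous paths f : [0, T] -> E of class W^alpha_p, where E is a      *)
(* subset of U with metric dist; continuity subsumes measurability. The value *)
(* of f outside [0, T] is irrelevant, and so is the value of the integrand on *)
(* the diagonal (it is 0 there, as division by 0 yields 0).                   *)
Definition sobolev_path (E : set U) (dist : U -> U -> R) (alpha : R)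
    (p : \bar R) (T : R) (f : R -> U) : Prop :=
  continuous_path E dist T f /\
  match p with
  | q%:E =>
      (\int[(@lebesgue_measure R \x @lebesgue_measure R)%E]_(z in
          `[0%R, T] `*` `[0%R, T])
        ((dist (f z.1) (f z.2) `^ q) / (`|z.2 - z.1| `^ (alpha * q + 1)))%:E
        < +oo)%E
  | +oo%E => exists C : R, {in `[0, T] &, forall s t,
      dist (f s) (f t) <= C * `|t - s| `^ alpha}
  | -oo%E => False
  end.

End SobolevPaths.

(* Main.v *)
Require Import Defs.
From HB Require Import structures.
From mathcomp Require Import all_boot all_order all_algebra.
From mathcomp Require Import all_classical all_reals all_analysis.
From mathcomp Require Import measurable_realfun.
From mathcomp Require Import ring lra zify.

Set Implicit Arguments.
Unset Strict Implicit.
Unset Printing Implicit Defensive.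

Import Order.TTheory GRing.Theory Num.Theory.
Import numFieldNormedType.Exports.

Local Open Scope classical_set_scope.
Local Open Scope ring_scope.

(** Why the theorem holds. Let N be the integer part of 1 / alpha, G the free
   nilpotent group of step N, and nu the quasi-norm on G given by the largest
   |x_w| ^ (1 / |w|) over the coefficients x_w of the logarithm. It is equivalent
   to the Carnot-Caratheodory norm: an iterated integral over a word w is at most
   the length of the path to the power |w| (nu_le_cc_norm), and by Chow's theorem
   an element of G is a product of boundedly many exponentials of vectors of the
   size of nu (nu_generated, cc_norm_le_nu).

   The lift is built at dyadic times, level after level. Suppose that two
   consecutive points have been lifted, with increment g, and that X has
   increments of size b between them and their midpoint. Lifting the latter
   increments by elements h and h' of size b gives g = h h' k with k in K. As K is
   closed, a small k has the square root exp (log k / 2) in K, by Cartan's argument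
   (small_logset_tangent), and its quasi-norm is that of k divided by at least
   2 ^ (1 / N). Distributing this square root on both sides yields a lift of the
   midpoint with two increments of size at most max (lam nu g, C b), for any lam
   greater than 2 ^ (- 1 / N) (midpoint). Since 1 / alpha is greater than N, lam can
   be chosen smaller than 2 ^ (- alpha). The increments inherited from the coarse
   levels are then damped faster than the regularity alpha requires, and the
   increments of the lift are controlled like those of X: uniformly by
   2 ^ (- alpha n) at level n when p is infinite (recursion_sup), and through the
   sum over n and k of 2 ^ (n (alpha p - 1)) a_n(k) ^ p, where a_n(k) is the k-th
   increment of level n, when p is finite (recursion_sum).

   For finite p this needs a bound on the same sums for X. The double integral
   controls their average over the translates of the dyadic grid, hence their
   value on some translate of the grid (dyadic_sums). The path is reflected at
   the ends of [0, T] so that translates make sense, and the comparison is made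
   with step functions below the integrand, on finer and finer grids of cells.

   Finally the lift is extended from dyadic times to all times. The quasi-norm
   satisfies the triangle inequality only up to a constant, but the constant can
   be made close to 1 for one of the two factors (nuM_r, nuM_l). Consequently a
   chain of dyadic approximations converges and the distance to its limit is at
   most C (1 + e) ^ j times the j-th step, for some j (chain_limit). So the distance
   of two values of the lift at times of distance about 2 ^ (- n) is controlled by a
   single increment, at a level m >= n and next to one of the two times, up to a
   factor (1 + e) ^ (m - n) (bin_limit_dist). For infinite p this is the Hoelder
   bound; for finite p it bounds the integrand by step functions whose integrals
   add up to the sums above (lift_sobolev). The limit lies over X because X is
   continuous and K is closed (path_lift). *)

(** * The degree filtration and the exponential *)

Section Filtration.
Context {R : realType} {d N : nat}.
Local Notation TN := (tensor R d N).
Implicit Types (a b c x y g h u : TN) (w : seq 'I_d) (k j : nat) (t l : R).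

Lemma tscaleA l t a : l *: (t *: a) = (l * t) *: a.
Proof. exact: scalerA. Qed.

Lemma tscale_nat n a : a *+ n = n%:R *: a.
Proof. by rewrite scaler_nat. Qed.

Lemma tcoef_big a w : (N < size w)%N -> tcoef a w = 0.
Proof. by move=> sw; rewrite /tcoef insubF // leqNgt sw. Qed.

Lemma tcoef0 w : tcoef (0 : TN) w = 0.
Proof. by rewrite /tcoef; case: insub => [u|//]; rewrite ffunE. Qed.

Lemma tcoefN a w : tcoef (- a) w = - tcoef a w.
Proof. by rewrite -scaleN1r tcoefZ mulN1r. Qed.

Lemma tcoefB a b w : tcoef (a - b) w = tcoef a w - tcoef b w.
Proof. by rewrite tcoefD tcoefN. Qed.

Lemma tcoef_sum (J : Type) (r : seq J) (P : pred J) (F : J -> TN) w :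
  tcoef (\sum_(i <- r | P i) F i) w = \sum_(i <- r | P i) tcoef (F i) w.
Proof.
by elim/big_rec2: _ => [|i u v _ <-]; rewrite ?tcoef0 ?tcoefD.
Qed.

(** The words of length less than k have coefficient 0: this is the k-th power of
   the augmentation ideal, which vanishes for k > N. *)
Definition hdeg k a := forall w, (size w < k)%N -> tcoef a w = 0.

Lemma hdeg_le j k a : (j <= k)%N -> hdeg k a -> hdeg j a.
Proof. by move=> jk ha w sw; apply/ha/(leq_trans sw). Qed.

Lemma hdeg0 k : hdeg k 0.
Proof. by move=> w _; rewrite tcoef0. Qed.

Lemma hdegD k a b : hdeg k a -> hdeg k b -> hdeg k (a + b).
Proof. by move=> ha hb w sw; rewrite tcoefD ha ?hb ?addr0. Qed.

Lemma hdegZ k l a : hdeg k a -> hdeg k (l *: a).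
Proof. by move=> ha w sw; rewrite tcoefZ ha ?mulr0. Qed.

Lemma hdegN k a : hdeg k a -> hdeg k (- a).
Proof. by rewrite -scaleN1r; exact: hdegZ. Qed.

Lemma hdegB k a b : hdeg k a -> hdeg k b -> hdeg k (a - b).
Proof. by move=> ha hb; apply/hdegD => //; exact: hdegN. Qed.

Lemma hdeg_sum k (J : Type) (r : seq J) (P : pred J) (F : J -> TN) :
  (forall i, P i -> hdeg k (F i)) -> hdeg k (\sum_(i <- r | P i) F i).
Proof.
by move=> hF; elim/big_ind: _ => //; [exact: hdeg0 | exact: hdegD].
Qed.

Lemma hdegM i j a b : hdeg i a -> hdeg j b -> hdeg (i + j) (a * b).
Proof.
move=> ha hb w sw; case: (leqP (size w) N) => [sN|]; last exact: tcoef_big.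
rewrite tcoef_mul // /Defs.conv big1 // => l _.
case: (ltnP (size (take l w)) i) => [h|h]; first by rewrite ha ?mul0r.
by rewrite hb ?mulr0 // size_drop; move: h; rewrite size_take; case: ifP; lia.
Qed.

Lemma hdegMl k a b : hdeg k a -> hdeg k (a * b).
Proof. by move=> ha; rewrite -[k]addn0; apply: hdegM. Qed.

Lemma hdegMr k a b : hdeg k b -> hdeg k (a * b).
Proof. by move=> hb; rewrite -[k]add0n; apply: hdegM. Qed.

Lemma hdegX k a : hdeg 1 a -> hdeg k (a ^+ k).
Proof.
move=> ha; elim: k => [//|k IH].
by rewrite exprS -add1n; exact: hdegM.
Qed.

Lemma hdeg_eq0 k a : (N < k)%N -> hdeg k a -> a = 0.
Proof.
move=> Nk ha; apply: tensorP => w sw.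
by rewrite ha ?tcoef0 // (leq_ltn_trans sw).
Qed.

Lemma hdeg1P a : hdeg 1 a <-> tcoef a [::] = 0.
Proof. by split=> [ha|a0 [|//]//]; rewrite ha. Qed.

(** Cauchy products of truncated series: the terms beyond the triangle vanish by
   degree. *)
Lemma sum_triangle (V : nmodType) n (F : nat -> nat -> V) :
  (forall i j, (n <= i + j)%N -> F i j = 0) ->
  \sum_(m < n) \sum_(i < m.+1) F i (m - i)%N = \sum_(i < n) \sum_(j < n) F i j.
Proof.
move=> F0.
transitivity (\sum_(m < n) \sum_(i < n | (i <= m)%N) F i (m - i)%N).
  apply: eq_bigr => m _.
  by rewrite (big_ord_widen n (fun i => F i (m - i)%N)).
rewrite (exchange_big_dep predT) //=; apply: eq_bigr => i _.
rewrite -(big_mkord (fun m => (i <= m)%N) (fun m => F i (m - i)%N)).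
rewrite -(big_mkord predT (F i)).
rewrite (big_cat_nat (n := i)) //=; last exact: ltnW.
rewrite big_nat_cond big1 ?add0r; last by move=> m; lia.
rewrite [RHS](big_cat_nat (n := (n - i)%N)) //=; last exact: leq_subr.
rewrite [X in _ = _ + X]big_nat_cond [X in _ = _ + X]big1 ?addr0; last first.
  by move=> m mn; apply: F0; lia.
rewrite -{1}[val i]add0n big_addn big_mkcond /=; apply: eq_bigr => m _.
by rewrite leq_addl addnK.
Qed.

Lemma texpE m x : (N < m)%N -> hdeg 1 x ->
  texp x = \sum_(k < m) (k`!%:R)^-1 *: x ^+ k.
Proof.
move=> Nm hx; rewrite /texp (big_ord_widen m (fun k => (k`!%:R)^-1 *: x ^+ k)) //.
rewrite big_mkcond; apply: eq_bigr => k _; case: ltnP => // Nk.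
by rewrite (hdeg_eq0 _ (hdegX (k := k) hx)) ?scaler0.
Qed.

Lemma texp0 : texp (0 : TN) = 1.
Proof.
rewrite /texp big_ord_recl big1 ?addr0; last first.
  by move=> i _; rewrite expr0n /= scaler0.
by rewrite fact0 invr1 scale1r expr0.
Qed.

Lemma fact_neq0 k : (k`!%:R : R) != 0.
Proof. by rewrite pnatr_eq0 -lt0n fact_gt0. Qed.

Lemma texpD x y : hdeg 1 x -> hdeg 1 y -> x * y = y * x ->
  texp (x + y) = texp x * texp y.
Proof.
move=> hx hy xy.
pose F i j : TN := ((i`!%:R)^-1 *: x ^+ i) * ((j`!%:R)^-1 *: y ^+ j).
transitivity (\sum_(m < N.+1) \sum_(i < m.+1) F i (m - i)%N); last first.
  rewrite sum_triangle; last first.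
    move=> i j ij; apply: (@hdeg_eq0 (i + j)%N) => //.
    by apply: hdegM; apply: hdegZ; exact: hdegX.
  by rewrite /texp mulr_suml; apply: eq_bigr => i _; rewrite mulr_sumr.
have cyx : GRing.comm y x by [].
apply: eq_bigr => m _; rewrite addrC exprDn_comm //.
rewrite scaler_sumr; apply: eq_bigr => i _.
rewrite /F -tscaleAl -tscaleAr tscaleA.
have -> : x ^+ i * y ^+ (m - i) = y ^+ (m - i) * x ^+ i.
  by apply/commrX/commr_sym/commrX.
rewrite tscale_nat tscaleA; congr (_ *: _).
have im : (i <= m)%N by rewrite -ltnS.
have := bin_fact im => /(congr1 (fun n => n%:R : R)); rewrite !natrM => e.
have := fact_neq0 m; rewrite -e !mulf_eq0 !negb_or => /and3P[h1 h2 h3].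
by field; rewrite h1 h2 h3.
Qed.

Lemma texp_coef0 x : hdeg 1 x -> tcoef (texp x) [::] = 1.
Proof.
move=> hx; rewrite /texp big_ord_recl tcoefD fact0 invr1 scale1r expr0 tcoef1_0.
rewrite tcoef_sum big1 ?addr0 // => i _.
by rewrite tcoefZ (hdegX (k := i.+1)) ?mulr0.
Qed.

Lemma texpS x l t : hdeg 1 x -> texp ((l + t) *: x) = texp (l *: x) * texp (t *: x).
Proof.
move=> hx; rewrite scalerDl texpD //; [exact: hdegZ|exact: hdegZ|].
by rewrite -!tscaleAl -!tscaleAr !tscaleA mulrC.
Qed.

Lemma texpK x : hdeg 1 x -> texp x * texp (- x) = 1.
Proof.
move=> hx; rewrite -texpD ?subrr ?texp0 //; first exact: hdegN.
by rewrite mulrN mulNr.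
Qed.

Lemma texpNK x : hdeg 1 x -> texp (- x) * texp x = 1.
Proof.
by move=> hx; rewrite -{2}[x]opprK texpK //; exact: hdegN.
Qed.

Lemma texp_unit x : hdeg 1 x -> texp x \is a GRing.unit.
Proof. by move=> hx; apply/unitrP; exists (texp (- x)); rewrite texpK ?texpNK. Qed.

Lemma texpV x : hdeg 1 x -> (texp x)^-1 = texp (- x).
Proof.
by move=> hx; apply: (mulrI (texp_unit hx)); rewrite texpK // divrr // texp_unit.
Qed.

Lemma texpX x n : hdeg 1 x -> texp x ^+ n = texp (n%:R *: x).
Proof.
move=> hx; elim: n => [|n IH]; first by rewrite expr0 scale0r texp0.
by rewrite exprSr IH -[in RHS]addn1 natrD texpS // scale1r.
Qed.

Lemma exprD_hdeg k j x y : (0 < k)%N -> hdeg 1 x -> hdeg k y ->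
  hdeg (k + j) ((x + y) ^+ j.+1 - x ^+ j.+1).
Proof.
move=> k0 hx hy; elim: j => [|j IH]; first by rewrite !expr1 addrC addKr addn0.
have -> : (x + y) ^+ j.+2 - x ^+ j.+2 =
    (x + y) * ((x + y) ^+ j.+1 - x ^+ j.+1) + y * x ^+ j.+1.
  by rewrite mulrBr -exprS mulrDl -exprS opprD addrA subrK.
apply: hdegD; last by apply: hdegM => //; exact: hdegX.
rewrite addnS -add1n; apply: hdegM => //; apply: hdegD => //.
exact: hdeg_le hy.
Qed.

(** To first order in the degree filtration texp is a translation. This triangular
   form gives its injectivity and the convergence of the Newton-like iteration
   below, so that the logarithmic series can be avoided. *)
Lemma texp_triangular k x y : (0 < k)%N -> hdeg 1 x -> hdeg k y ->
  hdeg k.+1 (texp (x + y) - texp x - y).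
Proof.
move=> k0 hx hy.
rewrite !(@texpE N.+2) //; last by apply: hdegD => //; exact: hdeg_le hy.
rewrite -sumrB big_ord_recl big_ord_recl /= !expr0 subrr add0r !expr1.
rewrite -scalerBr invr1 scale1r [x + y]addrC addrK addrAC subrr add0r.
apply: hdeg_sum => j _; rewrite -scalerBr; apply: hdegZ.
by rewrite [y + x]addrC; apply: hdeg_le (exprD_hdeg (j := j.+1) _ hx hy) => //; lia.
Qed.

(** Each step corrects the error in one more degree, so N steps invert texp. *)
Fixpoint tlog_iter n g : TN :=
  if n is m.+1 then let y := tlog_iter m g in y + (g - texp y) else 0.

Definition tlog g := tlog_iter N g.

Lemma tlog_iterP n g : tcoef g [::] = 1 ->
  hdeg 1 (tlog_iter n g) /\ hdeg n.+1 (texp (tlog_iter n g) - g).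
Proof.
move=> g1; elim: n => [|n [IH1 IH2]] /=.
  by split; [exact: hdeg0|apply/hdeg1P; rewrite texp0 tcoefB tcoef1_0 g1 subrr].
have h : hdeg n.+1 (g - texp (tlog_iter n g)) by rewrite -opprB; exact: hdegN.
split; first by apply: hdegD => //; exact: hdeg_le h.
have := texp_triangular (ltn0Sn n) IH1 h.
by move: (texp _) (texp _) => a b; rewrite opprB addrA subrK.
Qed.

Lemma tlog_hdeg g : tcoef g [::] = 1 -> hdeg 1 (tlog g).
Proof. by move=> g1; case: (tlog_iterP N g1). Qed.

Lemma tlogK g : tcoef g [::] = 1 -> texp (tlog g) = g.
Proof.
move=> g1; case: (tlog_iterP N g1) => _ h; apply/eqP; rewrite -subr_eq0.
by apply/eqP; exact: hdeg_eq0 h.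
Qed.

Lemma texp_inj x y : hdeg 1 x -> hdeg 1 y -> texp x = texp y -> x = y.
Proof.
move=> hx hy e; suff h k : hdeg k.+1 (x - y).
  by apply/eqP; rewrite -subr_eq0; apply/eqP; exact: (@hdeg_eq0 N.+1).
elim: k => [|k IH]; first exact: hdegB.
have := texp_triangular (ltn0Sn k) hy IH.
by rewrite [y + _]addrC subrK e subrr sub0r => /hdegN; rewrite opprK.
Qed.

Lemma texpKlog x : hdeg 1 x -> tlog (texp x) = x.
Proof.
move=> hx; have e := texp_coef0 hx.
by apply: texp_inj => //; [exact: tlog_hdeg|rewrite tlogK].
Qed.

End Filtration.

(** * Norm, Lipschitz estimates and dilations *)

(** The factor N + 1 makes the sup norm submultiplicative: a coefficient of a
   product is a sum of at most N + 1 products of coefficients. *)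
HB.lock Definition tnorm (R : realType) (d N : nat) (a : tensor R d N) : R :=
  N.+1%:R * \big[Num.max/0]_(w : N.-bseq 'I_d) `|a w|.

Ltac tlin := apply: tensorP => ? _;
  rewrite !(tcoefD, tcoefN, tcoefZ, tcoef0); ring.

Section Norm.
Context {R : realType} {d N : nat}.
Local Notation TN := (tensor R d N).
Implicit Types (a b c x y g h u : TN) (w : seq 'I_d) (k j : nat) (B C t l : R).

Lemma tnorm_le a C : 0 <= C ->
  (forall w, (size w <= N)%N -> `|tcoef a w| <= C) -> tnorm a <= N.+1%:R * C.
Proof.
move=> C0 h; rewrite tnorm.unlock ler_pM2l ?ltr0n //.
apply: bigmax_le => // w _; rewrite -tcoefE; exact/h/size_bseq.
Qed.

Lemma tnorm_ge0 a : 0 <= tnorm a.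
Proof.
rewrite tnorm.unlock mulr_ge0 //.
by elim/big_ind: _ => // x y x0 y0; rewrite le_max x0.
Qed.

Lemma tcoef_le_tnormM a w : N.+1%:R * `|tcoef a w| <= tnorm a.
Proof.
rewrite tnorm.unlock ler_pM2l ?ltr0n // /tcoef; case: insubP => [u _ _|_].
  exact: (le_bigmax (0 : R) (fun v : N.-bseq 'I_d => `|a v|) u).
by rewrite normr0; elim/big_ind: _ => // x y x0 y0; rewrite le_max x0.
Qed.

Lemma tcoef_le_tnorm a w : `|tcoef a w| <= tnorm a.
Proof.
apply: le_trans (tcoef_le_tnormM a w); rewrite ler_peMl //.
by rewrite ler1n.
Qed.

Lemma tnorm_leP a C : 0 <= C ->
  (forall w, (size w <= N)%N -> N.+1%:R * `|tcoef a w| <= C) -> tnorm a <= C.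
Proof.
move=> C0 h; have N0 : 0 < N.+1%:R :> R by rewrite ltr0n.
have -> : C = N.+1%:R * (N.+1%:R^-1 * C) by rewrite mulVKf ?gt_eqF.
apply: tnorm_le => [|w sw]; first by rewrite mulr_ge0 // invr_ge0 ltW.
by rewrite ler_pdivlMl // h.
Qed.

Lemma tnorm0 : tnorm (0 : TN) = 0.
Proof.
apply/eqP; rewrite eq_le tnorm_ge0 andbT; apply: tnorm_leP => // w _.
by rewrite tcoef0 normr0 mulr0.
Qed.

Lemma tnormD a b : tnorm (a + b) <= tnorm a + tnorm b.
Proof.
apply: tnorm_leP => [|w _]; first by rewrite addr_ge0 ?tnorm_ge0.
rewrite tcoefD (le_trans (ler_wpM2l _ (ler_normD _ _))) // mulrDr.
by rewrite lerD // tcoef_le_tnormM.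
Qed.

Lemma tnormZ l a : tnorm (l *: a) = `|l| * tnorm a.
Proof.
have le (m : R) x : tnorm (m *: x) <= `|m| * tnorm x.
  apply: tnorm_leP => [|w _]; first by rewrite mulr_ge0 ?tnorm_ge0.
  by rewrite tcoefZ normrM mulrCA ler_wpM2l // tcoef_le_tnormM.
apply/eqP; rewrite eq_le le /=; have [->|l0] := eqVneq l 0.
  by rewrite normr0 mul0r tnorm_ge0.
rewrite -ler_pdivlMl ?normr_gt0 // -normfV (le_trans _ (le _ _)) //.
by rewrite tscaleA mulVf // scale1r.
Qed.

Lemma tnormN a : tnorm (- a) = tnorm a.
Proof. by rewrite -scaleN1r tnormZ normrN1 mul1r. Qed.

Lemma tnormB a b : tnorm (a - b) <= tnorm a + tnorm b.
Proof. by rewrite (le_trans (tnormD _ _)) // tnormN. Qed.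

Lemma tnormC a b : tnorm (a - b) = tnorm (b - a).
Proof. by rewrite -tnormN opprB. Qed.

Lemma tnorm_trans b a c : tnorm (a - c) <= tnorm (a - b) + tnorm (b - c).
Proof.
have -> : a - c = (a - b) + (b - c) by rewrite addrA subrK.
exact: tnormD.
Qed.

Lemma tnormM a b : tnorm (a * b) <= tnorm a * tnorm b.
Proof.
apply: tnorm_leP => [|w sw]; first by rewrite mulr_ge0 ?tnorm_ge0.
rewrite tcoef_mul // /Defs.conv.
have N0 : 0 < N.+1%:R :> R by rewrite ltr0n.
pose q := N.+1%:R^-1 * tnorm a * (N.+1%:R^-1 * tnorm b).
have q0 : 0 <= q.
  by do !apply: mulr_ge0; rewrite ?tnorm_ge0 ?invr_ge0 ?ler0n.
apply: (@le_trans _ _ (N.+1%:R * \sum_(i < (size w).+1) q)).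
  rewrite ler_wpM2l ?ler0n //; apply: (le_trans (ler_norm_sum _ _ _)).
  apply: ler_sum => i _.
  by rewrite normrM ler_pM // ler_pdivlMl // tcoef_le_tnormM.
rewrite sumr_const card_ord -(mulr_natr q).
apply: (@le_trans _ _ (N.+1%:R * (q * N.+1%:R))).
  by rewrite ler_pM2l // ler_wpM2l // ler_nat ltnS.
rewrite /q; have := lt0r_neq0 N0; move: (N.+1%:R : R) => m m0.
by rewrite le_eqVlt; apply/orP; left; apply/eqP; field.
Qed.

(** It holds for polynomial maps, hence for the exponential and the logarithm;
   estimates on balls are then spread to the whole group by dilations. *)
Definition locLip (F : TN -> TN) := forall B, exists2 C, 0 <= C &
  forall x y, tnorm x <= B -> tnorm y <= B ->
    tnorm (F x - F y) <= C * tnorm (x - y).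

Lemma locLip_bounded F B : locLip F ->
  exists2 C, 0 <= C & forall x, tnorm x <= B -> tnorm (F x) <= C.
Proof.
move=> /(_ (Num.max B 0))[C C0 hC].
exists (tnorm (F 0) + C * Num.max B 0).
  by rewrite addr_ge0 ?tnorm_ge0 // mulr_ge0 // le_max lexx orbT.
move=> x xB; have := hC x 0; rewrite subr0 tnorm0 !le_max xB lexx orbT.
move=> /(_ isT isT) h; have -> : F x = F 0 + (F x - F 0) by rewrite addrC subrK.
rewrite (le_trans (tnormD _ _)) // lerD2l (le_trans h) // ler_wpM2l //.
by rewrite le_max xB.
Qed.

Lemma locLip_cst a : locLip (fun=> a).
Proof. by move=> B; exists 0 => // x y _ _; rewrite subrr tnorm0 mul0r. Qed.

Lemma locLip_id : locLip id.
Proof. by move=> B; exists 1 => // x y _ _; rewrite mul1r. Qed.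

Lemma locLipD F G : locLip F -> locLip G -> locLip (fun x => F x + G x).
Proof.
move=> hF hG B; have [C C0 hC] := hF B; have [D D0 hD] := hG B.
exists (C + D) => [|x y xB yB]; first exact: addr_ge0.
rewrite opprD addrACA (le_trans (tnormD _ _)) // mulrDl.
by rewrite lerD ?hC ?hD.
Qed.

Lemma locLipZ l F : locLip F -> locLip (fun x => l *: F x).
Proof.
move=> hF B; have [C C0 hC] := hF B.
exists (`|l| * C) => [|x y xB yB]; first by rewrite mulr_ge0.
by rewrite -scalerBr tnormZ -mulrA ler_wpM2l // hC.
Qed.

Lemma locLipM F G : locLip F -> locLip G -> locLip (fun x => F x * G x).
Proof.
move=> hF hG B; have [C C0 hC] := hF B; have [D D0 hD] := hG B.
have [BF BF0 hBF] := locLip_bounded B hF.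
have [BG BG0 hBG] := locLip_bounded B hG.
exists (C * BG + BF * D) => [|x y xB yB]; first by rewrite addr_ge0 ?mulr_ge0.
have -> : F x * G x - F y * G y = (F x - F y) * G x + F y * (G x - G y).
  by rewrite mulrBl mulrBr addrA subrK.
rewrite (le_trans (tnormD _ _)) // [leRHS]mulrDl lerD //.
  by rewrite (le_trans (tnormM _ _)) // mulrAC ler_pM ?tnorm_ge0 ?hC ?hBG.
by rewrite (le_trans (tnormM _ _)) // -mulrA ler_pM ?tnorm_ge0 ?hD ?hBF.
Qed.

Lemma locLip_comp F G : locLip F -> locLip G -> locLip (fun x => F (G x)).
Proof.
move=> hF hG B; have [BG BG0 hBG] := locLip_bounded B hG.
have [C C0 hC] := hF BG; have [D D0 hD] := hG B.
exists (C * D) => [|x y xB yB]; first exact: mulr_ge0.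
rewrite (le_trans (hC _ _ _ _)) ?hBG // -mulrA ler_wpM2l //; exact: hD.
Qed.

Lemma locLip_sum n (F : 'I_n -> TN -> TN) : (forall i, locLip (F i)) ->
  locLip (fun x => \sum_(i < n) F i x).
Proof.
elim: n F => [|n IH] F hF.
  have -> : (fun x => \sum_(i < 0) F i x) = (fun=> 0).
    by apply/funext => x; rewrite big_ord0.
  exact: locLip_cst.
have -> : (fun x => \sum_(i < n.+1) F i x) =
    (fun x => F ord0 x + \sum_(i < n) F (lift ord0 i) x).
  by apply/funext => x; rewrite big_ord_recl.
by apply: locLipD => //; apply: IH => i.
Qed.

Lemma locLipX k : locLip (fun x => x ^+ k).
Proof.
elim: k => [|k IH].
  have -> : (fun x : TN => x ^+ 0) = (fun=> 1) by apply/funext => x; rewrite expr0.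
  exact: locLip_cst.
have -> : (fun x : TN => x ^+ k.+1) = (fun x => x * x ^+ k).
  by apply/funext => x; rewrite exprS.
by apply: locLipM => //; exact: locLip_id.
Qed.

Lemma locLip_texp : locLip (@texp R d N).
Proof. by apply: locLip_sum => i; apply: locLipZ; exact: locLipX. Qed.

Lemma locLip_tlog : locLip tlog.
Proof.
suff h n : locLip (@tlog_iter R d N n) by exact: h.
elim: n => [|n IH] /=; first exact: locLip_cst.
apply: locLipD => //; apply: locLipD; first exact: locLip_id.
have -> : (fun x => - texp (tlog_iter n x)) =
    (fun x => (-1) *: texp (tlog_iter n x)).
  by apply/funext => x; rewrite scaleN1r.
by apply: locLipZ; apply: locLip_comp => //; exact: locLip_texp.
Qed.

Lemma tlog1 : tlog (1 : TN) = 0.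
Proof. by rewrite -texp0 texpKlog //; exact: hdeg0. Qed.

Lemma texp_taylor2 B : exists2 C, 0 <= C & forall x, hdeg 1 x -> tnorm x <= B ->
  tnorm (texp x - (1 + x)) <= C * tnorm x ^+ 2.
Proof.
pose F x : TN := \sum_(k < N) (k.+2`!%:R)^-1 *: x ^+ k.
have hF : locLip F by apply: locLip_sum => i; apply: locLipZ; exact: locLipX.
have [C C0 hC] := locLip_bounded B hF; exists C => // x hx xB.
have -> : texp x - (1 + x) = F x * x ^+ 2.
  rewrite (@texpE _ _ _ N.+2) // big_ord_recl big_ord_recl /= !expr0 expr1.
  rewrite fact0 !invr1 !scale1r addrA [_ + _ - _]addrC addKr /F mulr_suml.
  by apply: eq_bigr => i _; rewrite -tscaleAl -exprD addn2.
rewrite (le_trans (tnormM _ _)) // ler_pM ?tnorm_ge0 ?hC // expr2.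
exact: tnormM.
Qed.

(** The infinitesimal form of the Trotter product formula: to first order, the
   group product is the sum of the logarithms. *)
Lemma tlog_texpM B : 0 <= B -> exists2 C, 0 <= C & forall x y, hdeg 1 x -> hdeg 1 y ->
  tnorm x <= B -> tnorm y <= B ->
  tnorm (tlog (texp x * texp y) - (x + y)) <= C * (tnorm x + tnorm y) ^+ 2.
Proof.
move=> B0; have [D D0 hD] := locLip_bounded (B + B) locLip_texp.
have [L L0 hL] := locLip_tlog (D * D + D).
have [C C0 hC] := texp_taylor2 (B + B).
pose e := tnorm (1 : TN); have e0 : 0 <= e := tnorm_ge0 _.
exists (L * (C * D + (e + B) * C + 1 + C)) => [|x y hx hy xB yB].
  by rewrite mulr_ge0 // !addr_ge0 ?mulr_ge0 // addr_ge0.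
have hxy : hdeg 1 (x + y) by exact: hdegD.
have xyB : tnorm (x + y) <= B + B by rewrite (le_trans (tnormD _ _)) ?lerD.
have xBB : tnorm x <= B + B by rewrite (le_trans xB) ?lerDl.
have yBB : tnorm y <= B + B by rewrite (le_trans yB) ?lerDl.
have := texpKlog hxy; set h := texp (x + y) => eh.
rewrite -[X in tnorm (_ - X)]eh; set g := _ * _.
have hB : tnorm h <= D * D + D.
  by rewrite (le_trans (hD _ xyB)) // lerDr mulr_ge0.
have gB : tnorm g <= D * D + D.
  rewrite (le_trans (tnormM _ _)) // (@le_trans _ _ (D * D)) ?lerDl //.
  by rewrite ler_pM ?tnorm_ge0 ?hD.
rewrite (le_trans (hL _ _ gB hB)) // -mulrA ler_wpM2l //.
have -> : g - h = (texp x - (1 + x)) * texp y +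
    ((1 + x) * (texp y - (1 + y)) + (x * y - (h - (1 + (x + y))))).
  by rewrite /g !(mulrDl, mulrDr, mulrN, mulNr, mulr1, mul1r); tlin.
set X := tnorm x; set Y := tnorm y.
have X0 : 0 <= X := tnorm_ge0 x; have Y0 : 0 <= Y := tnorm_ge0 y.
have X2 : X ^+ 2 <= (X + Y) ^+ 2 by rewrite lerXn2r ?nnegrE ?addr_ge0 // lerDl.
have Y2 : Y ^+ 2 <= (X + Y) ^+ 2 by rewrite lerXn2r ?nnegrE ?addr_ge0 // lerDr.
set S := (X + Y) ^+ 2 in X2 Y2 *.
have h1 : tnorm ((texp x - (1 + x)) * texp y) <= C * S * D.
  rewrite (le_trans (tnormM _ _)) // ler_pM ?tnorm_ge0 ?hD //.
  by rewrite (le_trans (hC _ _ _)) // ler_wpM2l.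
have h2 : tnorm ((1 + x) * (texp y - (1 + y))) <= (e + B) * (C * S).
  rewrite (le_trans (tnormM _ _)) // ler_pM ?tnorm_ge0 //.
    by rewrite (le_trans (tnormD _ _)) // lerD2l.
  by rewrite (le_trans (hC _ _ _)) // ler_wpM2l.
have h3 : tnorm (x * y) <= S.
  rewrite (le_trans (tnormM _ _)) // -/X -/Y /S; nra.
have h4 : tnorm (h - (1 + (x + y))) <= C * S.
  rewrite (le_trans (hC _ hxy xyB)) // ler_wpM2l //.
  by rewrite lerXn2r ?nnegrE ?tnorm_ge0 ?addr_ge0 // tnormD.
rewrite (le_trans (tnormD _ _)) //; apply: (le_trans (lerD h1 (tnormD _ _))).
apply: (le_trans (lerD (lexx _) (lerD h2 (tnormB _ _)))).
apply: (le_trans (lerD (lexx _) (lerD (lexx _) (lerD h3 h4)))).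
by rewrite le_eqVlt; apply/orP; left; apply/eqP; ring.
Qed.

(** An algebra endomorphism, by which estimates near the identity are transported
   to the whole group. *)
Definition dil l a : TN := [ffun w : N.-bseq 'I_d => l ^+ size w * a w].

Lemma tcoef_dil l a w : tcoef (dil l a) w = l ^+ size w * tcoef a w.
Proof.
rewrite /tcoef; case: insubP => [u _ <-|_]; last by rewrite mulr0.
by rewrite ffunE.
Qed.

Lemma dilD l a b : dil l (a + b) = dil l a + dil l b.
Proof. by apply: tensorP => w _; rewrite tcoefD !tcoef_dil tcoefD mulrDr. Qed.

Lemma dilZ l t a : dil l (t *: a) = t *: dil l a.
Proof. by apply: tensorP => w _; rewrite tcoefZ !tcoef_dil tcoefZ mulrCA. Qed.

Lemma dil0 l : dil l 0 = 0.
Proof. by apply: tensorP => w _; rewrite tcoef_dil !tcoef0 mulr0. Qed.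

Lemma dil1 l : dil l 1 = 1.
Proof.
apply: tensorP => w sw; rewrite tcoef_dil tcoef_one //.
by case: w sw => [|i w] _ /=; rewrite ?expr0 ?mulr1 ?mulr0.
Qed.

Lemma dilM l a b : dil l (a * b) = dil l a * dil l b.
Proof.
apply: tensorP => w sw; rewrite tcoef_dil !tcoef_mul // /Defs.conv mulr_sumr.
apply: eq_bigr => i _; rewrite !tcoef_dil mulrACA -exprD -size_cat.
by rewrite cat_take_drop.
Qed.

Lemma dilX l a k : dil l (a ^+ k) = dil l a ^+ k.
Proof. by elim: k => [|k IH]; rewrite ?expr0 ?dil1 // !exprS dilM IH. Qed.

Lemma dil_sum l (J : Type) (r : seq J) (P : pred J) (F : J -> TN) :
  dil l (\sum_(i <- r | P i) F i) = \sum_(i <- r | P i) dil l (F i).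
Proof. by elim/big_rec2: _ => [|i u v _ <-]; rewrite ?dil0 ?dilD. Qed.

Lemma dil_texp l x : dil l (texp x) = texp (dil l x).
Proof. by rewrite dil_sum; apply: eq_bigr => i _; rewrite dilZ dilX. Qed.

Lemma hdeg_dil k l a : hdeg k a -> hdeg k (dil l a).
Proof. by move=> ha w sw; rewrite tcoef_dil ha ?mulr0. Qed.

Lemma dil_dil l t a : dil l (dil t a) = dil (l * t) a.
Proof. by apply: tensorP => w _; rewrite !tcoef_dil exprMn mulrA. Qed.

Lemma dil_1 a : dil 1 a = a.
Proof. by apply: tensorP => w _; rewrite tcoef_dil expr1n mul1r. Qed.

Lemma dil_tlog l g : tcoef g [::] = 1 -> tlog (dil l g) = dil l (tlog g).
Proof.
move=> g1; have h := tlog_hdeg g1.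
by rewrite -[in LHS](tlogK g1) dil_texp texpKlog //; exact: hdeg_dil.
Qed.

End Norm.

(** * The free nilpotent Lie algebra and its group *)

Section Lie.
Context {R : realType} {d N : nat}.
Local Notation TN := (tensor R d N).
Local Notation lie := (@free_nilpotent_lie R d N).
Local Notation G := (@free_nilpotent_group R d N).
Local Notation layer := (@lie_layer R d N).
Implicit Types (a b c x y z g h u : TN) (w : seq 'I_d) (k j : nat) (t l : R).

Lemma lin_span_ind (A P : set TN) : P 0 ->
  (forall a b, P a -> P b -> P (a + b)) -> (forall l a, P a -> P (l *: a)) ->
  A `<=` P -> lin_span A `<=` P.
Proof.
move=> P0 PD PZ AP _ [n [c [a [Aa ->]]]].
by elim/big_ind: _ => // i _; apply/PZ/AP.
Qed.

Lemma lin_spanD (A : set TN) a b :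
  lin_span A a -> lin_span A b -> lin_span A (a + b).
Proof.
move=> [n [c [u [Au ->]]]] [m [e [v [Av ->]]]].
exists (n + m)%N.
exists (fun i => match fintype.split i with inl j => c j | inr j => e j end).
exists (fun i => match fintype.split i with inl j => u j | inr j => v j end).
split; first by move=> i; case: (fintype.split i).
rewrite big_split_ord; congr (_ + _); apply: eq_bigr => i _.
  by have := unsplitK (inl i : 'I_n + 'I_m) => /= ->.
by have := unsplitK (inr i : 'I_n + 'I_m) => /= ->.
Qed.

Lemma lin_spanZ (A : set TN) l a : lin_span A a -> lin_span A (l *: a).
Proof.
move=> [n [c [u [Au ->]]]]; exists n, (fun i => l * c i), u; split=> //.
by rewrite scaler_sumr; apply: eq_bigr => i _; rewrite tscaleA.
Qed.

Lemma lin_span_gen (A : set TN) a : A a -> lin_span A a.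
Proof.
by move=> Aa; exists 1%N, (fun=> 1), (fun=> a); split=> //; rewrite big_ord1 scale1r.
Qed.

Lemma lin_span0 (A : set TN) : lin_span A 0.
Proof.
exists 0%N, (fun=> 1), (fun=> 0); split; first by case.
by rewrite big_ord0.
Qed.

Lemma tensor_of_vecD (v w : 'rV[R]_d) :
  tensor_of_vec N (v + w) = tensor_of_vec N v + tensor_of_vec N w.
Proof.
apply/ffunP => u; rewrite !ffunE; case: (bseqval u) => [|i [|j s]];
  rewrite ?addr0 ?mxE //.
Qed.

Lemma tensor_of_vecZ l (v : 'rV[R]_d) :
  tensor_of_vec N (l *: v) = l *: tensor_of_vec N v.
Proof.
apply/ffunP => u; rewrite !ffunE; case: (bseqval u) => [|i [|j s]];
  rewrite ?scaler0 ?mxE //.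
Qed.

Lemma layerD i a b : layer i a -> layer i b -> layer i (a + b).
Proof.
case: i => [|i]; last exact: lin_spanD.
by move=> [v _ <-] [w _ <-]; exists (v + w) => //; rewrite tensor_of_vecD.
Qed.

Lemma layerZ i l a : layer i a -> layer i (l *: a).
Proof.
case: i => [|i]; last exact: lin_spanZ.
by move=> [v _ <-]; exists (l *: v) => //; rewrite tensor_of_vecZ.
Qed.

Lemma layer0 i : layer i 0.
Proof.
case: i => [|i]; last exact: lin_span0.
by exists 0 => //; rewrite -(scale0r 0) tensor_of_vecZ scale0r.
Qed.

Lemma layerB i a b : layer i a -> layer i b -> layer i (a - b).
Proof.
by move=> ha hb; apply: layerD => //; rewrite -scaleN1r; exact: layerZ.
Qed.

Definition hom k a := forall w, size w != k -> tcoef a w = 0.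

Lemma tcoef_vec (v : 'rV[R]_d) w : (size w <= N)%N ->
  tcoef (tensor_of_vec N v) w = if w is [:: i] then v 0 i else 0.
Proof.
exact: (tcoef_small (fun w => if w is [:: i] then v 0 i else 0)).
Qed.

Lemma homD k a b : hom k a -> hom k b -> hom k (a + b).
Proof. by move=> ha hb w sw; rewrite tcoefD ha ?hb ?addr0. Qed.

Lemma homZ k l a : hom k a -> hom k (l *: a).
Proof. by move=> ha w sw; rewrite tcoefZ ha ?mulr0. Qed.

Lemma hom0 k : hom k 0.
Proof. by move=> w _; rewrite tcoef0. Qed.

Lemma homM i j a b : hom i a -> hom j b -> hom (i + j) (a * b).
Proof.
move=> ha hb w sw; case: (leqP (size w) N) => [sN|]; last exact: tcoef_big.
rewrite tcoef_mul // /Defs.conv big1 // => l _.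
have [e|h] := eqVneq (size (take l w)) i; last by rewrite ha ?mul0r.
rewrite hb ?mulr0 //; apply: contraNneq sw => f.
by rewrite -e -f -size_cat cat_take_drop.
Qed.

Lemma hom_bracket i j a b : hom i a -> hom j b -> hom (i + j) (bracket a b).
Proof.
move=> ha hb; apply: homD; first exact: homM.
by rewrite -scaleN1r addnC; apply/homZ/homM.
Qed.

Lemma hom_layer i a : layer i a -> hom i.+1 a.
Proof.
elim: i a => [|i IH] a.
  move=> [v _ <-] w sw; case: (leqP (size w) N) => [sN|]; last exact: tcoef_big.
  by rewrite tcoef_vec //; case: w sw {sN} => [|x [|y w]].
apply: lin_span_ind; [exact: hom0|exact: homD|by move=> *; exact: homZ|].
move=> _ [u [v _ <-] [z hz <-]].
rewrite -add1n; apply: hom_bracket; last exact: IH.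
move=> w sw; case: (leqP (size w) N) => [sN|]; last exact: tcoef_big.
by rewrite tcoef_vec //; case: w sw {sN} => [|m [|q w]].
Qed.

Lemma bracketDl a b c : bracket (a + b) c = bracket a c + bracket b c.
Proof. by rewrite /bracket mulrDl mulrDr opprD addrACA. Qed.

Lemma bracketDr a b c : bracket a (b + c) = bracket a b + bracket a c.
Proof. by rewrite /bracket mulrDl mulrDr opprD addrACA. Qed.

Lemma bracketZl l a b : bracket (l *: a) b = l *: bracket a b.
Proof. by rewrite /bracket -tscaleAl -tscaleAr scalerBr. Qed.

Lemma bracketZr l a b : bracket a (l *: b) = l *: bracket a b.
Proof. by rewrite /bracket -tscaleAl -tscaleAr scalerBr. Qed.

Lemma bracket0l a : bracket 0 a = 0.
Proof. by rewrite /bracket mul0r mulr0 subrr. Qed.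

Lemma bracket0r a : bracket a 0 = 0.
Proof. by rewrite /bracket mul0r mulr0 subrr. Qed.

Lemma bracket_vec_layer i (v : 'rV[R]_d) x :
  layer i x -> layer i.+1 (bracket (tensor_of_vec N v) x).
Proof.
move=> hx; apply: lin_span_gen; exists (tensor_of_vec N v); first by exists v.
by exists x.
Qed.

(** The layers are defined by brackets with vectors on the left; the Jacobi
   identity moves general brackets into this form. *)
Lemma bracket_layer i j x y :
  layer i x -> layer j y -> layer (i + j).+1 (bracket x y).
Proof.
elim: i j x y => [|i IH] j x y; first by move=> [v _ <-]; exact: bracket_vec_layer.
move=> + hy; apply: (@lin_span_ind _ (fun x => layer _ (bracket x y))).
- by rewrite bracket0l; exact: layer0.
- by move=> a b ha hb; rewrite bracketDl; exact: layerD.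
- by move=> l a ha; rewrite bracketZl; exact: layerZ.
move=> _ [_ [v _ <-] [z hz <-]]; set e := tensor_of_vec N v.
have -> : bracket (bracket e z) y =
    bracket e (bracket z y) - bracket z (bracket e y).
  by rewrite /bracket !(mulrBl, mulrBr) !mulrA; tlin.
apply: layerB; first by apply: bracket_vec_layer; exact: IH.
by rewrite addSnnS; apply: IH => //; exact: bracket_vec_layer.
Qed.

Definition proj k a : TN :=
  [ffun w : N.-bseq 'I_d => (size w == k)%:R * a w].

Lemma tcoef_proj k a w : tcoef (proj k a) w = (size w == k)%:R * tcoef a w.
Proof.
rewrite /tcoef; case: insubP => [u _ <-|_]; last by rewrite mulr0.
by rewrite ffunE.
Qed.

Lemma projD k a b : proj k (a + b) = proj k a + proj k b.
Proof. by apply: tensorP => w _; rewrite tcoefD !tcoef_proj tcoefD mulrDr. Qed.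

Lemma projZ k l a : proj k (l *: a) = l *: proj k a.
Proof. by apply: tensorP => w _; rewrite tcoefZ !tcoef_proj tcoefZ mulrCA. Qed.

Lemma proj0 k : proj k 0 = 0.
Proof. by apply: tensorP => w _; rewrite tcoef_proj !tcoef0 mulr0. Qed.

Lemma proj_sum k (J : Type) (r : seq J) (P : pred J) (F : J -> TN) :
  proj k (\sum_(i <- r | P i) F i) = \sum_(i <- r | P i) proj k (F i).
Proof. by elim/big_rec2: _ => [|i u v _ <-]; rewrite ?proj0 ?projD. Qed.

Lemma proj_hom k a : hom k a -> proj k a = a.
Proof.
move=> ha; apply: tensorP => w _; rewrite tcoef_proj.
by have [e|/ha ->] := eqVneq (size w) k; rewrite ?mul1r ?mulr0.
Qed.

Lemma proj_hom_neq k j a : hom k a -> j != k -> proj j a = 0.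
Proof.
move=> ha jk; apply: tensorP => w _; rewrite tcoef_proj tcoef0.
by have [e|_] := eqVneq (size w) j; rewrite ?mul0r // ha ?mulr0 // e.
Qed.

Lemma sum_proj a : hdeg 1 a -> a = \sum_(i < N) proj i.+1 a.
Proof.
move=> ha; apply: tensorP => w sw; rewrite tcoef_sum.
case: w sw => [|x w] sw.
  by rewrite ha // big1 // => i _; rewrite tcoef_proj mul0r.
rewrite (bigD1 (Ordinal sw)) //= tcoef_proj eqxx mul1r big1 ?addr0 //.
move=> i; rewrite -val_eqE /= => iw.
by rewrite tcoef_proj /= eqSS eq_sym (negbTE iw) mul0r.
Qed.

(** The Lie algebra is graded, so that membership can be tested degree by degree. *)
Lemma lieP x : lie x <-> hdeg 1 x /\ forall i, layer i (proj i.+1 x).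
Proof.
split=> [[w [hw ->]]|[h1 hi]]; last first.
  by exists (fun i => proj i.+1 x); split=> //; exact: sum_proj.
split=> [|i].
  apply: hdeg_sum => i _ u su; apply: (hom_layer (hw i)).
  by move: su; case: (size u).
rewrite proj_sum; elim/big_ind: _ => [||j _]; [exact: layer0|exact: layerD|].
have [->|ij] := eqVneq i j; first by rewrite proj_hom //; exact/hom_layer.
by rewrite (proj_hom_neq (hom_layer (hw j))) ?eqSS //; exact: layer0.
Qed.

Lemma lie_hdeg x : lie x -> hdeg 1 x.
Proof. by case/lieP. Qed.

Lemma lie_layerW i x : layer i x -> lie x.
Proof.
move=> hx; have hh := hom_layer hx; apply/lieP; split=> [w sw|j].
  by apply: hh; move: sw; case: (size w).
have [->|ji] := eqVneq j i; first by rewrite proj_hom.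
by rewrite (proj_hom_neq hh) ?eqSS //; exact: layer0.
Qed.

Lemma lieD x y : lie x -> lie y -> lie (x + y).
Proof.
move=> /lieP[x1 hx] /lieP[y1 hy]; apply/lieP; split=> [|i]; first exact: hdegD.
by rewrite projD; exact: layerD.
Qed.

Lemma lieZ l x : lie x -> lie (l *: x).
Proof.
move=> /lieP[x1 hx]; apply/lieP; split=> [|i]; first exact: hdegZ.
by rewrite projZ; exact: layerZ.
Qed.

Lemma lieN x : lie x -> lie (- x).
Proof. by rewrite -scaleN1r; exact: lieZ. Qed.

Lemma lie0 : lie 0.
Proof. exact: lie_layerW (layer0 0). Qed.

Lemma lie_sum (J : Type) (r : seq J) (P : pred J) (F : J -> TN) :
  (forall i, P i -> lie (F i)) -> lie (\sum_(i <- r | P i) F i).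
Proof. by move=> hF; elim/big_ind: _ => //; [exact: lie0|exact: lieD]. Qed.

Lemma lie_proj k x : lie x -> lie (proj k x).
Proof.
move=> /lieP[x1 hx]; case: k => [|k]; last exact: lie_layerW (hx k).
have -> : proj 0 x = 0; last exact: lie0.
apply: tensorP => w _; rewrite tcoef_proj tcoef0; case: w => [|i w].
  by rewrite x1 ?mulr0.
by rewrite mul0r.
Qed.

Lemma bracket_suml (J : Type) (r : seq J) (P : pred J) (F : J -> TN) y :
  bracket (\sum_(i <- r | P i) F i) y = \sum_(i <- r | P i) bracket (F i) y.
Proof. by elim/big_rec2: _ => [|i u v _ <-]; rewrite ?bracket0l ?bracketDl. Qed.

Lemma bracket_sumr (J : Type) (r : seq J) (P : pred J) (F : J -> TN) y :
  bracket y (\sum_(i <- r | P i) F i) = \sum_(i <- r | P i) bracket y (F i).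
Proof. by elim/big_rec2: _ => [|i u v _ <-]; rewrite ?bracket0r ?bracketDr. Qed.

Lemma lie_bracket x y : lie x -> lie y -> lie (bracket x y).
Proof.
move=> /lieP[x1 hx] /lieP[y1 hy].
rewrite (sum_proj x1) (sum_proj y1) bracket_suml; apply: lie_sum => i _.
rewrite bracket_sumr; apply: lie_sum => j _.
exact: lie_layerW (bracket_layer (hx i) (hy j)).
Qed.

(** The derivation generating the dilations. It will characterize the exponentials
   of Lie elements without the Baker-Campbell-Hausdorff formula. *)
Definition eul a : TN := [ffun w : N.-bseq 'I_d => (size w)%:R * a w].

Lemma tcoef_eul a w : tcoef (eul a) w = (size w)%:R * tcoef a w.
Proof.
rewrite /tcoef; case: insubP => [u _ <-|_]; last by rewrite mulr0.
by rewrite ffunE.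
Qed.

Lemma eulM a b : eul (a * b) = eul a * b + a * eul b.
Proof.
apply: tensorP => w sw; rewrite tcoefD tcoef_eul !tcoef_mul // /Defs.conv.
rewrite mulr_sumr -big_split; apply: eq_bigr => i _ /=.
rewrite !tcoef_eul -[w in (size w)%:R](cat_take_drop i) size_cat natrD; ring.
Qed.

Lemma eulD a b : eul (a + b) = eul a + eul b.
Proof. by apply: tensorP => w _; rewrite tcoefD !tcoef_eul tcoefD mulrDr. Qed.

Lemma eulZ l a : eul (l *: a) = l *: eul a.
Proof. by apply: tensorP => w _; rewrite tcoefZ !tcoef_eul tcoefZ mulrCA. Qed.

Lemma eul_sum (J : Type) (r : seq J) (P : pred J) (F : J -> TN) :
  eul (\sum_(i <- r | P i) F i) = \sum_(i <- r | P i) eul (F i).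
Proof.
elim/big_rec2: _ => [|i u v _ <-]; last by rewrite eulD.
by apply: tensorP => w _; rewrite tcoef_eul !tcoef0 mulr0.
Qed.

Lemma eul1 : eul 1 = 0.
Proof.
apply: tensorP => w sw; rewrite tcoef_eul tcoef0 tcoef_one //.
by case: w {sw} => [|i w] /=; rewrite ?mul0r ?mulr0.
Qed.

Lemma proj_eul k a : proj k (eul a) = k%:R *: proj k a.
Proof.
apply: tensorP => w _; rewrite tcoefZ !tcoef_proj tcoef_eul.
by have [->|] := eqVneq (size w) k; rewrite ?mul1r ?mul0r ?mulr0.
Qed.

Lemma lie_eul x : lie x -> lie (eul x).
Proof.
move=> /lieP[x1 hx]; apply/lieP; split=> [w sw|i].
  by rewrite tcoef_eul x1 ?mulr0.
by rewrite proj_eul; exact: layerZ.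
Qed.

End Lie.

(** * The exponential of the Lie algebra is a group *)

Section GroupClosure.
Context {R : realType} {d N : nat}.
Local Notation TN := (tensor R d N).
Local Notation lie := (@free_nilpotent_lie R d N).
Local Notation G := (@free_nilpotent_group R d N).
Implicit Types (a b c x y z g h u : TN) (w : seq 'I_d) (k j : nat) (t l : R).

Lemma tscaleI l a b : l != 0 -> l *: a = l *: b -> a = b.
Proof.
by move=> l0 /(congr1 ( *:%R l^-1)); rewrite !tscaleA mulVf // !scale1r.
Qed.

Local Notation A x i := ((i`!%:R)^-1 *: x ^+ i).

Lemma mulr_factV i : i.+1%:R * (i.+1`!%:R)^-1 = (i`!%:R)^-1 :> R.
Proof. by rewrite factS natrM invfM mulrA mulfV ?mul1r // pnatr_eq0. Qed.

Lemma divpow_mulr x i : A x i * x = i.+1%:R *: A x i.+1.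
Proof.
by rewrite -tscaleAl -exprSr tscaleA mulr_factV.
Qed.

(** The two commutation formulas with texp x below are of this form, with r = 0 and
   r = 1: if right multiplication by x acts on the b_j as left multiplication
   plus a shift, it shifts their Cauchy products with the divided powers of x. *)
Lemma cauchy_shift x (b : nat -> TN) r m :
  (forall j, b j * x = x * b j + (j + r.+1)%:R *: b j.+1) ->
  (\sum_(i < m.+1) A x i * b (m - i)%N) * x + r%:R *: (A x m.+1 * b 0%N) =
  (m + r.+1)%:R *: \sum_(i < m.+2) A x i * b (m.+1 - i)%N.
Proof.
move=> hb.
pose T i := A x i * b (m.+1 - i)%N.
have e1 : (\sum_(i < m.+1) A x i * b (m - i)%N) * x =
    \sum_(i < m.+1) (i.+1%:R *: T i.+1) +
    \sum_(i < m.+1) ((m - i + r.+1)%:R *: T i).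
  rewrite mulr_suml -big_split; apply: eq_bigr => i _ /=.
  rewrite -mulrA hb mulrDr mulrA divpow_mulr /T subSS subSn; last first.
    by rewrite -ltnS.
  by rewrite -tscaleAr -tscaleAl.
have e2 : \sum_(i < m.+1) (i.+1%:R *: T i.+1) = \sum_(i < m.+2) (i%:R *: T i).
  by rewrite [RHS]big_ord_recl scale0r add0r.
have e3 : \sum_(i < m.+1) ((m - i + r.+1)%:R *: T i) + r%:R *: T m.+1 =
    \sum_(i < m.+2) ((m.+1 - i + r)%:R *: T i).
  rewrite [RHS]big_ord_recr /= subnn add0n; congr (_ + _).
  apply: eq_bigr => i _; congr (_%:R *: _).
  by rewrite addnS subSn -?addSn // -ltnS.
have eT : A x m.+1 * b 0%N = T m.+1 by rewrite /T subnn.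
rewrite e1 e2 -addrA eT e3.
rewrite -big_split scaler_sumr; apply: eq_bigr => i _ /=.
rewrite -scalerDl -natrD; congr (_%:R *: _).
have := ltn_ord i; lia.
Qed.

Definition adn x j u := iter j (bracket x) u.

Lemma hdeg_adn k x j u : hdeg 1 x -> hdeg k u -> hdeg (k + j) (adn x j u).
Proof.
move=> hx hu; elim: j => [|j IH]; rewrite ?addn0 // addnS -addn1.
apply: hdegB; last exact: hdegM.
by rewrite addnC; apply: hdegM.
Qed.

Lemma adnS x j u : adn x j u * x = x * adn x j u - adn x j.+1 u.
Proof. by rewrite /adn iterS /bracket opprB addrC subrK. Qed.

Lemma lie_adn x j u : lie x -> lie u -> lie (adn x j u).
Proof. by move=> hx hu; elim: j => //= j IH; exact: lie_bracket. Qed.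

(** The adjoint action of the group preserves the Lie algebra: v is the series
   exp(- ad x) u. *)
Lemma lie_texp_conj x u : lie x -> lie u ->
  exists2 v, lie v & u * texp x = texp x * v.
Proof.
move=> lx lu; have hx := lie_hdeg lx; have hu := lie_hdeg lu.
pose b j : TN := ((-1) ^+ j * (j`!%:R)^-1) *: adn x j u.
have hb j : b j * x = x * b j + (j + 1)%:R *: b j.+1.
  rewrite /b -tscaleAl adnS -tscaleAr scalerBr; congr (_ + _).
  rewrite -scaleN1r !tscaleA; congr (_ *: _).
  by rewrite addn1 [RHS]mulrCA mulr_factV exprS -mulrA.
have E m : u * A x m = \sum_(i < m.+1) A x i * b (m - i)%N.
  elim: m => [|m IH].
    by rewrite big_ord1 /b !fact0 !invr1 !expr0 !mul1r !scale1r mulr1 mul1r.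
  have /lt0r_neq0 h : 0 < m.+1%:R :> R by rewrite ltr0n.
  apply: (tscaleI h); have := cauchy_shift m hb.
  rewrite scale0r addr0 addn1 => <-; rewrite -IH -mulrA divpow_mulr.
  exact: tscaleAr.
exists (\sum_(j < N.+1) b j).
  by apply: lie_sum => j _; apply/lieZ/lie_adn.
rewrite /texp mulr_sumr mulr_suml.
under eq_bigr do rewrite E.
rewrite (@sum_triangle _ N.+1 (fun i j => A x i * b j)).
  by apply: eq_bigr => i _; rewrite mulr_sumr.
move=> i j ij; apply: (@hdeg_eq0 _ _ _ (i + j)) => //.
apply: hdegM; apply: hdegZ; first exact: hdegX.
exact: (hdeg_adn (k := 0)).
Qed.

(** The derivative of the exponential: v is the series of (1 - exp(- ad x)) / ad x
   applied to eul x. *)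
Lemma eul_texp x : lie x -> exists2 v, lie v & eul (texp x) = texp x * v.
Proof.
move=> lx; have hx := lie_hdeg lx; have lu := lie_eul lx.
set u := eul x in lu; have hu := lie_hdeg lu.
pose b j : TN := ((-1) ^+ j * (j.+1`!%:R)^-1) *: adn x j u.
have hb j : b j * x = x * b j + (j + 2)%:R *: b j.+1.
  rewrite /b -tscaleAl adnS -tscaleAr scalerBr; congr (_ + _).
  rewrite -scaleN1r !tscaleA; congr (_ *: _).
  by rewrite addn2 [RHS]mulrCA mulr_factV exprS -mulrA.
have hF i j : (N.+1 <= (i + j).+1)%N -> A x i * b j = 0.
  move=> ij; apply: (@hdeg_eq0 _ _ _ (i + j).+1) => //.
  rewrite -addnS; apply: hdegM; apply: hdegZ; first exact: hdegX.
  exact: (hdeg_adn (k := 1)).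
have E m : eul (A x m.+1) = \sum_(i < m.+1) A x i * b (m - i)%N.
  elim: m => [|m IH].
    have f1 : 1`! = 1%N by [].
    by rewrite big_ord1 /b f1 fact0 expr1 !invr1 !expr0 !mul1r !scale1r mul1r.
  have /lt0r_neq0 h : 0 < m.+2%:R :> R by rewrite ltr0n.
  apply: (tscaleI h); have := cauchy_shift m hb.
  rewrite addn2 => <-; rewrite -IH -eulZ -divpow_mulr eulM scale1r.
  by rewrite /b expr0 mul1r invr1 scale1r.
exists (\sum_(j < N.+1) b j).
  by apply: lie_sum => j _; apply/lieZ/lie_adn.
rewrite /texp mulr_suml eul_sum big_ord_recl /= fact0 invr1 scale1r expr0 eul1.
rewrite add0r.
under eq_bigr do rewrite E.
have := @sum_triangle _ N.+1 (fun i j => A x i * b j).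
rewrite big_ord_recr /= [X in _ + X]big1 ?addr0 => [->|i _].
- by apply: eq_bigr => i _; rewrite mulr_sumr.
- by move=> i j ij; apply: hF; apply: leq_trans ij _.
- by apply: hF; rewrite subnKC // -ltnS.
Qed.

(** Membership in exp(lie) is detected by the logarithmic derivative along the
   Euler derivation: this is what makes it stable under products. *)
Definition eul_log g := exists2 v, lie v & eul g = g * v.

Lemma eul_log_mul g y : eul_log g -> lie y -> eul_log (g * texp y).
Proof.
move=> [v lv ev] ly; have [s ls es] := lie_texp_conj ly lv.
have [r lr er] := eul_texp ly.
exists (s + r); first exact: lieD.
by rewrite eulM ev er -mulrA es mulrDr !mulrA.
Qed.

(** Conversely, an element with logarithmic derivative in the Lie algebra is
   trivialized by right multiplication by exponentials, one degree at a time: the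
   leading term of g e^x is, up to its degree, that of its logarithmic derivative,
   hence a Lie element. *)
Lemma eul_log_texp g : tcoef g [::] = 1 -> eul_log g ->
  exists2 x, lie x & texp x = g.
Proof.
move=> g1 hg.
suff h k : exists2 x, lie x & hdeg k.+1 (g * texp x - 1).
  have [x lx hx] := h N; exists (- x); first exact: lieN.
  have e : g * texp x = 1.
    by apply/eqP; rewrite -subr_eq0; apply/eqP; exact: hdeg_eq0 hx.
  by rewrite -[RHS]mulr1 -(texpK (lie_hdeg lx)) mulrA e mul1r.
elim: k => [|k [x lx hk]].
  exists 0; first exact: lie0.
  by apply/hdeg1P; rewrite texp0 mulr1 tcoefB tcoef1_0 g1 subrr.
have [v lv] := eul_log_mul hg lx.
set r := g * texp x - 1 in hk.
have -> : g * texp x = 1 + r by rewrite addrC subrK.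
rewrite eulD eul1 add0r mulrDl mul1r => er.
pose y := (k.+1%:R)^-1 *: proj k.+1 v.
have k0 : (k.+1%:R : R) != 0 by rewrite pnatr_eq0.
have ly : lie y by apply/lieZ/lie_proj.
have ey : y = proj k.+1 r.
  have /(congr1 (proj k.+1)) := er; rewrite proj_eul [proj _ (v + _)]projD => e.
  have e0 : proj k.+1 (r * v) = 0.
    apply: tensorP => w _; rewrite tcoef_proj tcoef0.
    have [sw|_] := eqVneq (size w) k.+1; last by rewrite mul0r.
    rewrite (hdegM hk (lie_hdeg lv)) ?mulr0 //; rewrite sw; lia.
  by move: e; rewrite e0 addr0 /y => <-; rewrite tscaleA mulVf // scale1r.
exists (x - y); first by apply: lieD => //; exact: lieN.
have hy : hdeg k.+1 (- y).
  apply: hdegN; rewrite ey => w sw; rewrite tcoef_proj.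
  by rewrite hk ?mulr0.
have hT := texp_triangular (ltn0Sn k) (lie_hdeg lx) hy.
set T := texp (x - y) - texp x - - y in hT.
have -> : texp (x - y) = texp x - y + T.
  by rewrite /T; move: (texp _) (texp x) => p q; tlin.
have -> : g * (texp x - y + T) - 1 = r - y + ((1 - g) * y + g * T).
  by rewrite /r !(mulrDr, mulrDl, mulrN, mulNr, mul1r); tlin.
apply: hdegD.
  move=> w sw; rewrite tcoefB ey tcoef_proj.
  have [e|ne] := eqVneq (size w) k.+1; first by rewrite mul1r subrr.
  rewrite mul0r subr0 hk // ltn_neqAle ne /=.
  by rewrite -ltnS.
apply: hdegD; last exact: hdegMr.
rewrite -add1n; apply: hdegM; last by rewrite -[y]opprK; exact: hdegN.
by apply/hdeg1P; rewrite tcoefB tcoef1_0 g1 subrr.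
Qed.

Lemma group_texp x : lie x -> G (texp x).
Proof. by move=> lx; exists x. Qed.

Lemma group_coef0 g : G g -> tcoef g [::] = 1.
Proof. by move=> [x lx <-]; exact/texp_coef0/lie_hdeg. Qed.

Lemma group_tlog g : G g -> lie (tlog g).
Proof. by move=> [x lx <-]; rewrite texpKlog //; exact: lie_hdeg. Qed.

Lemma groupM g h : G g -> G h -> G (g * h).
Proof.
move=> [x lx <-] [y ly <-]; apply: eul_log_texp; last first.
  by apply: eul_log_mul => //; exact: eul_texp.
by rewrite tcoefM0 !texp_coef0 ?mulr1 //; exact: lie_hdeg.
Qed.

Lemma group1 : G 1.
Proof. by rewrite -texp0; apply/group_texp/lie0. Qed.

Lemma groupV g : G g -> G g^-1.
Proof.
by move=> [x lx <-]; rewrite texpV; [apply/group_texp/lieN|exact: lie_hdeg].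
Qed.

Lemma group_unit g : G g -> g \is a GRing.unit.
Proof. by move=> [x lx <-]; exact/texp_unit/lie_hdeg. Qed.

Lemma tlogV g : G g -> tlog g^-1 = - tlog g.
Proof.
move=> [x lx <-]; have hx := lie_hdeg lx.
by rewrite texpV // !texpKlog //; exact: hdegN.
Qed.

Lemma dil_layer l i a : lie_layer d N i a -> dil l a = l ^+ i.+1 *: a.
Proof.
move=> /hom_layer ha; apply: tensorP => w _; rewrite tcoef_dil tcoefZ.
by have [->//|/ha ->] := eqVneq (size w) i.+1; rewrite !mulr0.
Qed.

Lemma lie_dil l x : lie x -> lie (dil l x).
Proof.
move=> lx; have /lieP[x1 hx] := lx; rewrite (sum_proj x1) dil_sum.
apply: lie_sum => i _; rewrite (dil_layer _ (hx i)); apply: lieZ.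
exact: lie_layerW (hx i).
Qed.

Lemma group_dil l g : G g -> G (dil l g).
Proof. by move=> [x lx <-]; rewrite dil_texp; apply/group_texp/lie_dil. Qed.

End GroupClosure.

(** * A homogeneous quasi-norm *)

(** The exponents make it homogeneous of degree 1 under dilations. *)
HB.lock Definition hnorm (R : realType) (d N : nat) (x : tensor R d N) : R :=
  \big[Num.max/0]_(w : N.-bseq 'I_d | (0 < size w)%N)
    (`|x w| `^ ((size w)%:R^-1)).

Section HomogeneousNorm.
Context {R : realType} {d N : nat}.
Local Notation TN := (tensor R d N).
Local Notation lie := (@free_nilpotent_lie R d N).
Local Notation G := (@free_nilpotent_group R d N).
Implicit Types (a b c x y z g h u : TN) (w : seq 'I_d) (k j : nat).
Implicit Types (B C t l e : R).

Lemma root_le (a l : R) n : (0 < n)%N -> 0 <= a -> 0 <= l ->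
  (a `^ (n%:R^-1) <= l) = (a <= l ^+ n).
Proof.
move=> n0 a0 l0; have n0' : (n%:R : R) != 0 by rewrite pnatr_eq0 -lt0n.
have e : a = (a `^ (n%:R^-1)) ^+ n.
  by rewrite -powR_mulrn ?powR_ge0 // -powRrM mulVf // powRr1.
by rewrite [in RHS]e ler_pXn2r ?nnegrE ?powR_ge0.
Qed.

Lemma hnorm_ge0 x : 0 <= hnorm x.
Proof.
rewrite hnorm.unlock; elim/big_ind: _ => [//|u v u0 v0|w _].
  by rewrite le_max u0.
exact: powR_ge0.
Qed.

Lemma hnorm_leP x l : 0 <= l ->
  hnorm x <= l <-> (forall w, (0 < size w)%N -> `|tcoef x w| <= l ^+ size w).
Proof.
move=> l0; rewrite hnorm.unlock; split=> [h w w0|h].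
  rewrite /tcoef; case: insubP => [u _ eu|_]; last by rewrite normr0 exprn_ge0.
  rewrite -eu -root_le ?eu // -eu; apply: le_trans h.
  by apply: (le_bigmax_cond (0 : R) (P := fun w : N.-bseq 'I_d => (0 < size w)%N)
    (fun w : N.-bseq 'I_d => `|x w| `^ ((size w)%:R^-1))); rewrite eu.
by apply: bigmax_le => // w w0; rewrite root_le // -tcoefE h.
Qed.

Lemma hnorm_coef x w : (0 < size w)%N -> `|tcoef x w| <= hnorm x ^+ size w.
Proof. by move=> w0; apply: (hnorm_leP x (hnorm_ge0 x)).1. Qed.

Lemma hnormN x : hnorm (- x) = hnorm x.
Proof.
have le y : hnorm (- y) <= hnorm y.
  apply/hnorm_leP => [|w w0]; first exact: hnorm_ge0.
  by rewrite tcoefN normrN hnorm_coef.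
by apply/eqP; rewrite eq_le le /= -{1}[x]opprK le.
Qed.

Lemma hnorm_dil_le l x : 0 <= l -> hnorm (dil l x) <= l * hnorm x.
Proof.
move=> l0; apply/hnorm_leP => [|w w0]; first by rewrite mulr_ge0 ?hnorm_ge0.
rewrite tcoef_dil normrM ger0_norm ?exprn_ge0 // exprMn.
by rewrite ler_wpM2l ?exprn_ge0 // hnorm_coef.
Qed.

Lemma hnorm_dil l x : 0 < l -> hnorm (dil l x) = l * hnorm x.
Proof.
move=> l0; apply/eqP; rewrite eq_le hnorm_dil_le ?(ltW l0) //=.
rewrite -ler_pdivlMl // -{1}[x]dil_1 -(mulVf (lt0r_neq0 l0)) -dil_dil.
by apply: hnorm_dil_le; rewrite invr_ge0 ltW.
Qed.

Lemma hnorm_eq0 x : hdeg 1 x -> hnorm x <= 0 -> x = 0.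
Proof.
move=> hx x0; apply: tensorP => w _; rewrite tcoef0.
case: w => [|i w]; first by rewrite hx.
apply/eqP; rewrite -normr_le0; have := hnorm_coef x (ltn0Sn (size w) : (0 < size (i :: w))%N).
have -> : hnorm x = 0 by apply/eqP; rewrite eq_le x0 hnorm_ge0.
by rewrite expr0n.
Qed.

(** Halving the logarithm contracts the quasi-norm by the factor 2^(-1/N): the
   component of degree k only contracts by 2^(-1/k). *)
Lemma hnorm_half x (q : R) : 0 <= q -> q <= 1 -> 2^-1 <= q ^+ N ->
  hnorm (2^-1 *: x) <= q * hnorm x.
Proof.
move=> q0 q1 qN; apply/hnorm_leP => [|w w0]; first by rewrite mulr_ge0 ?hnorm_ge0.
case: (leqP (size w) N) => [sw|sw]; last first.
  by rewrite tcoef_big // normr0 exprn_ge0 // mulr_ge0 ?hnorm_ge0.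
rewrite tcoefZ normrM exprMn ler_pM ?hnorm_coef // ger0_norm ?invr_ge0 //.
by rewrite (le_trans qN) // ler_wiXn2l.
Qed.

Lemma tnorm_hnorm x l : hdeg 1 x -> 0 <= l <= 1 -> hnorm x <= l ->
  tnorm x <= N.+1%:R * l.
Proof.
move=> hx /andP[l0 l1] xl; apply: tnorm_le => // w sw.
case: w sw => [|i w] sw; first by rewrite hx // normr0.
have /(_ (i :: w) isT) h := (hnorm_leP x l0).1 xl.
by rewrite (le_trans h) //= exprS ler_piMr // exprn_ile1.
Qed.

Lemma hnorm_tnorm x l : 0 <= l <= 1 -> tnorm x <= l ^+ N -> hnorm x <= l.
Proof.
move=> /andP[l0 l1] xl; apply/hnorm_leP => // w w0.
case: (leqP (size w) N) => [sw|sw]; last first.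
  by rewrite tcoef_big // normr0 exprn_ge0.
rewrite (le_trans (tcoef_le_tnorm _ _)) // (le_trans xl) //.
by rewrite ler_wiXn2l.
Qed.

Lemma hnorm_bounded x l : 1 <= l -> tnorm x <= l -> hnorm x <= l.
Proof.
move=> l1 xl; have l0 : 0 <= l by rewrite (le_trans ler01).
apply/hnorm_leP => // -[//|i w] _; rewrite (le_trans (tcoef_le_tnorm _ _)) //.
by rewrite (le_trans xl) // exprS ler_peMr // exprn_ege1.
Qed.

Definition nu g : R := hnorm (tlog g).

Lemma nu_ge0 g : 0 <= nu g. Proof. exact: hnorm_ge0. Qed.

Lemma nuV g : G g -> nu g^-1 = nu g.
Proof. by move=> Gg; rewrite /nu tlogV // hnormN. Qed.

Lemma nu_dil l g : G g -> 0 < l -> nu (dil l g) = l * nu g.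
Proof. by move=> Gg l0; rewrite /nu dil_tlog ?group_coef0 // hnorm_dil. Qed.

Lemma nu1 : nu 1 = 0.
Proof.
rewrite /nu tlog1; apply/eqP; rewrite eq_le hnorm_ge0 andbT.
by apply/hnorm_leP => // w _; rewrite tcoef0 normr0 exprn_ge0.
Qed.

Lemma nu_eq0 g : G g -> nu g <= 0 -> g = 1.
Proof.
move=> Gg g0; rewrite -(tlogK (group_coef0 Gg)) (_ : tlog g = 0) ?texp0 //.
exact: hnorm_eq0 (tlog_hdeg (group_coef0 Gg)) g0.
Qed.

Lemma nu_normalize l g : G g -> 0 < l ->
  exists2 g', G g' & g = dil l g' /\ nu g' = l^-1 * nu g.
Proof.
move=> Gg l0; exists (dil l^-1 g); first exact: group_dil.
by rewrite dil_dil mulfV ?lt0r_neq0 // dil_1 nu_dil ?invr_gt0.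
Qed.

Lemma nu_ball_tnorm : exists2 D, 1 <= D &
  forall g, G g -> nu g <= 1 -> tnorm g <= D.
Proof.
have [D D0 hD] := locLip_bounded N.+1%:R (@locLip_texp R d N).
exists (D + 1) => [|g Gg g1]; first by rewrite lerDr.
have hg := tlog_hdeg (group_coef0 Gg).
rewrite -(tlogK (group_coef0 Gg)) (@le_trans _ _ D) ?lerDl // hD //.
by rewrite -[leRHS]mulr1; apply: tnorm_hnorm => //; rewrite ler01 lexx.
Qed.

Lemma nu_ball_sub1 : exists2 C, 0 <= C & forall g l, G g ->
  0 <= l <= 1 -> nu g <= l -> tnorm (g - 1) <= C * l.
Proof.
have [C C0 hC] := @locLip_texp R d N N.+1%:R.
exists (C * N.+1%:R) => [|g l Gg l01 gl]; first by rewrite mulr_ge0.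
have hg := tlog_hdeg (group_coef0 Gg).
have h := tnorm_hnorm hg l01 gl.
rewrite -[g](tlogK (group_coef0 Gg)) -texp0 -mulrA.
rewrite (le_trans (hC _ _ _ _)) ?subr0 ?tnorm0 //; last by rewrite ler_wpM2l.
by rewrite (le_trans h) // ler_piMr //; case/andP: l01.
Qed.

Lemma nu_tnorm_ball B : exists2 C, 1 <= C & forall g, G g -> tnorm g <= B ->
  nu g <= C.
Proof.
have [C C0 hC] := locLip_bounded B (@locLip_tlog R d N).
exists (C + 1) => [|g Gg gB]; first by rewrite lerDr.
apply: hnorm_bounded; first by rewrite lerDr.
by rewrite (le_trans (hC _ gB)) // lerDl.
Qed.

(** Crude quasi-triangle inequality: bounded on the unit ball, hence everywhere
   by scaling. *)
Lemma nuM_crude : exists2 C, 1 <= C & forall g h l, G g -> G h ->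
  nu g <= l -> nu h <= l -> nu (g * h) <= C * l.
Proof.
have [D D1 hD] := nu_ball_tnorm.
have [C C1 hC] := nu_tnorm_ball (D * D).
exists C => // g h l Gg Gh gl hl.
have l0 : 0 <= l by rewrite (le_trans (nu_ge0 g)).
move: l0; rewrite le_eqVlt => /orP[/eqP e|l0].
  move: gl hl; rewrite -e mulr0 => /(nu_eq0 Gg)-> /(nu_eq0 Gh)->.
  by rewrite mulr1 nu1.
have [g' Gg' [eg ng]] := nu_normalize Gg l0.
have [h' Gh' [eh nh]] := nu_normalize Gh l0.
rewrite eg eh -dilM nu_dil //; last exact: groupM.
rewrite mulrC ler_wpM2r ?(ltW l0) //.
apply: hC; first exact: groupM.
rewrite (le_trans (tnormM _ _)) // ler_pM ?tnorm_ge0 // hD //.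
  by rewrite ng ler_pdivrMl ?mulr1.
by rewrite nh ler_pdivrMl ?mulr1.
Qed.

(** A small perturbation on the right costs a factor arbitrarily close to 1. It
   replaces the triangle inequality, which nu only satisfies up to a constant:
   iterated along a chain it loses (1 + e) ^ j instead of C ^ j. *)
Lemma nuM_r e : 0 < e -> exists2 C, 1 <= C & forall g h, G g -> G h ->
  nu (g * h) <= Num.max ((1 + e) * nu g) (C * nu h).
Proof.
move=> e0; have [C0 C01 hC0] := nuM_crude.
have [D D1 hD] := nu_ball_tnorm; have [E E0 hE] := nu_ball_sub1.
have [L L0 hL] := @locLip_tlog R d N (D * D).
have D0 : 0 <= D by rewrite (le_trans ler01).
pose M := L * (D * E) + 1.
have M0 : 0 < M by rewrite ltr_wpDl // !mulr_ge0.
pose t := Num.min 1 (e / M).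
have t0 : 0 < t by rewrite lt_min ltr01 divr_gt0.
have t1 : t <= 1 by rewrite ge_min lexx.
have tM : M * t <= e by rewrite -ler_pdivlMl // mulrC ge_min lexx orbT.
exists (C0 * t^-1) => [|g h Gg Gh].
  by rewrite -[leLHS]mulr1 ler_pM // invf_ge1.
rewrite le_max; have [hg|gh] := lerP (nu h) (t * nu g); last first.
  apply/orP; right; rewrite -mulrA; apply: hC0 => //.
    by rewrite ler_pdivlMl // ltW.
  by rewrite ler_peMl ?nu_ge0 // invf_ge1.
apply/orP; left; have := nu_ge0 g; rewrite le_eqVlt => /orP[/eqP e'|g0].
  move: hg; rewrite -e' mulr0 => /(nu_eq0 Gh)->.
  by rewrite mulr1 -e' mulr0.
have [g' Gg' [eg ng]] := nu_normalize Gg g0.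
have [h' Gh' [eh nh]] := nu_normalize Gh g0.
have {}ng : nu g' = 1 by rewrite ng mulVf // gt_eqF.
have {}nh : nu h' <= t by rewrite nh ler_pdivrMl // mulrC.
rewrite {1}eg {1}eh -dilM nu_dil //; last exact: groupM.
rewrite mulrC ler_wpM2r ?(ltW g0) //.
have nh1 := le_trans nh t1.
apply/hnorm_leP => [|w w0]; first by rewrite addr_ge0 // ltW.
have gB : tnorm g' <= D * D by rewrite (le_trans (hD _ _ _)) ?ng // ler_peMr.
have ghB : tnorm (g' * h') <= D * D.
  by rewrite (le_trans (tnormM _ _)) // ler_pM ?tnorm_ge0 ?hD ?ng.
have h1 : tnorm (tlog (g' * h') - tlog g') <= e.
  rewrite (le_trans (hL _ _ ghB gB)) //.
  have -> : g' * h' - g' = g' * (h' - 1) by rewrite mulrBr mulr1.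
  apply: le_trans tM; rewrite (@le_trans _ _ (L * (D * (E * t)))) //.
    rewrite ler_wpM2l // (le_trans (tnormM _ _)) //.
    by rewrite ler_pM ?tnorm_ge0 ?hD ?ng // hE // ltW // andbT.
  by rewrite /M mulrDl !mulrA lerDl mul1r ltW.
have -> : tcoef (tlog (g' * h')) w =
    tcoef (tlog g') w + tcoef (tlog (g' * h') - tlog g') w.
  by rewrite -tcoefD [tlog g' + _]addrC subrK.
rewrite (le_trans (ler_normD _ _)) // (@le_trans _ _ (1 + e)) //.
  rewrite lerD //; last by rewrite (le_trans (tcoef_le_tnorm _ _)).
  by have := hnorm_coef (tlog g') w0; rewrite -/(nu g') ng expr1n.
case: w w0 => // i w _; rewrite exprS ler_peMr ?addr_ge0 ?(ltW e0) //.
by rewrite exprn_ege1 // lerDl ltW.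
Qed.

Lemma nuM_l e : 0 < e -> exists2 C, 1 <= C & forall g h, G g -> G h ->
  nu (g * h) <= Num.max (C * nu g) ((1 + e) * nu h).
Proof.
move=> /nuM_r[C C1 hC]; exists C => // g h Gg Gh.
rewrite -nuV; last exact: groupM.
rewrite invrM ?group_unit // maxC -[nu g]nuV // -[nu h]nuV //.
by apply: hC; exact: groupV.
Qed.

(** By scaling let nu g = 1. If h is close enough to 1, so is its conjugate, which is
   then smaller than e; otherwise the size of g, hence that of the conjugate, is at
   most a multiple of the size of h. *)
Lemma nuJ e : 0 < e -> exists2 C, 1 <= C & forall g h, G g -> G h ->
  nu (g^-1 * h * g) <= Num.max (e * nu g) (C * nu h).
Proof.
move=> e0; have [C0 C01 hC0] := nuM_crude.
have C00 : 0 <= C0 by rewrite (le_trans ler01).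
have [D D1 hD] := nu_ball_tnorm; have [E E0 hE] := nu_ball_sub1.
have [L L0 hL] := @locLip_tlog R d N (D * D * D).
have D0 : 0 <= D by rewrite (le_trans ler01).
pose M := L * (D * E * D) + 1.
have M0 : 0 < M by rewrite ltr_wpDl // !mulr_ge0.
pose f := Num.min 1 e.
have f0 : 0 < f by rewrite lt_min ltr01 e0.
have f1 : f <= 1 by rewrite ge_min lexx.
pose t := Num.min 1 (f ^+ N / M).
have t0 : 0 < t by rewrite lt_min ltr01 divr_gt0 // exprn_gt0.
have t1 : t <= 1 by rewrite ge_min lexx.
have tM : M * t <= f ^+ N by rewrite -ler_pdivlMl // mulrC ge_min lexx orbT.
exists (C0 * (C0 * t^-1)) => [|g h Gg Gh].
  by rewrite -[leLHS]mulr1 ler_pM // -[leLHS]mulr1 ler_pM // invf_ge1.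
have GgV := groupV Gg.
rewrite le_max; have [hg|gh] := lerP (nu h) (t * nu g); last first.
  have le1 : nu g <= t^-1 * nu h by rewrite ler_pdivlMl // ltW.
  have le2 : nu h <= t^-1 * nu h by rewrite ler_peMl ?nu_ge0 // invf_ge1.
  apply/orP; right; rewrite -!mulrA; apply: (hC0) => //; first exact: groupM.
    rewrite nuV // (le_trans le1) // ler_peMl //.
    by rewrite mulr_ge0 ?nu_ge0 ?invr_ge0 ?(ltW t0).
  exact: hC0.
apply/orP; left; have := nu_ge0 g; rewrite le_eqVlt => /orP[/eqP e'|g0].
  move: hg; rewrite -e' !mulr0 => /(nu_eq0 Gh)->.
  by rewrite mulr1 mulVr ?group_unit // nu1.
have [g' Gg' [eg ng]] := nu_normalize Gg g0.
have [h' Gh' [eh nh]] := nu_normalize Gh g0.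
have [i' Gi' [ei ni]] := nu_normalize GgV g0.
have {}ng : nu g' = 1 by rewrite ng mulVf // gt_eqF.
have {}ni : nu i' = 1 by rewrite ni nuV // mulVf // gt_eqF.
have {}nh : nu h' <= t by rewrite nh ler_pdivrMl // mulrC.
have nh1 := le_trans nh t1.
have ig : i' * g' = 1.
  have := mulVr (group_unit Gg); rewrite ei {2}eg -dilM => /(congr1 (dil (nu g)^-1)).
  by rewrite dil_dil dil1 mulVf ?gt_eqF // dil_1.
rewrite ei {2}eg {1}eh -!dilM nu_dil //; last by apply: groupM => //; exact: groupM.
rewrite mulrC ler_wpM2r ?(ltW g0) //.
apply: (@le_trans _ _ f); last by rewrite ge_min lexx orbT.
apply: hnorm_tnorm; first by rewrite (ltW f0).
apply: le_trans tM; rewrite -[tlog _]subr0 -tlog1.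
have ighB : tnorm (i' * h' * g') <= D * D * D.
  rewrite (le_trans (tnormM _ _)) // ler_pM ?tnorm_ge0 ?hD ?ng //.
  by rewrite (le_trans (tnormM _ _)) // ler_pM ?tnorm_ge0 ?hD ?ni.
have oneB : tnorm (1 : TN) <= D * D * D.
  rewrite (@le_trans _ _ D) ?hD ?nu1 //; first exact: group1.
  by rewrite ler_peMl // -[leLHS]mulr1 ler_pM.
rewrite (le_trans (hL _ _ ighB oneB)) //.
have -> : i' * h' * g' - 1 = i' * (h' - 1) * g' by rewrite mulrBr mulr1 mulrBl ig.
rewrite (@le_trans _ _ (L * (D * (E * t) * D))) //.
  rewrite ler_wpM2l // (le_trans (tnormM _ _)) // ler_pM ?tnorm_ge0 ?hD ?ng //.
  rewrite (le_trans (tnormM _ _)) // ler_pM ?tnorm_ge0 ?hD ?ni // hE //.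
  by rewrite ltW.
rewrite /M mulrDl mul1r -[leLHS]addr0 lerD ?(ltW t0) //.
by rewrite le_eqVlt; apply/orP; left; apply/eqP; ring.
Qed.

End HomogeneousNorm.

(** * Brackets of basis vectors span the layers *)

Section Brackets.
Context {R : realType} {d N : nat}.
Local Notation TN := (tensor R d N).
Local Notation lie := (@free_nilpotent_lie R d N).
Local Notation G := (@free_nilpotent_group R d N).
Local Notation layer := (@lie_layer R d N).
Local Notation words := (N.-bseq 'I_d).
Local Notation dimT := #|{: N.-bseq 'I_d}|.
Implicit Types (a b c x y z g h u : TN) (w : seq 'I_d) (k : nat).
Implicit Types (B C t l e : R).

Definition coords x : 'rV[R]_dimT := \row_j x (enum_val j).

Lemma coordsD x y : coords (x + y) = coords x + coords y.
Proof. by apply/rowP => j; rewrite !mxE ffunE. Qed.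

Lemma coordsZ l x : coords (l *: x) = l *: coords x.
Proof. by apply/rowP => j; rewrite !mxE ffunE. Qed.

Lemma coords0 : coords 0 = 0.
Proof. by apply/rowP => j; rewrite !mxE ffunE. Qed.

Lemma coords_sum (J : Type) (r : seq J) (P : pred J) (F : J -> TN) :
  coords (\sum_(i <- r | P i) F i) = \sum_(i <- r | P i) coords (F i).
Proof. by elim/big_rec2: _ => [|i u v _ <-]; rewrite ?coords0 ?coordsD. Qed.

Lemma coords_inj x y : coords x = coords y -> x = y.
Proof.
move=> /rowP e; apply/ffunP => w; have := e (enum_rank w).
by rewrite !mxE enum_rankK.
Qed.

Lemma coords_mulmx_bounded n (M : 'M[R]_(dimT, n)) : exists2 C, 0 <= C &
  forall x (j : 'I_n), `|(coords x *m M) 0 j| <= C * tnorm x.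
Proof.
exists (\sum_i \sum_j `|M i j|).
  by apply: sumr_ge0 => i _; apply: sumr_ge0.
move=> x j; rewrite mxE mulr_suml (le_trans (ler_norm_sum _ _ _)) //.
apply: ler_sum => i _; rewrite normrM mulrC ler_pM //.
  by rewrite (bigD1 j) //= lerDl sumr_ge0.
by rewrite mxE -tcoefE tcoef_le_tnorm.
Qed.

Definition basis_vec (i : 'I_d) : TN := tensor_of_vec N (delta_mx 0 i).

Lemma tensor_of_vecE (v : 'rV[R]_d) :
  tensor_of_vec N v = \sum_i v 0 i *: basis_vec i.
Proof.
rewrite {1}[v]row_sum_delta; elim/big_rec2: _ => [|i y1 y2 _ <-].
  by rewrite -(scale0r (0 : 'rV[R]_d)) tensor_of_vecZ scale0r.
by rewrite tensor_of_vecD tensor_of_vecZ.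
Qed.

(** The spanning set of the layer of degree |w| on which the layers become row
   spaces of matrices, hence closed and with bounded coordinates. *)
Fixpoint nested w : TN :=
  match w with
  | [::] => 0
  | [:: i] => basis_vec i
  | i :: w' => bracket (basis_vec i) (nested w')
  end.

Lemma nested_cons i j w :
  nested (i :: j :: w) = bracket (basis_vec i) (nested (j :: w)).
Proof. by []. Qed.

Lemma nested_layer k w : size w = k.+1 -> layer k (nested w).
Proof.
elim: k w => [|k IH] [|i [|j w]] //; first by move=> _; eexists.
by move=> [sw]; rewrite nested_cons; apply: bracket_vec_layer; apply: IH; rewrite /= sw.
Qed.

Definition nested_of k (w : words) : TN :=
  if size w == k.+1 then nested w else 0.

Definition nested_mx k : 'M[R]_dimT :=
  \matrix_i coords (nested_of k (enum_val i)).

Lemma nested_sub k w : size w = k.+1 -> (coords (nested w) <= nested_mx k)%MS.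
Proof.
move=> sw; case: (leqP (size w) N) => [sN|sN]; last first.
  rewrite (_ : nested w = 0) ?coords0 ?sub0mx //.
  apply: tensorP => u su; rewrite tcoef0; apply: (hom_layer (nested_layer sw)).
  by rewrite -sw neq_ltn (leq_ltn_trans su).
have -> : coords (nested w) = row (enum_rank (Bseq sN)) (nested_mx k).
  by rewrite rowK enum_rankK /nested_of /= sw eqxx.
exact: row_sub.
Qed.

Lemma nested_mxP k x : (coords x <= nested_mx k)%MS <->
  exists c : words -> R, x = \sum_(w : words) c w *: nested_of k w.
Proof.
split=> [/submxP[D e]|[c ->]].
  exists (fun w : words => D 0 (enum_rank w)); apply: coords_inj.
  rewrite coords_sum e mulmx_sum_row (reindex_onto enum_rank enum_val) /=.
    apply: eq_big => [w|w _]; first by rewrite enum_rankK eqxx.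
    by rewrite coordsZ rowK enum_rankK.
  by move=> i _; rewrite enum_valK.
rewrite coords_sum; apply: summx_sub => w _; rewrite coordsZ; apply: scalemx_sub.
rewrite /nested_of; case: eqP => [e|_]; last by rewrite coords0 sub0mx.
exact: nested_sub.
Qed.

Lemma layerP k x : layer k x <-> (coords x <= nested_mx k)%MS.
Proof.
split; last first.
  move=> /nested_mxP[c ->]; elim/big_ind: _ => [||w _]; [exact: layer0|exact: layerD|].
  apply: layerZ; rewrite /nested_of; case: eqP => [|_]; last exact: layer0.
  exact: nested_layer.
elim: k x => [|k IH] x.
  move=> [v _ <-]; rewrite tensor_of_vecE coords_sum; apply: summx_sub => i _.
  by rewrite coordsZ; apply: scalemx_sub; apply: (@nested_sub 0 [:: i]).
apply: (@lin_span_ind _ _ _ _ (fun x => (coords x <= nested_mx k.+1)%MS)).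
- by rewrite coords0 sub0mx.
- by move=> a b ha hb; rewrite coordsD addmx_sub.
- by move=> l a ha; rewrite coordsZ scalemx_sub.
move=> _ [_ [v _ <-] [z /IH/nested_mxP[c ->] <-]].
rewrite tensor_of_vecE bracket_suml coords_sum; apply: summx_sub => i _.
rewrite bracketZl bracket_sumr coordsZ coords_sum; apply: scalemx_sub.
apply: summx_sub => w _; rewrite bracketZr coordsZ; apply: scalemx_sub.
rewrite /nested_of; case: eqP => [e|_]; last by rewrite bracket0r coords0 sub0mx.
case: w e => [[|j w] sw] //= [e].
by rewrite -nested_cons; apply: nested_sub; rewrite /= e.
Qed.

(** The coefficients are read off by a partial inverse matrix, so they depend
   linearly, hence boundedly, on x. *)
Lemma layer_coefs k : exists2 C, 0 <= C & forall x, layer k x ->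
  exists2 c : words -> R, (forall w : words, `|c w| <= C * tnorm x) &
    x = \sum_(w : words | size w == k.+1) c w *: nested w.
Proof.
have [C C0 hC] := coords_mulmx_bounded (pinvmx (nested_mx k)).
exists C => // x /layerP hx; have hD := mulmxKpV hx.
set D := coords x *m _ in hD.
exists (fun w : words => D 0 (enum_rank w)) => [w|]; first exact: hC.
apply: coords_inj; rewrite coords_sum -[LHS]hD mulmx_sum_row [RHS]big_mkcond /=.
rewrite (reindex_onto enum_rank enum_val) /=; last by move=> i _; rewrite enum_valK.
apply: eq_big => [w|w _]; first by rewrite enum_rankK eqxx.
rewrite rowK enum_rankK /nested_of; case: ifP => _; first by rewrite coordsZ.
by rewrite coords0 scaler0.
Qed.

Lemma layer_closed k x :
  (forall e, 0 < e -> exists2 y, layer k y & tnorm (x - y) < e) -> layer k x.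
Proof.
move=> hx; apply/layerP; rewrite submxE.
have [C C0 hC] := coords_mulmx_bounded (cokermx (nested_mx k)).
apply/eqP/rowP => j; rewrite [RHS]mxE; apply/eqP; rewrite -normr_le0.
apply/ler_addgt0Pl => e e0; rewrite addr0.
have [|y /layerP] := hx (e / (C + 1)); first by rewrite divr_gt0 // ltr_wpDl.
rewrite submxE => /eqP y0 xy.
have -> : coords x = coords (x - y) + coords y by rewrite -coordsD subrK.
rewrite mulmxDl y0 addr0 (le_trans (hC _ _)) //.
rewrite (@le_trans _ _ (C * (e / (C + 1)))) ?ler_wpM2l ?(ltW xy) //.
rewrite mulrA ler_pdivrMr ?ltr_wpDl // mulrC ler_wpM2l ?(ltW e0) //.
by rewrite lerDl.
Qed.

Lemma tnorm_proj k x : tnorm (proj k x) <= tnorm x.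
Proof.
apply: tnorm_leP => [|w _]; first exact: tnorm_ge0.
rewrite tcoef_proj (le_trans _ (tcoef_le_tnormM x w)) // ler_wpM2l //.
by case: (_ == _); rewrite ?mul1r ?mul0r ?normr0.
Qed.

Lemma lie_closed x :
  (forall e, 0 < e -> exists2 y, lie y & tnorm (x - y) < e) -> lie x.
Proof.
move=> hx; apply/lieP; split=> [|i].
  apply/hdeg1P/eqP; rewrite -normr_le0; apply/ler_addgt0Pl => e e0.
  have [y /lie_hdeg hy xy] := hx e e0; rewrite addr0.
  have -> : tcoef x [::] = tcoef (x - y) [::] by rewrite tcoefB hy ?subr0.
  by rewrite (le_trans (tcoef_le_tnorm _ _)) // ltW.
apply: layer_closed => e e0; have [y /lieP[_ hy] xy] := hx e e0.
exists (proj i.+1 y) => //; rewrite -scaleN1r -projZ scaleN1r -projD.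
exact: le_lt_trans (tnorm_proj _ _) xy.
Qed.

Lemma group_closed g :
  (forall e, 0 < e -> exists2 h, G h & tnorm (g - h) < e) -> G g.
Proof.
move=> hg.
have g1 : tcoef g [::] = 1.
  apply/eqP; rewrite -subr_eq0 -normr_le0; apply/ler_addgt0Pl => e e0.
  have [h /group_coef0 h1 gh] := hg e e0; rewrite addr0 -h1 -tcoefB.
  by rewrite (le_trans (tcoef_le_tnorm _ _)) // ltW.
rewrite -(tlogK g1); apply: group_texp; apply: lie_closed => e e0.
have [C C0 hC] := @locLip_tlog R d N (tnorm g + 1).
have [|h Gh gh] := hg (Num.min 1 (e / (C + 1))).
  by rewrite lt_min ltr01 divr_gt0 // ltr_wpDl.
move: gh; rewrite lt_min => /andP[gh1 gh2].
exists (tlog h); first exact: group_tlog.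
have hB : tnorm h <= tnorm g + 1.
  have -> : h = g - (g - h) by rewrite opprB addrC subrK.
  by rewrite (le_trans (tnormB _ _)) // lerD2l ltW.
rewrite (le_lt_trans (hC _ _ _ hB)) ?lerDl //.
rewrite (@le_lt_trans _ _ (C * (e / (C + 1)))) ?ler_wpM2l ?(ltW gh2) //.
rewrite mulrA ltr_pdivrMr ?ltr_wpDl // mulrC ltr_pM2l //.
by rewrite ltrDl.
Qed.

End Brackets.

(** * Every group element is a product of exponentials of vectors *)

Section Generation.
Context {R : realType} {d N : nat}.
Local Notation TN := (tensor R d N).
Local Notation lie := (@free_nilpotent_lie R d N).
Local Notation G := (@free_nilpotent_group R d N).
Local Notation layer := (@lie_layer R d N).
Local Notation vec := ('rV[R]_d).
Implicit Types (a b c x y z g h u : TN) (w : seq 'I_d) (k n m : nat).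
Implicit Types (B C t l e : R) (v : vec) (s : seq vec).

Definition vexp v : TN := texp (tensor_of_vec N v).

Definition vprod s : TN := foldr (fun v g => vexp v * g) 1 s.

Lemma vec_hdeg v : hdeg 1 (tensor_of_vec N v).
Proof. by apply: (@lie_hdeg R d N); apply: (@lie_layerW R d N 0); exists v. Qed.

Lemma vexp_group v : G (vexp v).
Proof. by apply: group_texp; apply: (@lie_layerW R d N 0); exists v. Qed.

Lemma vprod_cat s1 s2 : vprod (s1 ++ s2) = vprod s1 * vprod s2.
Proof. by elim: s1 => [|v s IH] /=; rewrite ?mul1r // IH mulrA. Qed.

Lemma vprod_group s : G (vprod s).
Proof.
elim: s => [|v s IH] /=; first exact: group1.
by apply: groupM => //; exact: vexp_group.
Qed.

Lemma tensor_of_vecN v : tensor_of_vec N (- v) = - tensor_of_vec N v.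
Proof. by rewrite -scaleN1r tensor_of_vecZ scaleN1r. Qed.

Lemma eucl_normZ l v : eucl_norm (l *: v) = `|l| * eucl_norm v.
Proof.
rewrite /eucl_norm -sqrtr_sqr -sqrtrM ?sqr_ge0 // mulr_sumr.
by congr Num.sqrt; apply: eq_bigr => i _; rewrite mxE exprMn.
Qed.

Lemma eucl_normN v : eucl_norm (- v) = eucl_norm v.
Proof. by rewrite -scaleN1r eucl_normZ normrN1 mul1r. Qed.

Lemma eucl_norm_ge0 v : 0 <= eucl_norm v.
Proof. exact: sqrtr_ge0. Qed.

Lemma coord_eucl v i : `|v 0 i| <= eucl_norm v.
Proof.
rewrite /eucl_norm -sqrtr_sqr ler_wsqrtr // (bigD1 i) //= lerDl.
by apply: sumr_ge0 => j _; exact: sqr_ge0.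
Qed.

Definition generated n C g := exists s : seq vec,
  [/\ (size s <= n)%N, (forall v, v \in s -> eucl_norm v <= C) & vprod s = g].

Lemma generated_group n C g : generated n C g -> G g.
Proof. by move=> [s [_ _ <-]]; exact: vprod_group. Qed.

Lemma generated_le n m B C g : (n <= m)%N -> B <= C ->
  generated n B g -> generated m C g.
Proof.
move=> nm BC [s [sn sB <-]]; exists s; split=> //; first exact: leq_trans nm.
by move=> v /sB vB; exact: le_trans BC.
Qed.

Lemma generated1 n C : generated n C 1.
Proof. by exists [::]. Qed.

Lemma generatedM n m C g h : generated n C g -> generated m C h ->
  generated (n + m) C (g * h).
Proof.
move=> [s [sn sC <-]] [r [rm rC <-]]; exists (s ++ r); split.
- by rewrite size_cat leq_add.
- by move=> v; rewrite mem_cat => /orP[/sC|/rC].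
- exact: vprod_cat.
Qed.

Lemma vprod_revN s : vprod (rev (map -%R s)) * vprod s = 1.
Proof.
elim: s => [|v s IH]; first by rewrite mulr1.
rewrite map_cons rev_cons -cats1 vprod_cat /= mulr1 -mulrA [_ * (_ * vprod s)]mulrA.
by rewrite /vexp tensor_of_vecN texpNK ?mul1r //; exact: vec_hdeg.
Qed.

Lemma generatedV n C g : generated n C g -> generated n C g^-1.
Proof.
move=> [s [sn sC <-]]; exists (rev (map -%R s)); split.
- by rewrite size_rev size_map.
- move=> v; rewrite mem_rev => /mapP[u us ->].
  by rewrite eucl_normN sC.
- apply: (mulIr (group_unit (vprod_group s))).
  by rewrite vprod_revN mulVr // group_unit //; exact: vprod_group.
Qed.

Lemma generated_vexp C v : eucl_norm v <= C -> generated 1 C (vexp v).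
Proof.
move=> vC; exists [:: v]; split=> //; last by rewrite /= mulr1.
by move=> u; rewrite inE => /eqP ->.
Qed.

Lemma dil_vec l v : dil l (tensor_of_vec N v) = tensor_of_vec N (l *: v).
Proof.
rewrite tensor_of_vecZ -[l in RHS]expr1; apply: (@dil_layer R d N l 0).
by exists v.
Qed.

Lemma generated_dil n C l g : 0 <= l -> generated n C g ->
  generated n (l * C) (dil l g).
Proof.
move=> l0 [s [sn sC <-]]; exists (map ( *:%R l) s); split.
- by rewrite size_map.
- by move=> v /mapP[u us ->]; rewrite eucl_normZ ger0_norm // ler_wpM2l // sC.
- elim: s {sn sC} => [|v s IH] /=; first by rewrite dil1.
  by rewrite IH dilM /vexp dil_texp dil_vec.
Qed.

Lemma vec_bounded C : exists2 B, 0 <= B &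
  forall v, eucl_norm v <= C -> tnorm (tensor_of_vec N v) <= B.
Proof.
exists (N.+1%:R * Num.max C 0) => [|v vC].
  by rewrite mulr_ge0 // le_max lexx orbT.
apply: tnorm_le => [|w sw]; first by rewrite le_max lexx orbT.
rewrite tcoef_vec //; case: w {sw} => [|i [|j w]];
  rewrite ?normr0 ?le_max ?lexx ?orbT //.
by rewrite (le_trans (coord_eucl _ _)).
Qed.

Lemma generated_bounded n C : exists2 B, 0 <= B &
  forall g, generated n C g -> tnorm g <= B.
Proof.
have [B0 B00 hB0] := vec_bounded C.
have [D D0 hD] := locLip_bounded B0 (@locLip_texp R d N).
suff [B B0' hB] : exists2 B, 0 <= B & forall s, (size s <= n)%N ->
    (forall v, v \in s -> eucl_norm v <= C) -> tnorm (vprod s) <= B.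
  by exists B => // g [s [sn sC <-]]; exact: hB.
elim: n => [|n [B Bp hB]].
  by exists (tnorm (1 : TN)); [exact: tnorm_ge0|move=> [|//]].
exists (tnorm (1 : TN) + D * B); first by rewrite addr_ge0 ?tnorm_ge0 ?mulr_ge0.
move=> [|v s] /= sn sC; first by rewrite lerDl mulr_ge0.
rewrite (le_trans (tnormM _ _)) // (@le_trans _ _ (D * B)) ?lerDr ?tnorm_ge0 //.
rewrite ler_pM ?tnorm_ge0 //; first by apply/hD/hB0/sC; rewrite mem_head.
by apply: hB => // u us; apply: sC; rewrite inE us orbT.
Qed.

End Generation.

Section Chow.
Context {R : realType} {d N : nat}.
Local Notation TN := (tensor R d N).
Local Notation lie := (@free_nilpotent_lie R d N).
Local Notation G := (@free_nilpotent_group R d N).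
Local Notation layer := (@lie_layer R d N).
Local Notation words := (N.-bseq 'I_d).
Local Notation vec := ('rV[R]_d).
Implicit Types (a b x y z g h u : TN) (k n m : nat).
Implicit Types (B C t l e : R) (v : vec) (s : seq vec).

Lemma texp_hdeg1 k y : (0 < k)%N -> hdeg k y -> hdeg k.+1 (texp y - 1 - y).
Proof.
by move=> k0 hy; have := texp_triangular k0 (hdeg0 (k := 1)) hy; rewrite add0r texp0.
Qed.

Lemma texp_sub1_hdeg k y : hdeg 1 y -> hdeg k (texp y - 1) -> hdeg k y.
Proof.
move=> hy; elim: k => [//|[|k] IH] h; first exact: hy.
have hk := IH (hdeg_le (leqnSn _) h).
have -> : y = (texp y - 1) - (texp y - 1 - y) by rewrite opprB addrC subrK.
by apply: hdegB => //; exact: texp_hdeg1.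
Qed.

Lemma group_lead_layer k g : G g -> hdeg k.+1 (g - 1) -> layer k (proj k.+1 g).
Proof.
move=> [y ly <-] h; have hy := texp_sub1_hdeg (lie_hdeg ly) h.
have hT := texp_hdeg1 (ltn0Sn k) hy.
have -> : proj k.+1 (texp y) = proj k.+1 y; last by have /lieP[] := ly.
apply: tensorP => w sw; rewrite !tcoef_proj.
have [e|_] := eqVneq (size w) k.+1; last by rewrite !mul0r.
have := hT w; rewrite e ltnSn => /(_ isT).
rewrite !tcoefB tcoef_one //; case: w e {sw} => //= i w _.
by rewrite subr0 => /eqP; rewrite subr_eq0 => /eqP ->.
Qed.

(** Writing g = 1 + a + r and h = 1 + b + q with r, q of higher degree, the commutator
   is 1 + [g, h] g^-1 h^-1, and [g, h] agrees with [a, b] up to higher degree. *)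
Lemma commutator_lead i j g h a b : G g -> G h -> (0 < i)%N -> (0 < j)%N ->
  hdeg i a -> hdeg j b ->
  hdeg i.+1 (g - 1 - a) -> hdeg j.+1 (h - 1 - b) ->
  hdeg (i + j).+1 (g * h * g^-1 * h^-1 - 1 - bracket a b).
Proof.
move=> Gg Gh i0 j0 ha hb hga hhb.
set r := g - 1 - a in hga; set q := h - 1 - b in hhb.
have eg : g = 1 + a + r by rewrite /r; tlin.
have eh : h = 1 + b + q by rewrite /q; tlin.
set P := g^-1 * h^-1.
have hgP : g * h * P = 1 + bracket g h * P.
  have e1 : h * g * P = 1.
    by rewrite /P mulrA mulrK ?group_unit // divrr ?group_unit.
  by rewrite /bracket mulrBl e1 addrC subrK.
have hP : hdeg 1 (P - 1).
  apply/hdeg1P; rewrite tcoefB tcoef1_0 tcoefM0 !group_coef0 ?mulr1 ?subrr //;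
    exact: groupV.
have hbr : hdeg (i + j).+1 (bracket g h - bracket a b).
  have -> : bracket g h - bracket a b = bracket a q + bracket r (b + q).
    by rewrite eg eh /bracket !(mulrDl, mulrDr, mulr1, mul1r); tlin.
  apply: hdegD; rewrite /bracket; apply: hdegB.
  - by rewrite -addnS; exact: hdegM.
  - by rewrite addnC -addSn; exact: hdegM.
  - rewrite -addSn; apply: hdegM => //; apply: hdegD => //.
    exact: hdeg_le hhb.
  - have -> : (i + j).+1 = (j + i.+1)%N by lia.
    apply: hdegM => //; apply: hdegD => //; exact: hdeg_le hhb.
have hab : hdeg (i + j) (bracket a b).
  by apply: hdegB; [exact: hdegM|rewrite addnC; exact: hdegM].
rewrite -mulrA -/P hgP [1 + _]addrC addrK.
have -> : bracket g h * P - bracket a b =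
    (bracket g h - bracket a b) * P + bracket a b * (P - 1).
  move: (bracket g h) (bracket a b) (P) => p s P'.
  by rewrite mulrBl mulrBr mulr1 addrA subrK.
apply: hdegD; first exact: hdegMl.
by rewrite -addn1; apply: hdegM.
Qed.

(** A multiple of a nested bracket is the leading term of an iterated group
   commutator of exponentials of basis vectors. The scalar is carried by the
   innermost vector, so that the number of factors does not depend on it. *)
Lemma nested_generated k (w : seq 'I_d) M : size w = k.+1 ->
  exists n C, forall c : R, `|c| <= M -> exists2 h : TN, generated n C h &
    hdeg k.+2 (h - 1 - c *: nested w).
Proof.
have base (i : 'I_d) (c : R) :
    hdeg 2 (vexp (c *: delta_mx 0 i) - 1 - c *: @basis_vec R d N i).
  rewrite /vexp tensor_of_vecZ; apply: texp_hdeg1 => //; apply: hdegZ.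
  exact: vec_hdeg.
have norm1 (i : 'I_d) (c : R) : eucl_norm (c *: delta_mx 0 i) <= `|c|.
  rewrite eucl_normZ /eucl_norm (bigD1 i) //= mxE !eqxx expr1n big1 => [|j ji].
    by rewrite addr0 sqrtr1 mulr1.
  by rewrite mxE eqxx (negbTE ji) expr0n.
elim: k w => [|k IH] [|i [|j w]] //.
  move=> _; exists 1%N, M => c cM; exists (vexp (c *: delta_mx 0 i)).
    by apply: generated_vexp; exact: le_trans (norm1 _ _) cM.
  exact: base.
move=> [sw]; have [|n [C hC]] := IH (j :: w); first by rewrite /= sw.
pose C' := Num.max 1 C; pose e := vexp (1 *: delta_mx 0 i) : TN.
have ge : generated 1 C' e.
  apply: generated_vexp; rewrite (le_trans (norm1 _ _)) // normr1.
  by rewrite le_max lexx.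
exists (1 + n + 1 + n)%N, C' => c cM; have [h gh hh] := hC c cM.
have {}gh : generated n C' h.
  by apply: generated_le gh => //; rewrite le_max lexx orbT.
exists (e * h * e^-1 * h^-1).
  by do ![apply: generatedM|apply: generatedV|assumption].
rewrite nested_cons -bracketZr -[k.+3]/((1 + k.+1).+1).
apply: commutator_lead => //.
- exact: generated_group ge.
- exact: generated_group gh.
- exact: vec_hdeg.
- apply: hdegZ => u su; apply: (hom_layer (nested_layer (w := j :: w) (k := k) _)).
    by rewrite /= sw.
  by rewrite neq_ltn su.
- by have := base i 1; rewrite [1 *: basis_vec i]scale1r.
Qed.

Lemma nested_sum_generated k M (r : seq words) :
  (forall w, w \in r -> size w = k.+1) ->
  exists n C, forall c : words -> R, (forall w, `|c w| <= M) ->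
  exists2 h : TN, generated n C h &
    hdeg k.+2 (h - 1 - \sum_(w <- r) c w *: nested w).
Proof.
elim: r => [|w r IH] hr.
  exists 0%N, 0 => c _; exists 1; first exact: generated1.
  by rewrite big_nil subr0 subrr; exact: hdeg0.
have [n [C hC]] := IH (fun (v0 : words) vr => hr v0 (mem_behead (s := w :: r) vr)).
have sw := hr w (mem_head _ _).
have [m [D hD]] := nested_generated M sw.
exists (m + n)%N, (Num.max D C) => c cM.
have [h gh hh] := hC c cM; have [g gg hg] := hD (c w) (cM w).
exists (g * h).
  apply: generatedM; [apply: generated_le gg|apply: generated_le gh] => //.
    by rewrite le_max lexx.
  by rewrite le_max lexx orbT.
rewrite big_cons; set a := c w *: _ in hg *; set b := \sum_(_ <- _) _ in hh *.
have hom_hdeg u : hom k.+1 u -> hdeg k.+1 u.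
  by move=> hu v sv; apply: hu; rewrite neq_ltn sv.
have ha : hdeg k.+1 a by apply/hdegZ/hom_hdeg/hom_layer/nested_layer.
have hb : hdeg k.+1 b.
  rewrite /b big_seq; apply: hdeg_sum => v vr; apply/hdegZ/hom_hdeg/hom_layer.
  by apply: nested_layer; apply: hr; rewrite inE vr orbT.
set p := g - 1 - a in hg; set q := h - 1 - b in hh.
have eg : g = 1 + a + p by rewrite /p; tlin.
have eh : h = 1 + b + q by rewrite /q; tlin.
have -> : g * h - 1 - (a + b) = p * h + q + a * (b + q).
  by rewrite eh {1}eg !(mulrDl, mulrDr, mulr1, mul1r); tlin.
apply: hdegD; first by apply: hdegD => //; exact: hdegMl.
apply: (@hdeg_le _ _ _ _ (k.+1 + k.+1)); first lia.
by apply: hdegM => //; apply: hdegD => //; exact: hdeg_le hh.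
Qed.

(** The leading term of g - 1 is matched by a product of group commutators; dividing
   it out raises the degree by one and keeps the element bounded. *)
Lemma bounded_generated k B : (k <= N)%N ->
  exists n C, forall g, G g -> hdeg (N - k).+1 (g - 1) -> tnorm g <= B ->
  generated n C g.
Proof.
elim: k B => [|k IH] B kN.
  exists 0%N, 0 => g Gg hg _; have -> : g = 1; last exact: generated1.
  apply/eqP; rewrite -subr_eq0; apply/eqP; apply: hdeg_eq0 hg.
  by rewrite subn0.
set i := (N - k.+1)%N.
have ei : (N - k = i.+1)%N by rewrite /i; lia.
have [L L0 hL] := @layer_coefs R d N i.
have [|n [C hC]] := @nested_sum_generated i (L * B)
  [seq w : words <- index_enum _ | size w == i.+1].
  by move=> w; rewrite mem_filter => /andP[/eqP].
have [D D0 hD] := @generated_bounded R d N n C.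
have [m [E hE]] := IH (D * B) (ltnW kN).
exists (n + m)%N, (Num.max C E) => g Gg hg gB.
have [c hc ec] := hL _ (group_lead_layer Gg hg).
have [|h gh hh] := hC c.
  move=> w; rewrite (le_trans (hc w)) // ler_wpM2l //.
  exact: le_trans (tnorm_proj _ _) gB.
rewrite big_filter -ec in hh.
have Gh := generated_group gh.
have gV := generatedV gh.
have -> : g = h * (h^-1 * g) by rewrite mulrA divrr ?group_unit // mul1r.
apply: generatedM.
  by apply: generated_le gh => //; rewrite le_max lexx.
apply: (@generated_le _ _ _ m m E); rewrite ?le_max ?lexx ?orbT //.
apply: hE; first by apply: groupM => //; exact: groupV.
  rewrite ei.
  have -> : h^-1 * g - 1 = h^-1 * (g - h) by rewrite mulrBr mulVr ?group_unit.
  apply: hdegMr.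
  have -> : g - h = (g - 1 - proj i.+1 g) - (h - 1 - proj i.+1 g) by tlin.
  apply: hdegB => // w sw.
  rewrite !tcoefB tcoef_proj.
  have [e|ne] := eqVneq (size w) i.+1.
    rewrite mul1r; case: (leqP (size w) N) => sN; last by rewrite !tcoef_big // !subr0.
    by rewrite tcoef_one //; case: w e {sN sw} => //= ? ? _; rewrite subr0 subrr.
  by rewrite mul0r subr0 -tcoefB hg // ltn_neqAle ne /= -ltnS.
rewrite (le_trans (tnormM _ _)) // ler_pM ?tnorm_ge0 //; exact: hD.
Qed.

(** Chow's theorem in quantitative form: bounded_generated on the unit ball of nu,
   transported by dilations. *)
Lemma nu_generated : exists n, exists2 C, 0 <= C & forall g l, G g -> 0 < l ->
  nu g <= l -> generated n (C * l) g.
Proof.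
have [D D1 hD] := @nu_ball_tnorm R d N.
have [n [C hC]] := bounded_generated D (leqnn N).
exists n, (Num.max C 0) => [|g l Gg l0 gl]; first by rewrite le_max lexx orbT.
have [g' Gg' [eg ng]] := nu_normalize Gg l0.
rewrite eg mulrC; apply: generated_dil; first exact: ltW.
apply: (@generated_le _ _ _ n n C); rewrite ?le_max ?lexx //.
have g1 : nu g' <= 1 by rewrite ng ler_pdivrMl ?mulr1.
apply: hC => //; last exact: hD.
by rewrite subnn; apply/hdeg1P; rewrite tcoefB tcoef1_0 group_coef0 ?subrr.
Qed.

End Chow.

(** * Signatures and the Carnot-Caratheodory norm *)

Section RiemannStieltjes.
Context {R : realType}.
Implicit Types (a b t x e C : R) (f g F : R -> R) (s : seq R).

Lemma part_pt_size a b s : itv_partition a b s -> part_pt a s (size s) = b.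
Proof. exact: itv_partition_nth_size. Qed.

Lemma part_pt_lt a b s k : itv_partition a b s -> (k < size s)%N ->
  part_pt a s k < part_pt a s k.+1.
Proof. by move=> [/(pathP a) + _] => /[apply]. Qed.

Lemma part_pt_itv a b s k : itv_partition a b s -> (k <= size s)%N ->
  a <= part_pt a s k <= b.
Proof.
move=> abs ks; rewrite /part_pt (set_nth_default b) ?ltnS //.
by rewrite (itv_partition_nth_ge _ abs) ?(itv_partition_nth_le _ abs).
Qed.

Lemma sum_part_pt (V : zmodType) (F : R -> V) a b s : itv_partition a b s ->
  \sum_(0 <= k < size s) (F (part_pt a s k.+1) - F (part_pt a s k)) = F b - F a.
Proof.
by move=> abs; rewrite (telescope_sumr (fun k => F (part_pt a s k))) // (part_pt_size abs).
Qed.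

Lemma fine_partition a b e : a <= b -> 0 < e ->
  exists2 s, itv_partition a b s & forall k, (k < size s)%N ->
    part_pt a s k.+1 - part_pt a s k < e.
Proof.
rewrite le_eqVlt => /orP[/eqP <-|ab] e0.
  by exists [::] => //; split=> //=.
pose n := (Num.truncn ((b - a) / e)).+1.
have n0 : 0 < n%:R :> R by rewrite ltr0n.
pose h := (b - a) / n%:R.
have h0 : 0 < h by rewrite divr_gt0 ?subr_gt0.
have hn : h < e.
  rewrite ltr_pdivrMr // mulrC -ltr_pdivrMr //; exact: truncnS_gt.
pose s := [seq a + i%:R * h | i <- iota 1 n].
have ss : size s = n by rewrite size_map size_iota.
have pt k : (k <= n)%N -> part_pt a s k = a + k%:R * h.
  case: k => [|k] kn; first by rewrite /part_pt /= mul0r addr0.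
  by rewrite /part_pt /= (nth_map 0%N) ?size_iota // nth_iota // add1n.
have step k : (k < n)%N -> part_pt a s k.+1 - part_pt a s k = h.
  by move=> kn; rewrite !pt // 1?ltnW // -natr1; ring.
exists s; last by move=> k; rewrite ss => kn; rewrite step.
split.
  apply/(pathP a) => i; rewrite ss => iS.
  by have := step i iS; rewrite /part_pt /= => e1; rewrite -subr_gt0 e1.
have -> : last a s = part_pt a s n by rewrite /part_pt -ss -last_nth.
have hnh : n%:R * h = b - a by rewrite /h mulrCA mulfV ?mulr1 ?gt_eqF.
by rewrite pt // hnh addrC subrK.
Qed.

Lemma RSint_unique f g a b l l' : a <= b ->
  is_RSint f g a b l -> is_RSint f g a b l' -> l = l'.
Proof.
move=> ab hl hl'; apply/eqP; rewrite -subr_eq0 -normr_le0.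
apply/ler_addgt0Pl => e e0; rewrite addr0.
have e2 : 0 < e / 2 by rewrite divr_gt0.
have [d1 d10 h1] := hl _ e2; have [d2 d20 h2] := hl' _ e2.
have [|s abs sm] := @fine_partition a b (Num.min d1 d2) ab.
  by rewrite lt_min d10.
have hx d : Num.min d1 d2 <= d -> forall k, (k < size s)%N ->
    part_pt a s k.+1 - part_pt a s k < d /\
    part_pt a s k <= part_pt a s k <= part_pt a s k.+1.
  move=> hd k ks; rewrite lexx ltW; last exact: part_pt_lt abs ks.
  by split=> //; exact: lt_le_trans (sm k ks) hd.
have le1 : Num.min d1 d2 <= d1 by rewrite ge_min lexx.
have le2 : Num.min d1 d2 <= d2 by rewrite ge_min lexx orbT.
have {}h1 := h1 s (part_pt a s) abs (hx _ le1).
have {}h2 := h2 s (part_pt a s) abs (hx _ le2).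
move: h1 h2; move: (\sum_(_ <= _ < _) _) => S h1 h2.
have -> : l - l' = (S - l') - (S - l) by ring.
by rewrite (le_trans (ler_normB _ _)) // [e]splitr lerD // ltW.
Qed.

(** A primitive is recognized by a second order error bound on the increments, which
   add up to a multiple of the mesh. *)
Lemma is_RSint_primitive f g F a b C : a <= b ->
  (forall r x t : R, a <= r -> r <= x -> x <= t -> t <= b ->
    `|F t - F r - f x * (g t - g r)| <= C * (t - r) ^+ 2) ->
  is_RSint f g a b (F b - F a).
Proof.
move=> ab hF e e0.
have C0 : 0 <= `|C| * (b - a) by rewrite mulr_ge0 // subr_ge0.
pose del := e / (`|C| * (b - a) + 1).
exists del => [|s xi abs hs]; first by rewrite divr_gt0 // ltr_wpDl.
rewrite -(sum_part_pt F abs) -sumrB.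
rewrite (@le_lt_trans _ _ (\sum_(0 <= k < size s)
  `|C| * del * (part_pt a s k.+1 - part_pt a s k))) //.
  rewrite (le_trans (ler_norm_sum _ _ _)) // !big_nat; apply: ler_sum => k /= ks.
  have [hd /andP[x1 x2]] := hs k ks.
  have /andP[p1 _] := part_pt_itv abs (ltnW ks).
  have /andP[_ p2] := part_pt_itv abs ks.
  have p3 := part_pt_lt abs ks.
  rewrite distrC (le_trans (hF _ _ _ p1 x1 x2 p2)) // expr2 mulrA -subr_ge0.
  move: (part_pt a s k) (part_pt a s k.+1) hd p3 => u v hd p3.
  have : C <= `|C| by exact: ler_norm.
  have : 0 <= `|C| by [].
  move: (`|C|) => c c0 Cc; rewrite subr_ge0 ler_wpM2r ?subr_ge0 ?(ltW p3) //.
  rewrite (@le_trans _ _ (c * (v - u))) ?ler_wpM2r ?ler_wpM2l ?subr_ge0 ?(ltW p3) //.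
  exact: ltW.
rewrite -mulr_sumr (sum_part_pt id abs) /= mulrAC /del mulrCA.
rewrite -ltr_pdivlMl // mulVf ?gt_eqF // ltr_pdivrMr ?ltr_wpDl // mul1r.
by rewrite ltrDl.
Qed.

Lemma RSint_primitive f g F a b C : a <= b ->
  (forall r x t : R, a <= r -> r <= x -> x <= t -> t <= b ->
    `|F t - F r - f x * (g t - g r)| <= C * (t - r) ^+ 2) ->
  RSint f g a b = F b - F a.
Proof.
move=> ab hF; have h := is_RSint_primitive ab hF.
by apply: get_unique => // y /(RSint_unique ab h).
Qed.

(** When the integral does not exist, RSint is the default value 0, which also
   satisfies the bound. *)
Lemma RSint_bound f g a b M V : a <= b -> 0 <= M ->
  (forall x, a <= x <= b -> `|f x| <= M) ->
  (forall s, itv_partition a b s ->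
    \sum_(0 <= k < size s) `|g (part_pt a s k.+1) - g (part_pt a s k)| <= V) ->
  `|RSint f g a b| <= M * V.
Proof.
move=> ab M0 hf hg.
have V0 : 0 <= V.
  have [s abs _] := fine_partition ab ltr01.
  by apply: le_trans (hg s abs); apply: sumr_ge0.
have [[l hl]|hn] := pselect (exists l, is_RSint f g a b l); last first.
  rewrite /RSint getPN => [|x hx]; last by apply: hn; exists x.
  by rewrite normr0 mulr_ge0.
have := getPex (ex_intro _ l hl : exists x, [set l | is_RSint f g a b l] x).
rewrite -/(RSint f g a b) => {l}hl.
apply/ler_addgt0Pl => e e0; have [del d0 hd] := hl e e0.
have [s abs sm] := fine_partition ab d0.
have := hd s (part_pt a s) abs.
have hx k : (k < size s)%N -> part_pt a s k.+1 - part_pt a s k < del /\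
    part_pt a s k <= part_pt a s k <= part_pt a s k.+1.
  by move=> ks; rewrite sm // lexx ltW // (part_pt_lt abs).
move=> /(_ hx); set S := \sum_(_ <= _ < _) _ => hS.
have hS2 : `|S| <= M * V.
  rewrite (le_trans (ler_norm_sum _ _ _)) //.
  apply: le_trans (ler_wpM2l M0 (hg s abs)); rewrite mulr_sumr !big_nat.
  apply: ler_sum => k /= ks; rewrite normrM ler_wpM2r // hf //.
  exact: part_pt_itv abs (ltnW ks).
have -> : RSint f g a b = S - (S - RSint f g a b) by rewrite opprB addrC subrK.
rewrite (le_trans (ler_normB _ _)) // addrC lerD //; exact: ltW.
Qed.

End RiemannStieltjes.

Section Signatures.
Context {R : realType} {d N : nat}.
Local Notation TN := (tensor R d N).
Local Notation G := (@free_nilpotent_group R d N).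
Local Notation vec := ('rV[R]_d).
Local Notation tv := (@tensor_of_vec R d N).
Implicit Types (B C L e : R).

Lemma path_length_ge0 (gamma : R -> vec) : (0 <= path_length 0 1 gamma)%E.
Proof.
have h := @itv_partition1 _ R 0 1 ltr01.
apply: le_trans (ereal_sup_ubound _); last by exists [:: 1].
by rewrite lee_fin; apply: sumr_ge0 => k _; exact: eucl_norm_ge0.
Qed.

Lemma partition_length (gamma : R -> vec) (t : R) s : bv_path gamma ->
  0 <= t <= 1 -> itv_partition 0 t s ->
  \sum_(0 <= k < size s)
    eucl_norm (gamma (part_pt 0 s k.+1) - gamma (part_pt 0 s k)) <=
  fine (path_length 0 1 gamma).
Proof.
move=> [_ hL] /andP[t0 t1] h0t.
have full s' : itv_partition 0 1 s' -> \sum_(0 <= k < size s')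
    eucl_norm (gamma (part_pt 0 s' k.+1) - gamma (part_pt 0 s' k)) <=
    fine (path_length 0 1 gamma).
  move=> hs'; rewrite -lee_fin fineK; last first.
    by rewrite ge0_fin_numE // path_length_ge0.
  by apply: ereal_sup_ubound; exists s'.
move: t1; rewrite le_eqVlt => /orP[/eqP e|t1].
  by apply: full; rewrite -e.
apply: le_trans (full (s ++ [:: 1]) _); last first.
  exact: itv_partition_cat h0t (itv_partition1 t1).
rewrite size_cat addn1 big_nat_recr //= -[leLHS]addr0 lerD ?eucl_norm_ge0 //.
rewrite !big_nat; apply: ler_sum => k /= ks.
by rewrite /part_pt -cat_cons !nth_cat /= !ltnS (ltnW ks) ks.
Qed.

Lemma iterated_int_bound (gamma : R -> vec) (w : seq 'I_d) (t : R) :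
  bv_path gamma -> 0 <= t <= 1 ->
  `|iterated_int gamma w t| <= fine (path_length 0 1 gamma) ^+ size w.
Proof.
move=> bv; set L := fine _; have L0 : 0 <= L by rewrite fine_ge0 ?path_length_ge0.
elim: w t => [|i w IH] t t01 /=; first by rewrite expr0 normr1.
have /andP[t0 t1] := t01.
rewrite exprSr; apply: RSint_bound => //; first exact: exprn_ge0.
  by move=> x /andP[x0 xt]; apply: IH; rewrite x0 (le_trans xt).
move=> s h0t; apply: le_trans (partition_length bv t01 h0t).
apply: ler_sum => k _; apply: le_trans (coord_eucl _ i).
by rewrite !mxE.
Qed.

(** By scaling, it suffices that nu is bounded on bounded sets of tensors. *)
Lemma nu_coef_bound : exists2 C, 1 <= C & forall (g : TN) l, G g -> 0 <= l ->
  (forall w : seq 'I_d, (0 < size w <= N)%N -> `|tcoef g w| <= l ^+ size w) ->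
  nu g <= C * l.
Proof.
have [C C1 hC] := @nu_tnorm_ball R d N (N.+1%:R * 1).
exists C => // g l Gg + hg; rewrite le_eqVlt => /orP[/eqP l0|l0].
  rewrite -l0 mulr0 in hg *; have -> : g = 1; last by rewrite nu1.
  apply: tensorP => -[_|i w sw]; first by rewrite group_coef0 // tcoef1_0.
  rewrite tcoef_one //; apply/eqP; rewrite -normr_le0.
  by rewrite (le_trans (hg (i :: w) _)) // expr0n.
have [g' Gg' [eg ng]] := nu_normalize Gg l0.
rewrite eg nu_dil // mulrC ler_wpM2r ?(ltW l0) //; apply: hC => //.
apply: tnorm_le => // w sw; case: w sw => [|i w] sw.
  by rewrite group_coef0 // normr1.
have := hg (i :: w) sw; rewrite eg tcoef_dil normrM ger0_norm ?exprn_ge0 ?(ltW l0) //.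
by rewrite -[leRHS]mulr1 ler_pM2l // exprn_gt0.
Qed.

Lemma signature_nu : exists2 C, 1 <= C & forall gamma : R -> vec,
  bv_path gamma -> G (signature N gamma) ->
  nu (signature N gamma) <= C * fine (path_length 0 1 gamma).
Proof.
have [C C1 hC] := nu_coef_bound; exists C => // gamma bv Gs.
apply: hC => //; first by rewrite fine_ge0 ?path_length_ge0.
move=> w /andP[_ sw].
have -> : tcoef (signature N gamma) w = iterated_int gamma (rev w) 1.
  exact: (tcoef_small (fun w => iterated_int gamma (rev w) 1)).
by rewrite -(size_rev w); apply: iterated_int_bound => //; rewrite ler01 lexx.
Qed.

Lemma tnorm_vec (v : vec) : tnorm (tv v) <= N.+1%:R * eucl_norm v.
Proof.
apply: tnorm_le => [|w sw]; first exact: eucl_norm_ge0.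
rewrite tcoef_vec //; case: w {sw} => [|i [|j w]]; rewrite ?normr0 ?eucl_norm_ge0 //.
exact: coord_eucl.
Qed.

Lemma eucl_normD2 (u v : vec) :
  eucl_norm (u + v) <= 2 * (eucl_norm u + eucl_norm v).
Proof.
rewrite -[leRHS]ger0_norm ?mulr_ge0 ?addr_ge0 ?eucl_norm_ge0 //.
rewrite -sqrtr_sqr; apply: ler_wsqrtr.
pose sq (x : vec) := \sum_i x 0 i ^+ 2.
have sq0 x : 0 <= sq x by apply: sumr_ge0 => i _; exact: sqr_ge0.
have e2 x : eucl_norm x ^+ 2 = sq x.
  by rewrite /eucl_norm sqr_sqrtr //; exact: sq0.
rewrite (@le_trans _ _ (2 * sq u + 2 * sq v)) //.
  rewrite /sq !mulr_sumr -big_split; apply: ler_sum => i _ /=.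
  by rewrite !mxE; have := sqr_ge0 (u 0 i - v 0 i); nra.
have := e2 u; have := e2 v; have := eucl_norm_ge0 u; have := eucl_norm_ge0 v.
by move: (eucl_norm u) (eucl_norm v) => x y x0 y0 <- <-; nra.
Qed.

(** A Lipschitz path gamma in R^d together with its development S in the
   group: S solves dS = S dgamma, up to a second order error. *)
Definition development (gamma : R -> vec) (S : R -> TN) L := [/\ 0 <= L,
  S 0 = 1, (forall t, G (S t)), (forall s t : R, s <= t ->
    eucl_norm (gamma t - gamma s) <= L * (t - s)) &
  exists2 C, 0 <= C & forall s t : R, 0 <= s -> s <= t -> t <= 1 ->
    tnorm (S t - S s - S s * tv (gamma t - gamma s)) <= C * (t - s) ^+ 2].

Lemma development_lipschitz gamma S L : development gamma S L ->
  exists2 C, 0 <= C & (forall t : R, 0 <= t -> t <= 1 -> tnorm (S t) <= C) /\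
    forall s t : R, 0 <= s -> s <= t -> t <= 1 ->
      tnorm (S t - S s) <= C * (t - s).
Proof.
move=> [L0 S0 _ hL [C C0 hC]].
have hv s t : s <= t -> tnorm (tv (gamma t - gamma s)) <= N.+1%:R * L * (t - s).
  by move=> st; rewrite (le_trans (tnorm_vec _)) // -mulrA ler_wpM2l // hL.
set K := N.+1%:R * L in hv; have K0 : 0 <= K by rewrite mulr_ge0.
pose e := tnorm (1 : TN); have e0 : 0 <= e := tnorm_ge0 _.
pose B := C + e * K + e; have B0 : 0 <= B by rewrite !addr_ge0 ?mulr_ge0.
have hB t : 0 <= t -> t <= 1 -> tnorm (S t) <= B.
  move=> t0 t1.
  have -> : S t = (S t - S 0 - S 0 * tv (gamma t - gamma 0)) +
      (S 0 * tv (gamma t - gamma 0) + S 0).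
    by move: (S t) (S 0) (S 0 * _) => x y z; tlin.
  rewrite (le_trans (tnormD _ _)) // /B -[leRHS]addrA lerD //.
    by rewrite (le_trans (hC _ _ _ _ _)) // subr0 ler_piMr // exprn_ile1.
  rewrite (le_trans (tnormD _ _)) // S0 lerD // (le_trans (tnormM _ _)) //.
  by rewrite ler_wpM2l // (le_trans (hv _ _ t0)) // subr0 ler_piMr.
exists (B + (C + B * K)); first by rewrite !addr_ge0 ?mulr_ge0.
split=> [t t0 t1|s t s0 st t1].
  by rewrite (le_trans (hB t _ _)) // lerDl !addr_ge0 ?mulr_ge0.
have -> : S t - S s = (S t - S s - S s * tv (gamma t - gamma s)) +
      S s * tv (gamma t - gamma s) by rewrite subrK.
have ts0 : 0 <= t - s by rewrite subr_ge0.
have ts1 : t - s <= 1 by rewrite (le_trans _ t1) // gerBl.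
rewrite (le_trans (tnormD _ _)) // mulrDl -[leLHS]add0r lerD ?mulr_ge0 //.
rewrite mulrDl lerD //.
  by rewrite (le_trans (hC _ _ _ _ _)) // ler_wpM2l // expr2 ler_piMr.
rewrite (le_trans (tnormM _ _)) // -mulrA ler_pM ?tnorm_ge0 ?hv //.
by rewrite hB // (le_trans st).
Qed.

Lemma development_mid gamma S L : development gamma S L ->
  exists2 C, 0 <= C & forall s x t : R, 0 <= s -> s <= x -> x <= t -> t <= 1 ->
    tnorm (S t - S s - S x * tv (gamma t - gamma s)) <= C * (t - s) ^+ 2.
Proof.
move=> dev; have [D D0 [_ hD]] := development_lipschitz dev.
move: dev => [L0 S0 _ hL [C C0 hC]].
exists (C + D * (N.+1%:R * L)); first by rewrite addr_ge0 ?mulr_ge0.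
move=> s x t s0 sx xt t1; have st := le_trans sx xt.
have ts0 : 0 <= t - s by rewrite subr_ge0.
have -> : S t - S s - S x * tv (gamma t - gamma s) =
    (S t - S s - S s * tv (gamma t - gamma s)) -
    (S x - S s) * tv (gamma t - gamma s).
  by rewrite mulrBl; move: (S t) (S s) (S x * _) (S s * _) => p q r r'; tlin.
rewrite (le_trans (tnormB _ _)) // [leRHS]mulrDl lerD ?hC //.
rewrite (le_trans (tnormM _ _)) // expr2 mulrACA ler_pM ?tnorm_ge0 //.
  by rewrite (le_trans (hD _ _ _ _ _)) // ?(le_trans xt) // ler_wpM2l // lerD2r.
by rewrite (le_trans (tnorm_vec _)) // -mulrA ler_wpM2l // hL.
Qed.

Lemma tcoef_mul_vec (a : TN) (v : vec) w i : (size w < N)%N ->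
  tcoef (a * tv v) (rcons w i) = tcoef a w * v 0 i.
Proof.
move=> sw; rewrite tcoef_mul ?size_rcons // /Defs.conv size_rcons.
rewrite big_ord_recr big_ord_recr /=.
have -> : take (size w) (rcons w i) = w by rewrite -cats1 take_size_cat.
have -> : drop (size w) (rcons w i) = [:: i] by rewrite -cats1 drop_size_cat.
rewrite [drop (size w).+1 _]drop_oversize ?size_rcons // !tcoef_vec //; last exact: leq_ltn_trans (leq0n _) sw.
rewrite mulr0 addr0 big1 ?add0r // => j _.
rewrite tcoef_vec; last by rewrite size_drop size_rcons; lia.
have : (1 < size (drop j (rcons w i)))%N.
  by rewrite size_drop size_rcons; have := ltn_ord j; lia.
by case: drop => [|x [|y u]] //; rewrite mulr0.
Qed.

(** The coefficients of S are successive primitives of each other against the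
   coordinates of gamma, like the iterated integrals. *)
Lemma development_signature gamma S L : development gamma S L ->
  signature N gamma = S 1.
Proof.
move=> dev; have [C C0 hC] := development_mid dev; have [_ S0 GS _ _] := dev.
have main w : forall t : R, 0 <= t -> t <= 1 -> (size w <= N)%N ->
    iterated_int gamma (rev w) t = tcoef (S t) w.
  elim/last_ind: w => [|w i IH] t t0 t1.
    by move=> _ /=; rewrite group_coef0.
  rewrite size_rcons rev_rcons /= => sw.
  rewrite (@RSint_primitive _ _ _ (fun u => tcoef (S u) (rcons w i)) 0 t C) //.
    rewrite S0 tcoef_one ?size_rcons // /nilp size_rcons subr0 //.
  move=> s x u s0 sx xu ut; have u1 := le_trans ut t1.
  have h := hC s x u s0 sx xu u1.
  rewrite IH ?(le_trans s0) ?(le_trans xu) 1?ltnW //.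
  have := le_trans (tcoef_le_tnorm _ (rcons w i)) h.
  by rewrite !tcoefB tcoef_mul_vec // !mxE.
apply: tensorP => w sw; rewrite -main //.
exact: (tcoef_small (fun w => iterated_int gamma (rev w) 1)).
Qed.

End Signatures.

Section CarnotCaratheodory.
Context {R : realType} {d N : nat}.
Local Notation TN := (tensor R d N).
Local Notation G := (@free_nilpotent_group R d N).
Local Notation vec := ('rV[R]_d).
Local Notation tv := (@tensor_of_vec R d N).
Implicit Types (B C L e : R) (gamma : R -> vec) (S : R -> TN).

Lemma lipschitz_continuous gamma L : 0 <= L ->
  (forall s t : R, s <= t -> eucl_norm (gamma t - gamma s) <= L * (t - s)) ->
  continuous gamma.
Proof.
move=> L0 hL x; apply/cvgrPdist_lt => e e0.
have hn (v : vec) : `|v| <= eucl_norm v.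
  have -> : `|v| = mx_norm v by [].
  rewrite mx_normrE; apply: bigmax_le => [|[i j] _ /=].
    exact: eucl_norm_ge0.
  by rewrite ord1 coord_eucl.
have hs t : eucl_norm (gamma x - gamma t) <= L * `|x - t|.
  have [xt|tx] := lerP x t; last first.
    by rewrite hL // ltW.
  by rewrite -eucl_normN opprB hL.
have d0 : 0 < e / (L + 1) by rewrite divr_gt0 // ltr_wpDl.
near=> t.
have xt : `|x - t| < e / (L + 1).
  by near: t; apply/nbhs_ballP; exists (e / (L + 1)).
rewrite (le_lt_trans (hn _)) // (le_lt_trans (hs t)) //.
rewrite (@le_lt_trans _ _ (L * (e / (L + 1)))) ?ler_wpM2l ?(ltW xt) //.
rewrite mulrA ltr_pdivrMr ?ltr_wpDl // mulrC ltr_pM2l //.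
by rewrite ltrDl.
Unshelve. all: by end_near. Qed.

(** The clocks min (2 t) 1 and max (2 t - 1) 0 run one after the other: first the
   segment in direction v, on [0, 1/2], then gamma. *)
Definition path_cons (v : vec) gamma (t : R) :=
  Num.min (2 * t) 1 *: v + gamma (Num.max (2 * t - 1) 0).

Definition dev_cons (v : vec) S (t : R) : TN :=
  texp (Num.min (2 * t) 1 *: tv v) * S (Num.max (2 * t - 1) 0).

Lemma development_cons v gamma S L B : eucl_norm v <= L ->
  development gamma S L ->
  development (path_cons v gamma) (dev_cons v S) (4 * (2 * L)).
Proof.
move=> vL dev; have [D D0 [hD1 _]] := development_lipschitz dev.
move: dev => [L0 S0 GS hL [C C0 hC]].
have clock (s t : R) : s <= t ->
    [/\ Num.min (2 * s) 1 <= Num.min (2 * t) 1,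
        Num.max (2 * s - 1) 0 <= Num.max (2 * t - 1) 0,
        (Num.min (2 * t) 1 - Num.min (2 * s) 1) +
        (Num.max (2 * t - 1) 0 - Num.max (2 * s - 1) 0) = 2 * (t - s) &
        Num.max (2 * s - 1) 0 = 0 \/ Num.min (2 * s) 1 = Num.min (2 * t) 1].
  move=> st; rewrite /Num.min /Num.max.
  by do 4 case: ltP => ?; split; try lra; (try by left); right; lra.
split; first by rewrite !mulr_ge0.
- rewrite /dev_cons mulr0 sub0r (_ : Num.min 0 1 = 0 :> R) ?min_l //.
  by rewrite (_ : Num.max (-1) 0 = 0 :> R) ?max_r ?lerN10 // scale0r texp0 mul1r.
- move=> t; apply: groupM => //; apply: group_texp; apply: lieZ.
  by apply: (@lie_layerW R d N 0); exists v.
- move=> s t st; have [h1 h2 h3 _] := clock s t st.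
  move: h1 h2 h3; rewrite /path_cons; set a := Num.min (2 * s) 1.
  set a' := Num.min _ 1; set b := Num.max (2 * s - 1) 0; set b' := Num.max _ 0.
  move=> h1 h2 h3; rewrite opprD addrACA -scalerBl.
  rewrite (le_trans (eucl_normD2 _ _)) // eucl_normZ ger0_norm ?subr_ge0 //.
  have := hL _ _ h2; have := eucl_norm_ge0 v.
  move: (eucl_norm (gamma b' - gamma b)) => q v0 hq.
  have : (a' - a) * eucl_norm v <= (a' - a) * L by rewrite ler_wpM2l ?subr_ge0.
  have -> : t - s = ((a' - a) + (b' - b)) / 2 by rewrite h3; lra.
  by move: ((a' - a) * eucl_norm v) => r hr; nra.
have hv := vec_hdeg (N := N) v; set x := tv v in hv.
have [M [M0 hM]] : exists M, 0 <= M /\ tnorm x <= M.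
  by exists (tnorm x); rewrite tnorm_ge0.
have hx (c : R) : 0 <= c <= 1 -> tnorm (c *: x) <= M.
  move=> /andP[c0 c1]; rewrite tnormZ ger0_norm // (le_trans _ hM) //.
  by rewrite ler_piMl ?tnorm_ge0.
have [E E0 hE] := locLip_bounded M (@locLip_texp R d N).
have [F F0 hF] := @texp_taylor2 R d N M.
have [H H0 hH] := @locLip_texp R d N M.
pose K := N.+1%:R * L; have K0 : 0 <= K by rewrite mulr_ge0.
exists (4 * (E * C + H * M * (D * K) + E * (F * M ^+ 2) * D)).
  by rewrite mulr_ge0 // !addr_ge0 ?mulr_ge0 ?exprn_ge0.
move=> s t s0 st t1; have [h1 h2 h3 h4] := clock s t st.
have [a0 b0 a1 b1] : [/\ 0 <= Num.min (2 * s) 1, 0 <= Num.max (2 * s - 1) 0,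
    Num.min (2 * t) 1 <= 1 & Num.max (2 * t - 1) 0 <= 1].
  by split; rewrite ?le_min ?le_max ?ge_min ?ge_max ?lexx ?orbT //; lra.
move: h1 h2 h3 h4 a0 b0 a1 b1; rewrite /path_cons /dev_cons -/x.
set a := Num.min (2 * s) 1; set a' := Num.min _ 1.
set b := Num.max (2 * s - 1) 0; set b' := Num.max _ 0.
move=> h1 h2 h3 h4 a0 b0 a1 b1.
set y := gamma b' - gamma b; set z := (a' - a) *: x.
have ez : tv (a' *: v + gamma b' - (a *: v + gamma b)) = z + tv y.
  by rewrite opprD addrACA -scalerBl tensor_of_vecD tensor_of_vecZ.
have aa : 0 <= a' - a by rewrite subr_ge0.
have bb : 0 <= b' - b by rewrite subr_ge0.
have eU : texp (a' *: x) = texp (a *: x) * texp z.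
  by rewrite -texpS // addrC subrK.
set U := texp (a *: x) in eU *; set U' := texp (a' *: x) in eU *.
have comm : U * z * S b = U * S b * z.
  by case: h4 => [->|e]; rewrite ?S0 ?mulr1 // /z e subrr scale0r !mulr0 mul0r.
rewrite ez.
have -> : U' * S b' - U * S b - U * S b * (z + tv y) =
    U' * (S b' - S b - S b * tv y) + (U' - U) * (S b * tv y) +
    U * (texp z - (1 + z)) * S b.
  rewrite [U * S b * (z + _)]mulrDr -comm eU.
  rewrite !(mulrBr, mulrBl, mulrDr, mulrDl, mulr1, mulrA).
  by tlin.
have a'1 : 0 <= a' <= 1 by rewrite a1 (le_trans a0).
have a1' : 0 <= a <= 1 by rewrite a0 (le_trans h1).
have ey : tnorm (tv y) <= K * (b' - b).
  by rewrite (le_trans (tnorm_vec _)) // /K -mulrA ler_wpM2l // hL.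
have ezn : tnorm z <= M * (a' - a).
  by rewrite /z tnormZ ger0_norm // mulrC ler_wpM2r.
have zM : tnorm z <= M by apply: hx; rewrite aa lerBlDr (le_trans a1) // lerDl.
have Sb : tnorm (S b) <= D by apply: hD1 => //; apply: le_trans b1.
have t1' : tnorm (U' * (S b' - S b - S b * tv y)) <= E * (C * (b' - b) ^+ 2).
  by rewrite (le_trans (tnormM _ _)) // ler_pM ?tnorm_ge0 ?hC // hE // hx.
have t2' : tnorm ((U' - U) * (S b * tv y)) <=
    H * (M * (a' - a)) * (D * (K * (b' - b))).
  rewrite (le_trans (tnormM _ _)) // ler_pM ?tnorm_ge0 //.
    rewrite (le_trans (hH _ _ _ _)) ?hx // ler_wpM2l //.
    by rewrite -scalerBl -/z.
  by rewrite (le_trans (tnormM _ _)) // ler_pM ?tnorm_ge0.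
have t3' : tnorm (U * (texp z - (1 + z)) * S b) <=
    E * (F * (M * (a' - a)) ^+ 2) * D.
  rewrite (le_trans (tnormM _ _)) // ler_pM ?tnorm_ge0 //.
  rewrite (le_trans (tnormM _ _)) // ler_pM ?tnorm_ge0 ?hE ?hx //.
  rewrite (le_trans (hF _ _ zM)) ?ler_wpM2l // ?lerXn2r ?nnegrE ?tnorm_ge0 ?mulr_ge0 //.
  exact: hdegZ.
rewrite (le_trans (tnormD _ _)) //; apply: le_trans (lerD (tnormD _ _) t3') _.
apply: le_trans (lerD (lerD t1' t2') (lexx _)) _.
have -> : t - s = ((a' - a) + (b' - b)) / 2 by rewrite h3; lra.
move: (a' - a) (b' - b) aa bb => p q p0 q0.
have c1 : 0 <= E * C by rewrite mulr_ge0.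
have c2 : 0 <= H * M * (D * K) by rewrite !mulr_ge0.
have c3 : 0 <= E * (F * M ^+ 2) * D by rewrite !mulr_ge0 ?exprn_ge0.
have q1 : q ^+ 2 <= (p + q) ^+ 2 by nra.
have q2 : p * q <= (p + q) ^+ 2 by nra.
have q3 : p ^+ 2 <= (p + q) ^+ 2 by nra.
have := ler_wpM2l c1 q1; have := ler_wpM2l c2 q2; have := ler_wpM2l c3 q3.
set X := E * C in c1 *; set Y := H * M * (D * K) in c2 *.
set Z := E * (F * M ^+ 2) * D in c3 *.
have -> : E * (C * q ^+ 2) = X * q ^+ 2 by rewrite /X; ring.
have -> : H * (M * p) * (D * (K * q)) = Y * (p * q) by rewrite /Y; ring.
have -> : E * (F * (M * p) ^+ 2) * D = Z * p ^+ 2 by rewrite /Z; ring.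
have -> : 4 * (X + Y + Z) * ((p + q) / 2) ^+ 2 = X * (p + q) ^+ 2 +
  Y * (p + q) ^+ 2 + Z * (p + q) ^+ 2 by field.
move: (X * _) (X * _) (Y * _) (Y * _) (Z * _) (Z * _) => *; lra.
Qed.

Lemma vprod_development (s : seq vec) C : 0 <= C ->
  (forall v, v \in s -> eucl_norm v <= C) ->
  exists gamma S, development gamma S (8 ^+ size s * C) /\ S 1 = vprod s.
Proof.
move=> C0; elim: s => [|v s IH] hs.
  exists (fun=> 0), (fun=> 1); split=> //; rewrite mul1r; split=> //.
  - by move=> _; exact: group1.
  - move=> s t st; rewrite subrr /eucl_norm big1 => [|i _]; last by rewrite mxE expr0n.
    by rewrite sqrtr0 mulr_ge0 // subr_ge0.
  - exists 0 => // s t _ _ _; rewrite !subrr -(scale0r (0 : vec)) tensor_of_vecZ.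
    by rewrite scale0r mulr0 subr0 tnorm0 mul0r.
have [|gamma [S [dev S1]]] := IH.
  by move=> u us; apply: hs; rewrite inE us orbT.
exists (path_cons v gamma), (dev_cons v S); split.
  have -> : 8 ^+ size (v :: s) * C = 4 * (2 * (8 ^+ size s * C)) :> R.
    by rewrite /= exprS; ring.
  apply: development_cons => //; rewrite (le_trans (hs v (mem_head _ _))) //.
  by rewrite ler_peMl // exprn_ege1 // ler1n.
rewrite /dev_cons mulr1 (_ : Num.min 2 1 = 1 :> R) ?scale1r; last first.
  by rewrite min_r // ler1n.
rewrite (_ : Num.max (2 - 1) 0 = 1 :> R) ?S1 // max_l; lra.
Qed.

Lemma development_cc gamma S L : development gamma S L ->
  bv_path gamma /\ fine (path_length 0 1 gamma) <= L.
Proof.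
move=> [L0 _ _ hL _].
have pl : (path_length 0 1 gamma <= L%:E)%E.
  apply: ub_ereal_sup => _ [s hs <-]; rewrite lee_fin.
  rewrite (@le_trans _ _ (\sum_(0 <= k < size s)
    L * (part_pt 0 s k.+1 - part_pt 0 s k))) //.
    rewrite !big_nat; apply: ler_sum => k /= ks; apply: hL.
    exact/ltW/(part_pt_lt hs).
  by rewrite -mulr_sumr (sum_part_pt id hs) /= subr0 mulr1.
have fin : (path_length 0 1 gamma < +oo)%E by rewrite (le_lt_trans pl) ?ltry.
split; first by split=> //; apply: continuous_subspaceT; exact: lipschitz_continuous hL.
by rewrite -lee_fin fineK // ge0_fin_numE // path_length_ge0.
Qed.

(** A product of boundedly many exponentials of vectors of size nu g is the
   signature of a path made of as many segments. *)
Lemma cc_norm_le_nu : exists2 C, 0 <= C &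
  forall g : TN, G g -> cc_norm g <= C * nu g.
Proof.
have [n [C C0 hC]] := @nu_generated R d N.
exists (8 ^+ n * C) => [|g Gg]; first by rewrite mulr_ge0 // exprn_ge0.
have lb : has_lbound [set fine (path_length 0 1 gamma) | gamma in
    [set gamma : R -> vec | bv_path gamma /\ signature N gamma = g]].
  by exists 0 => _ [gamma _ <-]; rewrite fine_ge0 ?path_length_ge0.
apply/ler_addgt0Pl => e e0.
pose l := nu g + e / (8 ^+ n * C + 1).
have c1 : 0 <= 8 ^+ n * C by rewrite mulr_ge0 // exprn_ge0.
have l0 : 0 < l by rewrite ltr_wpDl ?nu_ge0 // divr_gt0 // ltr_wpDl.
have gl : nu g <= l by rewrite lerDl divr_ge0 ?(ltW e0) ?addr_ge0.
have [s [sn sC es]] := hC g l Gg l0 gl.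
have [|gamma [S [dev S1]]] := @vprod_development s (C * l) _ sC.
  by rewrite mulr_ge0 // ltW.
have [bv pl] := development_cc dev.
rewrite (@le_trans _ _ (8 ^+ size s * (C * l))) //.
  apply: le_trans pl; apply: inf_lbound => //; exists gamma => //; split=> //.
  by rewrite (development_signature dev) S1.
rewrite (@le_trans _ _ (8 ^+ n * (C * l))) //.
  by rewrite ler_wpM2r ?mulr_ge0 ?(ltW l0) // ler_weXn2l // ler1n.
rewrite mulrA /l mulrDr addrC lerD //.
by rewrite mulrA ler_pdivrMr ?ltr_wpDl // mulrC ler_wpM2l ?(ltW e0) // lerDl.
Qed.

(** The iterated integral over a word w is at most the length to the power |w|. *)
Lemma nu_le_cc_norm : exists2 C, 0 < C &
  forall g : TN, G g -> nu g <= C * cc_norm g.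
Proof.
have [C C1 hC] := @signature_nu R d N; have C0 : 0 < C by apply: lt_le_trans C1.
exists C => // g Gg; rewrite -ler_pdivrMl //; apply: lb_le_inf.
  have [n [D D0 hD]] := @nu_generated R d N.
  have [||s [_ sD es]] := hD g (nu g + 1) Gg.
  - by rewrite ltr_wpDl ?nu_ge0.
  - by rewrite lerDl.
  have [|gamma [S [dev S1]]] := @vprod_development s (D * (nu g + 1)) _ sD.
    by rewrite mulr_ge0 // addr_ge0 ?nu_ge0.
  exists (fine (path_length 0 1 gamma)); exists gamma => //; split.
    exact: (development_cc dev).1.
  by rewrite (development_signature dev) S1.
move=> _ [gamma [bv es] <-]; rewrite ler_pdivrMl // -es; apply: hC => //.
by rewrite es.
Qed.

End CarnotCaratheodory.

(** * Closed normal subgroups near the identity *)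

Section ClosedSubgroup.
Context {R : realType} {d N : nat}.
Local Notation TN := (tensor R d N).
Local Notation lie := (@free_nilpotent_lie R d N).
Local Notation G := (@free_nilpotent_group R d N).
Implicit Types (a b g h u v x y z : TN) (B C e r s t : R) (K : set TN).

(** Closedness with respect to the distance d_cc, restated for the norm. *)
Record normal_closed K : Prop := NormalClosed {
  nc_sub : K `<=` G;
  nc_1 : K 1;
  nc_M : forall g h, K g -> K h -> K (g * h);
  nc_V : forall g, K g -> K g^-1;
  nc_J : forall g k, G g -> K k -> K (g * k * g^-1);
  nc_closed : forall g, G g ->
    (forall e, 0 < e -> exists2 k, K k & tnorm (g - k) < e) -> K g }.

Lemma nu_small s : 0 < s -> exists2 del : R, 0 < del &
  forall h, G h -> tnorm (h - 1) < del -> nu h <= s.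
Proof.
move=> s0; have [C C0 hC] := @locLip_tlog R d N (tnorm (1 : TN) + 1).
pose m := Num.min s 1.
have m0 : 0 < m by rewrite lt_min s0 ltr01.
have m1 : m <= 1 by rewrite ge_min lexx orbT.
exists (Num.min 1 (m ^+ N / (C + 1))).
  by rewrite lt_min ltr01 divr_gt0 ?exprn_gt0 // ltr_wpDl.
move=> h Gh; rewrite lt_min => /andP[h1 h2].
apply: (@le_trans _ _ m); last by rewrite ge_min lexx.
apply: hnorm_tnorm; first by rewrite (ltW m0).
rewrite -[tlog h]subr0 -tlog1 (le_trans (hC _ _ _ _)) ?lerDl //.
  have -> : h = 1 + (h - 1) by rewrite addrC subrK.
  by rewrite (le_trans (tnormD _ _)) // lerD2l ltW.
rewrite (@le_trans _ _ (C * (m ^+ N / (C + 1)))) ?ler_wpM2l ?(ltW h2) //.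
rewrite mulrA ler_pdivrMr ?ltr_wpDl // mulrC ler_wpM2l ?exprn_ge0 ?(ltW m0) //.
by rewrite lerDl.
Qed.

Lemma closed_normal_subgroupW K : closed_normal_subgroup K -> normal_closed K.
Proof.
move=> [KG [K1 KM] KV KJ Kcl]; split=> // g Gg hg; apply: Kcl => // e e0.
have [C C0 hC] := @cc_norm_le_nu R d N.
have [|del del0 hdel] := @nu_small (e / (C + 1)).
  by rewrite divr_gt0 // ltr_wpDl.
have g0 : 0 < tnorm g^-1 + 1 by rewrite ltr_wpDl // tnorm_ge0.
have [|k Kk gk] := hg (del / (tnorm g^-1 + 1)); first by rewrite divr_gt0.
exists k => //; rewrite /cc_dist.
have Ggk : G (g^-1 * k) by apply: groupM; [exact: groupV|exact: KG].
rewrite (le_lt_trans (hC _ Ggk)) //.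
have h1 : tnorm (g^-1 * k - 1) < del.
  have -> : g^-1 * k - 1 = g^-1 * (k - g) by rewrite mulrBr mulVr ?group_unit.
  rewrite (le_lt_trans (tnormM _ _)) // [tnorm (k - g)]tnormC.
  rewrite (@le_lt_trans _ _ ((tnorm g^-1 + 1) * tnorm (g - k))) //.
    by rewrite ler_wpM2r ?tnorm_ge0 // lerDl.
  by rewrite -ltr_pdivlMl // mulrC.
rewrite (@le_lt_trans _ _ (C * (e / (C + 1)))) ?ler_wpM2l ?hdel //.
rewrite mulrA ltr_pdivrMr ?ltr_wpDl // mulrC ltr_pM2l //.
by rewrite ltrDl.
Qed.

Lemma trotter x y e : hdeg 1 x -> hdeg 1 y -> 0 < e ->
  exists2 n, (0 < n)%N &
    tnorm (texp (x + y) -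
      (texp (n%:R^-1 *: x) * texp (n%:R^-1 *: y)) ^+ n) < e.
Proof.
move=> hx hy e0.
pose B := Num.max (tnorm x) (tnorm y).
have B0 : 0 <= B by rewrite le_max tnorm_ge0.
have [C C0 hC] := @tlog_texpM R d N B B0.
pose M := C * (tnorm x + tnorm y) ^+ 2.
have M0 : 0 <= M by rewrite mulr_ge0 // sqr_ge0.
have [L L0 hL] := @locLip_texp R d N (tnorm (x + y) + M).
pose n := (Num.truncn (L * M / e)).+1.
have n0 : 0 < n%:R :> R by rewrite ltr0n.
have n1 : 1 <= n%:R :> R by rewrite ler1n.
exists n => //.
have hs (w : TN) : tnorm (n%:R^-1 *: w) = n%:R^-1 * tnorm w.
  by rewrite tnormZ ger0_norm // invr_ge0 ltW.
have hle (w : TN) : tnorm w <= B -> tnorm (n%:R^-1 *: w) <= B.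
  move=> wB; rewrite hs (le_trans _ wB) // ler_piMl ?tnorm_ge0 //.
  by rewrite invf_le1.
have hnx := hdegZ n%:R^-1 hx; have hny := hdegZ n%:R^-1 hy.
have h := hC _ _ hnx hny (hle x (ltac:(by rewrite le_max lexx)))
  (hle y (ltac:(by rewrite le_max lexx orbT))).
set g := texp _ * texp _ in h *.
have g1 : tcoef g [::] = 1 by rewrite tcoefM0 !texp_coef0 ?mulr1.
have eg : g ^+ n = texp (n%:R *: tlog g) by rewrite -{1}(tlogK g1) texpX //; exact: tlog_hdeg.
have hd : tnorm ((x + y) - n%:R *: tlog g) <= M / n%:R.
  have -> : x + y = n%:R *: (n%:R^-1 *: x + n%:R^-1 *: y).
    by rewrite -scalerDr tscaleA mulfV ?gt_eqF // scale1r.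
  rewrite -scalerBr tnormZ ger0_norm ?(ltW n0) // tnormC.
  rewrite (le_trans (ler_wpM2l (ltW n0) h)) // !hs -mulrDr exprMn /M.
  by rewrite le_eqVlt; apply/orP; left; apply/eqP; field; rewrite gt_eqF.
have hdM : tnorm ((x + y) - n%:R *: tlog g) <= M.
  by rewrite (le_trans hd) // ler_pdivrMr // ler_peMr.
rewrite eg (le_lt_trans (hL _ _ _ _)) ?lerDl //.
  have -> : n%:R *: tlog g = (x + y) - ((x + y) - n%:R *: tlog g).
    by rewrite opprB addrC subrK.
  by rewrite (le_trans (tnormB _ _)) // lerD2l.
rewrite (le_lt_trans (ler_wpM2l L0 hd)) // mulrA ltr_pdivrMr //.
by rewrite -ltr_pdivrMl // mulrC; exact: truncnS_gt.
Qed.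

Lemma tensor_cluster (u : nat -> TN) B : (forall n, tnorm (u n) <= B) ->
  exists v, forall e m, 0 < e -> exists2 n, (m <= n)%N & tnorm (u n - v) < e.
Proof.
move=> uB.
pose A : set 'rV[R]_(#|{: N.-bseq 'I_d}|) := 
  [set v : 'rV[R]_(#|{: N.-bseq 'I_d}|) | forall i, `[- B, B]%classic (v ord0 i)].
have cA : compact A 
  by apply: (@rV_compact _ _ (fun=> `[- B, B]%classic)) => i; exact: segment_compact.
pose F := (fun n => coords (u n)) @ \oo.
have FA : F A.
  exists 0%N => // n _ i; rewrite /= in_itv /= -ler_norml mxE.
  by rewrite -tcoefE (le_trans (tcoef_le_tnorm _ _)).
have [r [_ cr]] := cA F _ FA.
exists [ffun w => r ord0 (enum_rank w)] => e m e0.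
have e1 : 0 < e / N.+1%:R / 2 by rewrite !divr_gt0 // ltr0n.
have F1 : F ((fun n => coords (u n)) @` [set n | (m <= n)%N]).
  by exists m => // n mn; exists n.
have [_ [[n mn <-] [_ hb]]] := cr _ _ F1 (nbhsx_ballx r _ e1).
exists n => //; rewrite (@le_lt_trans _ _ (N.+1%:R * (e / N.+1%:R / 2))) //.
  apply: tnorm_le => [|w sw]; first exact: ltW.
  rewrite tcoefB.
  have := hb ord0 (enum_rank (Bseq sw)); rewrite /ball /= mxE enum_rankK => h.
  rewrite -tcoefE /= in h; rewrite distrC (_ : tcoef [ffun _ => _] w =
    r ord0 (enum_rank (Bseq sw))) ?ltW //.
  by have := tcoefE [ffun w => r ord0 (enum_rank w)] (Bseq sw); rewrite ffunE.
have -> : N.+1%:R * (e / N.+1%:R / 2) = e / 2.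
  by rewrite mulrA mulrCA mulfV ?mulr1 // pnatr_eq0.
by rewrite ltr_pdivrMr // ltr_pMr // ltr1n.
Qed.

Section Near.
Context (K : set TN) (hK : normal_closed K).

Definition logset x := lie x /\ K (texp x).

(** The Lie algebra of K: the generators of the one-parameter subgroups in K. *)
Definition tangent x := forall t, logset (t *: x).

Lemma logset_closed x :
  (forall e, 0 < e -> exists2 y, logset y & tnorm (x - y) < e) -> logset x.
Proof.
move=> hx; have lx : lie x.
  by apply: lie_closed => e e0; have [y [ly _] xy] := hx e e0; exists y.
split=> //; apply: (nc_closed hK); first exact: group_texp.
move=> e e0; have [C C0 hC] := @locLip_texp R d N (tnorm x + 1).
have [|y [ly Ky]] := hx (Num.min 1 (e / (C + 1))).
  by rewrite lt_min ltr01 divr_gt0 // ltr_wpDl.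
rewrite lt_min => /andP[h1 h2]; exists (texp y) => //.
have yB : tnorm y <= tnorm x + 1.
  have -> : y = x - (x - y) by rewrite opprB addrC subrK.
  by rewrite (le_trans (tnormB _ _)) // lerD2l ltW.
rewrite (le_lt_trans (hC _ _ _ yB)) ?lerDl //.
rewrite (@le_lt_trans _ _ (C * (e / (C + 1)))) ?ler_wpM2l ?(ltW h2) //.
rewrite mulrA ltr_pdivrMr ?ltr_wpDl // mulrC ltr_pM2l //.
by rewrite ltrDl.
Qed.

Lemma logset_natmul n x : logset x -> logset (n%:R *: x).
Proof.
move=> [lx Kx]; split; first exact: lieZ.
rewrite -texpX; last exact: lie_hdeg.
elim: n => [|n IH]; first by rewrite expr0; exact: nc_1.
by rewrite exprS; exact: nc_M.
Qed.

Lemma logsetN x : logset x -> logset (- x).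
Proof.
move=> [lx Kx]; split; first exact: lieN.
by rewrite -texpV; [exact: nc_V|exact: lie_hdeg].
Qed.

Lemma tangentZ t x : tangent x -> tangent (t *: x).
Proof. by move=> hx s; rewrite tscaleA; exact: hx. Qed.

Lemma tangentW x : tangent x -> logset x.
Proof. by move=> /(_ 1); rewrite scale1r. Qed.

Lemma tangentN x : tangent x -> tangent (- x).
Proof. by rewrite -scaleN1r; exact: tangentZ. Qed.

Lemma tangent0 : tangent 0.
Proof.
move=> t; rewrite scaler0; split; first exact: lie0.
by rewrite texp0; exact: nc_1.
Qed.

(** A factor v is moved to the left through the powers of u at the cost of a
   conjugation. *)
Lemma normal_powM u v n : G u -> K v -> K ((u * v) ^+ n * (u ^+ n)^-1).
Proof.
move=> Gu Kv.
have Gun m : G (u ^+ m).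
  by elim: m => [|m IH]; rewrite ?expr0 ?exprS; [exact: group1|exact: groupM].
elim: n => [|n IH]; first by rewrite !expr0 invr1 mulr1; exact: nc_1.
have Uu := group_unit Gu; have Un := group_unit (Gun n).
have -> : (u * v) ^+ n.+1 * (u ^+ n.+1)^-1 =
    ((u * v) ^+ n * (u ^+ n)^-1) * (u ^+ n * (u * v * u^-1) * (u ^+ n)^-1).
  by rewrite !exprSr invrM // !mulrA mulrVK // .
apply: (nc_M hK) => //; apply: (nc_J hK) => //; exact: (nc_J hK).
Qed.

(** texp (x + a) is the limit of (u v) ^ n with u = texp (x / n) and v = texp (a / n).
   By normality (u v) ^ n agrees modulo K with u ^ n = texp x, although u itself may
   lie outside K; only a needs all its multiples in the logarithm of K. *)
Lemma logsetD x a : logset x -> tangent a -> logset (x + a).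
Proof.
move=> [lx Kx] ta; have [la _] := tangentW ta.
have lxa : lie (x + a) by exact: lieD.
split=> //; apply: (nc_closed hK); first exact: group_texp.
move=> e e0; have [n n0 hn] := trotter (lie_hdeg lx) (lie_hdeg la) e0.
exists ((texp (n%:R^-1 *: x) * texp (n%:R^-1 *: a)) ^+ n) => //.
set u := texp _; set v := texp _.
have Gu : G u by apply/group_texp/lieZ.
have [_ Kv] := ta n%:R^-1.
have eu : u ^+ n = texp x.
  rewrite texpX; last by apply: hdegZ; exact: lie_hdeg.
  by rewrite tscaleA mulfV ?scale1r // pnatr_eq0 -lt0n.
have -> : (u * v) ^+ n = ((u * v) ^+ n * (u ^+ n)^-1) * texp x.
  by rewrite -eu mulrVK // eu group_unit //; exact: group_texp.
by apply: (nc_M hK) => //; exact: normal_powM.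
Qed.

Lemma tangentD a b : tangent a -> tangent b -> tangent (a + b).
Proof.
by move=> ta tb t; rewrite scalerDr; apply: logsetD => //; exact: tangentZ.
Qed.

Lemma tangent_closed x :
  (forall e, 0 < e -> exists2 y, tangent y & tnorm (x - y) < e) -> tangent x.
Proof.
move=> hx t; apply: logset_closed => e e0.
have [|y ty xy] := hx (e / (`|t| + 1)); first by rewrite divr_gt0 // ltr_wpDl.
exists (t *: y); first exact: ty.
rewrite -scalerBr tnormZ (@le_lt_trans _ _ (`|t| * (e / (`|t| + 1)))) //.
  by rewrite ler_wpM2l // ltW.
rewrite mulrA ltr_pdivrMr ?ltr_wpDl // mulrC ltr_pM2l //.
by rewrite ltrDl.
Qed.

(** A logarithm outside the tangent space can be corrected by a tangent vector
   so as to become almost orthogonal to the tangent space. *)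
Lemma logset_orth x : logset x -> ~ tangent x -> exists b,
  [/\ logset b, 0 < tnorm b, tnorm b < 2 * tnorm x &
      forall a, tangent a -> tnorm b < 2 * tnorm (b - a)].
Proof.
move=> Lx ntx; pose D := [set tnorm (x - a) | a in tangent].
have D0 : D !=set0 by exists (tnorm (x - 0)); exists 0 => //; exact: tangent0.
have Dlb : has_lbound D by exists 0 => _ [a _ <-]; exact: tnorm_ge0.
have iD : has_inf D by [].
have inf0 : 0 < inf D.
  rewrite ltNge; apply/negP => i0; apply: ntx; apply: tangent_closed => e e0.
  have [_ [a ta <-] h] := inf_adherent e0 iD.
  by exists a => //; rewrite (lt_le_trans h) // gerDr.
have [_ [a ta <-] ha] := inf_adherent inf0 iD.
have infle a' : tangent a' -> inf D <= tnorm (x - a').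
  by move=> ta'; apply: inf_lbound => //; exists a'.
exists (x - a); split.
- by apply: logsetD => //; exact: tangentN.
- exact: lt_le_trans (infle a ta).
- rewrite (lt_le_trans ha) // mulr2n mulrDl mul1r.
  by have := infle _ tangent0; rewrite subr0 => h; rewrite lerD.
- move=> a' ta'; rewrite (lt_le_trans ha) // mulr2n mulrDl mul1r.
  have := infle _ (tangentD ta ta'); rewrite opprD addrA => h.
  by rewrite lerD.
Qed.

(** Cartan's argument: near the identity, K is the exponential of its tangent
   space. Otherwise the directions of small elements of K almost orthogonal to
   the tangent space would accumulate at a tangent direction. *)
Lemma small_logset_tangent :
  exists2 r, 0 < r & forall x, logset x -> tnorm x < r -> tangent x.
Proof.
apply: contrapT => hn.
have hseq m : exists b, [/\ logset b, 0 < tnorm b, tnorm b < 2 * m.+1%:R^-1 &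
    forall a, tangent a -> tnorm b < 2 * tnorm (b - a)].
  apply: contrapT => hm; apply: hn; exists (m.+1%:R^-1).
    by rewrite invr_gt0 ltr0n.
  move=> x Lx xm; apply: contrapT => /(logset_orth Lx)[b [Lb b0 bx hb]].
  apply: hm; exists b; split=> //; rewrite (lt_trans bx) //.
  by rewrite ltr_pM2l.
have [b hb] := choice hseq.
pose u m := (tnorm (b m))^-1 *: b m.
have u1 m : tnorm (u m) = 1.
  have [_ b0 _ _] := hb m.
  by rewrite tnormZ ger0_norm ?invr_ge0 ?(ltW b0) // mulVf // gt_eqF.
have bu m : b m = tnorm (b m) *: u m.
  have [_ b0 _ _] := hb m.
  by rewrite /u tscaleA mulfV ?gt_eqF // scale1r.
have [v hv] := @tensor_cluster u 1 (fun m => ltac:(by rewrite u1)).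
have tpos t : 0 <= t -> logset (t *: v).
  move=> t0; apply: logset_closed => e e0.
  have e1 : 0 < e / (t + 2) by rewrite divr_gt0 // ltr_wpDl.
  pose m0 := Num.truncn (2 / (e / (t + 2))).
  have [m m0m um] := hv _ m0 e1.
  have [Lb b0 bm _] := hb m.
  have bs : tnorm (b m) < e / (t + 2).
    rewrite (lt_trans bm) // ltr_pdivrMr ?ltr0n // mulrC -ltr_pdivrMr //.
    rewrite (lt_le_trans (truncnS_gt _)) // ler_nat ltnS //.
  pose j := Num.truncn (t / tnorm (b m)).
  exists (j%:R *: b m); first exact: logset_natmul.
  have /andP[j1 j2] := truncn_itv (divr_ge0 t0 (ltW b0)).
  rewrite -/j in j1 j2; rewrite ler_pdivlMr // in j1.
  rewrite ltr_pdivrMr // -natr1 mulrDl mul1r in j2.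
  have -> : t *: v - j%:R *: b m =
      - (t *: (u m - v)) + (t - j%:R * tnorm (b m)) *: u m.
    have -> : j%:R *: b m = (j%:R * tnorm (b m)) *: u m by rewrite {1}(bu m) tscaleA.
    by move: (u m) (_ * _) => q c; tlin.
  rewrite (le_lt_trans (tnormD _ _)) // tnormN (tnormZ t) (tnormZ (t - _)) u1 mulr1.
  rewrite !ger0_norm // ?subr_ge0 //.
  have h1 : t - j%:R * tnorm (b m) <= e / (t + 2) by lra.
  have h2 : t * tnorm (u m - v) <= t * (e / (t + 2)) by rewrite ler_wpM2l // ltW.
  rewrite (le_lt_trans (lerD h2 h1)) //.
  have : e / (t + 2) * (t + 2) = e by rewrite divfK // gt_eqF // ltr_wpDl.
  by move: (e / (t + 2)) e1 => q q0; rewrite mulrDr; nra.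
have tv : tangent v.
  move=> t; have [t0|t0] := lerP 0 t; first exact: tpos.
  rewrite -[t *: v]opprK -scaleNr; apply: logsetN; apply: tpos.
  by rewrite oppr_ge0 ltW.
have [|m _ um] := hv 2^-1 0%N; first by rewrite invr_gt0.
have [_ b0 _ /(_ _ (tangentZ (tnorm (b m)) tv))] := hb m.
rewrite {2}(bu m) -scalerBr tnormZ ger0_norm ?(ltW b0) // mulrCA.
rewrite -{1}[tnorm (b m)]mulr1 ltr_pM2l // => h.
by move: um h; lra.
Qed.

End Near.

End ClosedSubgroup.

(** * Quotient distance and midpoints *)

Section Quotient.
Context {R : realType} {d N : nat}.
Local Notation TN := (tensor R d N).
Local Notation lie := (@free_nilpotent_lie R d N).
Local Notation G := (@free_nilpotent_group R d N).
Context (K : set TN) (hcK : closed_normal_subgroup K).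
Implicit Types (a b g h u v x y z : TN) (A B : set TN) (e r s t : R).

Let hK : normal_closed K := closed_normal_subgroupW hcK.

Lemma coset_refl g : quot_proj K g g.
Proof. by exists 1; [exact: nc_1|rewrite mulr1]. Qed.

Lemma cosetP g h : G g -> quot_proj K g h <-> K (g^-1 * h).
Proof.
move=> Gg; split=> [[k Kk <-]|Kgh]; first by rewrite mulKr ?group_unit.
by exists (g^-1 * h) => //; rewrite mulVKr ?group_unit.
Qed.

Lemma coset_group g h : G g -> quot_proj K g h -> G h.
Proof. by move=> Gg [k Kk <-]; apply: groupM => //; exact: (nc_sub hK). Qed.

Lemma coset_eq g h : G g -> quot_proj K g h -> quot_proj K h = quot_proj K g.
Proof.
move=> Gg [k Kk <-]; apply/seteqP; split=> _ [k' Kk' <-].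
  by exists (k * k'); [exact: (nc_M hK)|rewrite mulrA].
exists (k^-1 * k'); first by apply: (nc_M hK) => //; exact: (nc_V hK).
by rewrite -mulrA mulVKr // group_unit //; exact: (nc_sub hK).
Qed.

Lemma quot_groupP A g : quot_group K A -> A g -> G g /\ A = quot_proj K g.
Proof.
move=> [h Gh <-] Ag; split; first exact: coset_group Ag.
by rewrite (coset_eq Gh).
Qed.

Lemma coset_mul_inv g h : G g -> G h ->
  coset_mul (coset_inv (quot_proj K g)) (quot_proj K h) = quot_proj K (g^-1 * h).
Proof.
move=> Gg Gh; have Ug := group_unit Gg; have Uh := group_unit Gh.
apply/seteqP; split=> [_ [_ [_ [k Kk <-] <-] [_ [k' Kk' <-] <-]]|_ [k Kk <-]].
  have Uk : k \is a GRing.unit by apply: group_unit; exact: (nc_sub hK).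
  exists (h^-1 * (g * k^-1 * g^-1) * h * k').
    have Kg : K (g * k^-1 * g^-1) by apply: (nc_J hK) => //; exact: (nc_V hK).
    apply: (nc_M hK) => //; have := nc_J hK (groupV Gh) Kg.
    by rewrite invrK.
  by rewrite invrM // !mulrA mulrK // mulVr // mul1r.
exists g^-1; first by exists g => //; exact: coset_refl.
by exists (h * k); [exists k|rewrite mulrA].
Qed.

(** The infimum defining the quotient norm is approached up to a factor 2; when it
   is 0, closedness of K shows that it is attained. *)
Lemma quot_dist_attained : exists2 C, 0 < C & forall g B, G g -> quot_group K B ->
  exists2 h, B h & nu (g^-1 * h) <= C * quot_dist (quot_proj K g) B.
Proof.
have [C C0 hC] := @nu_le_cc_norm R d N.
exists (2 * C) => [|g _ Gg [h Gh <-]]; first by rewrite mulr_gt0.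
rewrite /quot_dist coset_mul_inv // /quot_norm.
set S := [set cc_norm a | a in _].
have S0 : S !=set0 by exists (cc_norm (g^-1 * h)); exists (g^-1 * h) => //; exact: coset_refl.
have Ggh : G (g^-1 * h) by apply: groupM => //; exact: groupV.
have ccpos a : quot_proj K (g^-1 * h) a -> 0 <= cc_norm a.
  move=> ha; rewrite -(ler_pM2l C0) mulr0.
  by apply: le_trans (hC _ (coset_group Ggh ha)); exact: nu_ge0.
have Slb : has_lbound S by exists 0 => _ [a /ccpos a0 <-].
have iS : has_inf S by [].
have inf0 : 0 <= inf S by apply: lb_le_inf => // _ [a /ccpos a0 <-].
have pick e : 0 < e -> exists2 k, K k & cc_norm (g^-1 * h * k) < inf S + e.
  by move=> e0; have [_ [_ [k Kk <-] <-] lt] := inf_adherent e0 iS; exists k.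
move: inf0; rewrite le_eqVlt => /orP[/eqP i0|i0]; last first.
  have [k Kk hk] := pick _ i0.
  exists (h * k); first by exists k.
  rewrite mulrA (le_trans (hC _ _)) //.
    by apply: groupM => //; exact: (nc_sub hK).
  rewrite [2 * C]mulrC -[leRHS]mulrA ler_wpM2l ?(ltW C0) // mulr2n mulrDl mul1r.
  exact: ltW.
have Ghg : G (h^-1 * g) by apply: groupM => //; exact: groupV.
have Khg : K (h^-1 * g).
  have [_ _ _ _ Kcl] := hcK; apply: Kcl => // e e0.
  have [k Kk hk] := pick _ e0; exists k => //.
  have Ug := group_unit Gg; have Uh := group_unit Gh.
  by rewrite /cc_dist invrM ?unitrV // invrK; move: hk; rewrite -i0 add0r.
exists g; first exact/cosetP.
by rewrite mulVr ?group_unit // nu1 -i0 mulr0.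
Qed.

Lemma quot_dist_le_nu : exists2 C, 0 <= C & forall g h A B,
  quot_group K A -> quot_group K B -> A g -> B h ->
  quot_dist A B <= C * nu (g^-1 * h).
Proof.
have [C C0 hC] := @cc_norm_le_nu R d N.
have [D D0 hD] := @nu_le_cc_norm R d N.
exists C => // g h A B qA qB Ag Bh.
have [Gg ->] := quot_groupP qA Ag; have [Gh ->] := quot_groupP qB Bh.
have Ggh : G (g^-1 * h) by apply: groupM => //; exact: groupV.
rewrite (le_trans _ (hC _ Ggh)) // /quot_dist coset_mul_inv // /quot_norm.
apply: inf_lbound; last by exists (g^-1 * h) => //; exact: coset_refl.
exists 0 => _ [a ha <-]; rewrite -(ler_pM2l D0) mulr0.
by apply: le_trans (hD _ (coset_group Ggh ha)); exact: nu_ge0.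
Qed.

Lemma quot_dist_quasi : exists2 C, 0 <= C & forall A B D,
  quot_group K A -> quot_group K B -> quot_group K D ->
  [/\ 0 <= quot_dist A B, quot_dist A A = 0,
      quot_dist B A <= C * quot_dist A B &
      quot_dist A D <= C * (quot_dist A B + quot_dist B D)].
Proof.
have [C C0 hC] := quot_dist_attained; have [D D0 hD] := quot_dist_le_nu.
have [E E1 hE] := @nuM_crude R d N.
have E0 : 0 <= E by rewrite (le_trans ler01).
pose M := D * (E * C); have M0 : 0 <= M by rewrite !mulr_ge0 ?(ltW C0).
exists (M + D * C) => [|A B F qA qB qF].
  by rewrite addr_ge0 // mulr_ge0 // ltW.
have pos A' B' : quot_group K A' -> quot_group K B' -> 0 <= quot_dist A' B'.
  move=> [g Gg <-] qB'; have [h hB' nh] := hC g B' Gg qB'.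
  by rewrite -(ler_pM2l C0) mulr0 (le_trans (nu_ge0 _) nh).
have [g Gg eA] := qA.
have Ag : A g by rewrite -eA; exact: coset_refl.
have [h Bh nh] := hC g B Gg qB; rewrite eA in nh.
have [Gh eB] := quot_groupP qB Bh.
have [k Fk nk] := hC h F Gh qF; rewrite -eB in nk.
have [Gk _] := quot_groupP qF Fk.
have Ggh : G (g^-1 * h) by apply: groupM => //; exact: groupV.
have Ghk : G (h^-1 * k) by apply: groupM => //; exact: groupV.
split; first exact: pos.
- apply/eqP; rewrite eq_le pos // andbT (le_trans (hD _ _ _ _ qA qA Ag Ag)) //.
  by rewrite mulVr ?group_unit // nu1 mulr0.
- rewrite (le_trans (hD _ _ _ _ qB qA Bh Ag)) //.
  have -> : h^-1 * g = (g^-1 * h)^-1.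
    by rewrite invrM ?unitrV ?invrK //; exact: group_unit.
  rewrite nuV // (le_trans (ler_wpM2l D0 nh)) // mulrA mulrDl lerDr.
  by rewrite mulr_ge0 // pos.
- rewrite (le_trans (hD _ _ _ _ qA qF Ag Fk)) //.
  have -> : g^-1 * k = (g^-1 * h) * (h^-1 * k).
    by rewrite mulrA mulrK // group_unit.
  have s0 : 0 <= quot_dist A B + quot_dist B F by rewrite addr_ge0 ?pos.
  rewrite (@le_trans _ _ (D * (E * (C * (quot_dist A B + quot_dist B F))))) //.
    rewrite ler_wpM2l // hE //.
      by rewrite (le_trans nh) // ler_wpM2l ?(ltW C0) // lerDl pos.
    by rewrite (le_trans nk) // ler_wpM2l ?(ltW C0) // lerDr pos.
  have -> (p : R) : D * (E * (C * p)) = M * p by rewrite /M !mulrA.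
  by rewrite mulrDl lerDl mulr_ge0 // mulr_ge0 // ltW.
Qed.

(** For a small element of K, its logarithm is tangent to K, so half of it is the
   logarithm of an element of K. *)
Lemma small_halving : exists2 r, 0 < r & forall k, K k -> nu k < r ->
  K (texp (2^-1 *: tlog k)).
Proof.
have [r r0 hr] := small_logset_tangent hK.
pose l := Num.min 1 (r / N.+2%:R).
have l0 : 0 < l by rewrite lt_min ltr01 divr_gt0.
exists l => // k Kk kl; have Gk := nc_sub hK Kk.
have Lk : logset K (tlog k).
  by split; [exact: group_tlog|rewrite tlogK ?group_coef0].
have [|_] := hr _ Lk _ 2^-1 => //.
have l1 : 0 <= l <= 1 by rewrite (ltW l0) ge_min lexx.
rewrite (le_lt_trans (tnorm_hnorm (lie_hdeg (group_tlog Gk)) l1 (ltW kl))) //.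
rewrite (@lt_le_trans _ _ (N.+2%:R * l)) ?ltr_pM2r ?ltr_nat //.
by rewrite -ler_pdivlMl ?ltr0n // mulrC ge_min lexx orbT.
Qed.

Lemma halving_sqr k : G k ->
  texp (2^-1 *: tlog k) * texp (2^-1 *: tlog k) = k.
Proof.
move=> Gk; have g1 := group_coef0 Gk.
rewrite -texpS; last exact: tlog_hdeg.
have -> : 2^-1 + 2^-1 = 1 :> R by field.
by rewrite scale1r tlogK.
Qed.

(** The key step. An increment g = h h' k with h, h' small and k in K is split
   in two by halving the logarithm of k: both halves are smaller than g by a
   factor arbitrarily close to 2^(-1/N), as conjugation by k only costs an
   arbitrarily small multiple of k. *)
Lemma midpoint (lam : R) : (0 < N)%N -> 0 < lam -> lam < 1 -> 2^-1 < lam ^+ N ->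
  exists2 C, 1 <= C & exists2 r, 0 < r & forall g h h' (b : R),
    G h -> G h' -> K ((h * h')^-1 * g) -> nu h <= b -> nu h' <= b ->
    b < r -> nu g < r ->
    exists k, [/\ K k, nu (h * k) <= Num.max (lam * nu g) (C * b) &
      nu ((h * k)^-1 * g) <= Num.max (lam * nu g) (C * b)].
Proof.
move=> N0 lam0 lam1 hlam.
pose q : R := 2^-1 `^ N%:R^-1.
have q0 : 0 <= q by rewrite powR_ge0.
have qN : q ^+ N = 2^-1.
  by rewrite /q -powR_mulrn ?powR_ge0 // -powRrM mulVf ?powRr1 // pnatr_eq0 -lt0n.
have ql : q < lam.
  by rewrite -(@ltr_pXn2r _ N) ?nnegrE ?(ltW lam0) // qN.
have q1 : q <= 1 by rewrite (le_trans (ltW ql)) // ltW.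
have [e e0 he] : exists2 e, 0 < e & (1 + e) * ((1 + e) * q) <= lam.
  exists (Num.min 1 ((lam - q) / 3)).
    by rewrite lt_min ltr01 divr_gt0 // subr_gt0.
  have : Num.min 1 ((lam - q) / 3) <= 1 by rewrite ge_min lexx.
  have : Num.min 1 ((lam - q) / 3) <= (lam - q) / 3 by rewrite ge_min lexx orbT.
  have : 0 < Num.min 1 ((lam - q) / 3) by rewrite lt_min ltr01 divr_gt0 // subr_gt0.
  move: (Num.min _ _) => e e0 e2 e1; nra.
have e1 : 1 <= 1 + e by rewrite lerDl ltW.
have [C0 C01 hC0] := @nuM_crude R d N.
have [C1 C11 hC1] := @nuM_l R d N e e0.
have C1i : 0 < C1^-1 by rewrite invr_gt0 (lt_le_trans ltr01).
have [C2 C21 hC2] := @nuJ R d N C1^-1 C1i.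
have [r r0 hr] := small_halving.
have C00 : 0 <= C0 by rewrite (le_trans ler01).
have C10 : 0 <= C1 by rewrite (le_trans ler01).
have C20 : 0 <= C2 by rewrite (le_trans ler01).
have Cp : 1 <= C1 * C0 * C2 by rewrite !mulr_ege1.
exists (C1 * C0 * C2) => //.
exists (r / (C1 * C0 * C2 * (1 + e))).
  by rewrite divr_gt0 // mulr_gt0 // (lt_le_trans ltr01).
move=> g h h' b Gh Gh' Kk hb hb' br gr.
have b0 : 0 <= b by rewrite (le_trans (nu_ge0 h)).
set k := (h * h')^-1 * g in Kk; have Gk := nc_sub hK Kk.
have Ghh : G (h * h') by exact: groupM.
have eg : g = h * h' * k by rewrite /k mulVKr // group_unit.
have Gg : G g by rewrite eg; exact: groupM.
have nk : nu k <= Num.max (C1 * (C0 * b)) ((1 + e) * nu g).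
  rewrite (le_trans (hC1 _ _ (groupV Ghh) Gg)) // ge_max le_max.
  by rewrite nuV // ler_wpM2l ?hC0 //= le_max lexx orbT.
have p1 : C1 * C0 <= C1 * C0 * C2 by rewrite ler_peMr // mulr_ge0.
have kr : nu k < r.
  have P0 : 0 < C1 * C0 * C2 * (1 + e) by rewrite mulr_gt0 // (lt_le_trans ltr01).
  rewrite ltr_pdivlMr // in br; rewrite ltr_pdivlMr // in gr.
  rewrite (le_lt_trans nk) // gt_max; apply/andP; split.
    rewrite (le_lt_trans _ br) // mulrA mulrC ler_wpM2l // (le_trans p1) //.
    by rewrite ler_peMr // (le_trans ler01).
  rewrite (le_lt_trans _ gr) // mulrC ler_wpM2l ?nu_ge0 //.
  by rewrite ler_peMl // addr_ge0 // ltW.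
pose k1 := texp (2^-1 *: tlog k).
have Kk1 : K k1 by exact: hr.
have Gk1 := nc_sub hK Kk1.
have ek : k1 * k1 = k by exact: halving_sqr.
have nk1 : nu k1 <= q * nu k.
  rewrite /nu /k1 texpKlog; last by apply/hdegZ/tlog_hdeg/group_coef0.
  by apply: hnorm_half => //; rewrite qN.
have main : (1 + e) * nu k1 <= Num.max (lam * nu g) (C1 * C0 * C2 * b).
  rewrite (@le_trans _ _ ((1 + e) * (q * Num.max (C1 * (C0 * b)) ((1 + e) * nu g)))) //.
    rewrite ler_wpM2l ?addr_ge0 ?(ltW e0) // (le_trans nk1) // ler_wpM2l //.
  rewrite [leLHS]mulrA maxr_pMr ?mulr_ge0 ?addr_ge0 ?(ltW e0) // ge_max !le_max.
  apply/andP; split; apply/orP; [right|left].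
    rewrite (@le_trans _ _ (1 * (C1 * (C0 * b)))) //.
      rewrite ler_wpM2r ?mulr_ge0 //; apply: le_trans (ltW lam1).
      apply: le_trans he; rewrite ler_wpM2l ?addr_ge0 ?(ltW e0) //.
      by rewrite ler_peMl.
    by rewrite mul1r mulrA ler_wpM2r.
  have -> : (1 + e) * q * ((1 + e) * nu g) = (1 + e) * ((1 + e) * q) * nu g by ring.
  by rewrite ler_wpM2r ?nu_ge0.
exists k1; split=> //.
  rewrite (le_trans (hC1 _ _ Gh Gk1)) // ge_max main andbT le_max; apply/orP; right.
  rewrite (le_trans (ler_wpM2l C10 hb)) // ler_wpM2r //.
  by rewrite -mulrA ler_peMr // mulr_ege1.
have Gc : G (k1^-1 * h' * k1).
  by apply: groupM => //; apply: groupM => //; exact: groupV.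
have -> : (h * k1)^-1 * g = (k1^-1 * h' * k1) * k1.
  rewrite eg -ek invrM ?group_unit // !mulrA.
  by rewrite -[_ * h^-1 * h]mulrA mulVr ?group_unit // mulr1.
rewrite (le_trans (hC1 _ _ Gc Gk1)) // ge_max main andbT.
have := hC2 _ _ Gk1 Gh'; rewrite le_max => /orP[c1|c2].
  apply: le_trans main; rewrite (le_trans (ler_wpM2l C10 c1)) //.
  rewrite mulrA mulfV ?mul1r ?ler_peMl ?nu_ge0 //.
  by rewrite gt_eqF // (lt_le_trans ltr01).
rewrite le_max; apply/orP; right; rewrite (le_trans (ler_wpM2l C10 c2)) //.
rewrite (le_trans (ler_wpM2l C10 (ler_wpM2l C20 hb'))) // mulrA ler_wpM2r //.
by rewrite -mulrA ler_wpM2l // ler_peMl.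
Qed.

End Quotient.

(** * Lifting along dyadic grids *)

Section DyadicLift.
Context {R : realType} {d N : nat}.
Local Notation TN := (tensor R d N).
Local Notation G := (@free_nilpotent_group R d N).
Context (K : set TN) (hcK : closed_normal_subgroup K).
Implicit Types (g h u v x y z : TN) (A B M : set TN) (e r s t : R).

Let hK : normal_closed K := closed_normal_subgroupW hcK.

Lemma lift_midpoint (lam : R) :
  (0 < N)%N -> 0 < lam -> lam < 1 -> 2^-1 < lam ^+ N ->
  exists2 C, 1 <= C & exists2 r, 0 < r & forall g g' M,
    G g -> G g' -> quot_group K M -> nu (g^-1 * g') < r ->
    quot_dist (quot_proj K g) M < r -> quot_dist M (quot_proj K g') < r ->
    exists m, M m /\
      let V := Num.max (lam * nu (g^-1 * g'))
        (C * Num.max (quot_dist (quot_proj K g) M) (quot_dist M (quot_proj K g')))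
      in nu (g^-1 * m) <= V /\ nu (m^-1 * g') <= V.
Proof.
move=> N0 lam0 lam1 hlam.
have [C C1 [r r0 hC]] := midpoint hcK N0 lam0 lam1 hlam.
have [D D0 hD] := quot_dist_attained hcK.
have C0 : 0 < C by rewrite (lt_le_trans ltr01).
exists (C * (D + 1)); first by rewrite mulr_ege1 // lerDr ltW.
exists (Num.min r (r / D)); first by rewrite lt_min r0 divr_gt0.
move=> g g' M Gg Gg' qM; rewrite !lt_min => /andP[n1 _] /andP[_ n2] /andP[_ n3].
have [m0 Mm0 hm0] := hD g M Gg qM.
have [Gm0 eM] := quot_groupP hcK qM Mm0.
have qB : quot_group K (quot_proj K g') by exists g'.
have [t0 Bt0 ht0] := hD m0 _ Gm0 qB; rewrite -eM in ht0.
have Gt0 := coset_group hcK Gg' Bt0.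
set p := quot_dist _ M in hm0 n2 *; set q := quot_dist M _ in ht0 n3 *.
have GV := @groupV R d N; have GM := @groupM R d N.
have [|||||||k [Kk h1 h2]] := hC (g^-1 * g') (g^-1 * m0) (m0^-1 * t0)
  (D * Num.max p q) => //.
- by apply: GM => //; exact: GV.
- by apply: GM => //; exact: GV.
- have -> : (g^-1 * m0 * (m0^-1 * t0))^-1 * (g^-1 * g') = t0^-1 * g'.
    have Ug := group_unit Gg; have Um := group_unit Gm0; have Ut := group_unit Gt0.
    rewrite -mulrA (mulVKr Um) invrM ?unitrV // invrK -mulrA.
    by rewrite mulVKr // .
  have : K (g'^-1 * t0)^-1 by apply: (nc_V hK); exact: (iffLR (cosetP K t0 Gg') Bt0).
  by rewrite invrM ?unitrV ?invrK //; exact: group_unit.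
- by rewrite (le_trans hm0) // ler_wpM2l ?(ltW D0) // le_max lexx.
- by rewrite (le_trans ht0) // ler_wpM2l ?(ltW D0) // le_max lexx orbT.
- by rewrite mulrC -ltr_pdivlMr // gt_max n2.
have le V : V <= Num.max (lam * nu (g^-1 * g')) (C * (D * Num.max p q)) ->
  V <= Num.max (lam * nu (g^-1 * g')) (C * (D + 1) * Num.max p q).
  move=> hV; apply: le_trans hV _; rewrite ge_max !le_max lexx /=.
  apply/orP; right; rewrite -mulrA ler_wpM2l ?(ltW C0) // ler_wpM2r ?lerDl //.
  have [E _ /(_ (quot_proj K g) M M (ex_intro2 _ _ g Gg erefl) qM qM)[p0 _ _ _]] :=
    quot_dist_quasi hcK.
  by rewrite le_max -/p p0.
exists (m0 * k); split; first by rewrite eM; exists k.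
split; apply: le; first by rewrite (mulrA g^-1).
have -> : (m0 * k)^-1 * g' = (g^-1 * m0 * k)^-1 * (g^-1 * g'); last exact: h2.
have Ug := group_unit Gg; have Um := group_unit Gm0.
have Uk : k \is a GRing.unit by apply: group_unit; exact: (nc_sub hK).
have Umk := group_unit (groupM Gm0 (nc_sub hK Kk)).
have e : (g^-1 * (m0 * k))^-1 = (m0 * k)^-1 * g by rewrite invrM ?unitrV // invrK.
by rewrite -(mulrA g^-1) e -mulrA mulVKr.
Qed.

(** The points of level 0 are lifted one after the other; those of level j + 1 are
   the points of level j and the midpoints between consecutive ones. The smallness
   of the increments required by the midpoint lemma is propagated from a level to
   the next because the bound V is again small. *)
Lemma dyadic_lift (lam : R) :
  (0 < N)%N -> 0 < lam -> lam < 1 -> 2^-1 < lam ^+ N ->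
  exists2 C, 1 <= C & exists2 r, 0 < r & forall Y : nat -> nat -> set TN,
    (forall j k, quot_group K (Y j k)) -> (forall j k, Y j.+1 k.*2 = Y j k) ->
    (forall j k, quot_dist (Y j k) (Y j k.+1) < r) ->
    exists L : nat -> nat -> TN, let a j k := nu ((L j k)^-1 * L j k.+1) in
    [/\ forall j k, Y j k (L j k), forall j k, L j.+1 k.*2 = L j k &
      forall j k, let V := Num.max (lam * a j k)
        (C * Num.max (quot_dist (Y j.+1 k.*2) (Y j.+1 k.*2.+1))
                     (quot_dist (Y j.+1 k.*2.+1) (Y j.+1 k.*2.+2)))
      in a j.+1 k.*2 <= V /\ a j.+1 k.*2.+1 <= V].
Proof.
move=> N0 lam0 lam1 hlam.
have [C C1 [r r0 hC]] := lift_midpoint N0 lam0 lam1 hlam.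
have [D D0 hD] := quot_dist_attained hcK.
have C0 : 0 < C by rewrite (lt_le_trans ltr01).
exists (C + D); first by rewrite (le_trans C1) // lerDl ltW.
exists (Num.min r (r / (C + D))); first by rewrite lt_min r0 divr_gt0 // addr_gt0.
move=> Y qY Y2 Yr.
have Yr1 j k : quot_dist (Y j k) (Y j k.+1) < r.
  by have := Yr j k; rewrite lt_min => /andP[].
have Yr2 j k : (C + D) * quot_dist (Y j k) (Y j k.+1) < r.
  have := Yr j k; rewrite lt_min => /andP[_].
  by rewrite ltr_pdivlMr ?addr_gt0 // mulrC.
have Y0 j k : 0 <= quot_dist (Y j k) (Y j k.+1).
  by have [E _ /(_ _ _ _ (qY j k) (qY j k.+1) (qY j k))[]] := quot_dist_quasi hcK.
have /choice[nxt hnxt] : forall p : TN * set TN, exists h, G p.1 -> quot_group K p.2 ->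
    p.2 h /\ nu (p.1^-1 * h) <= D * quot_dist (quot_proj K p.1) p.2.
  move=> [g B] /=; have [[Gg qB]|hn] := pselect (G g /\ quot_group K B).
    by have [h Bh nh] := hD g B Gg qB; exists h.
  by exists 0 => Gg qB; case: hn.
have /choice[mid hmid] : forall p : TN * TN * set TN, exists m,
    G p.1.1 -> G p.1.2 -> quot_group K p.2 -> nu (p.1.1^-1 * p.1.2) < r ->
    quot_dist (quot_proj K p.1.1) p.2 < r -> quot_dist p.2 (quot_proj K p.1.2) < r ->
    p.2 m /\
      let V := Num.max (lam * nu (p.1.1^-1 * p.1.2))
        (C * Num.max (quot_dist (quot_proj K p.1.1) p.2)
                     (quot_dist p.2 (quot_proj K p.1.2)))
      in nu (p.1.1^-1 * m) <= V /\ nu (m^-1 * p.1.2) <= V.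
  move=> [[g g'] M] /=.
  have [hyp|hn] := pselect (exists m, M m /\
      let V := Num.max (lam * nu (g^-1 * g'))
        (C * Num.max (quot_dist (quot_proj K g) M) (quot_dist M (quot_proj K g')))
      in nu (g^-1 * m) <= V /\ nu (m^-1 * g') <= V).
    by have [m hm] := hyp; exists m.
  by exists 0 => Gg Gg' qM n1 n2 n3; case: hn; exact: hC.
have [g0 Yg0] : exists g, Y 0%N 0%N g.
  by have [g Gg <-] := qY 0%N 0%N; exists g; exact: (coset_refl hcK).
pose L0 := fix L0 k := if k is k'.+1 then nxt (L0 k', Y 0%N k) else g0.
pose L := fix L j k := if j is j'.+1 then
  if odd k then mid (L j' k./2, L j' k./2.+1, Y j k) else L j' k./2 else L0 k.
have LE j k : L j.+1 k.*2 = L j k by rewrite /= odd_double doubleK.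
have LO j k : L j.+1 k.*2.+1 = mid (L j k, L j k.+1, Y j.+1 k.*2.+1).
  by rewrite /= odd_double /= uphalf_double.
have LS k : L 0%N k.+1 = nxt (L 0%N k, Y 0%N k.+1) by [].
have L00 : L 0%N 0%N = g0 by [].
move: (L) LE LO LS L00 => {}L LE LO LS L00.
have inY j k g : Y j k g -> G g /\ Y j k = quot_proj K g.
  exact: (quot_groupP hcK (qY j k)).
have h0 k : Y 0%N k (L 0%N k) /\
    nu ((L 0%N k)^-1 * L 0%N k.+1) <= D * quot_dist (Y 0%N k) (Y 0%N k.+1).
  elim: k => [|k [IH1 IH2]].
    rewrite LS L00; split=> //; have [Gg eY] := inY _ _ _ Yg0.
    by have [_] := hnxt (g0, Y 0%N 1%N) Gg (qY _ _); rewrite /= -eY.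
  have [Gg eY] := inY _ _ _ IH1.
  have [h1 _] := hnxt (L 0%N k, Y 0%N k.+1) Gg (qY _ _).
  rewrite -LS in h1; split=> //; have [Gg' eY'] := inY _ _ _ h1.
  rewrite [L 0%N k.+2]LS.
  by have [_] := hnxt (L 0%N k.+1, Y 0%N k.+2) Gg' (qY _ _); rewrite /= -eY'.
have step j : (forall k, Y j k (L j k) /\ nu ((L j k)^-1 * L j k.+1) < r) ->
  forall k, [/\ Y j.+1 k.*2 (L j.+1 k.*2), Y j.+1 k.*2.+1 (L j.+1 k.*2.+1) &
    let V := Num.max (lam * nu ((L j k)^-1 * L j k.+1))
        (C * Num.max (quot_dist (Y j.+1 k.*2) (Y j.+1 k.*2.+1))
                     (quot_dist (Y j.+1 k.*2.+1) (Y j.+1 k.*2.+2)))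
      in nu ((L j.+1 k.*2)^-1 * L j.+1 k.*2.+1) <= V /\
         nu ((L j.+1 k.*2.+1)^-1 * L j.+1 k.*2.+2) <= V].
  move=> hj k; have [Yk nk] := hj k; have [Yk1 _] := hj k.+1.
  have [Gk eYk] := inY _ _ _ Yk; have [Gk1 eYk1] := inY _ _ _ Yk1.
  have := hmid (L j k, L j k.+1, Y j.+1 k.*2.+1) Gk Gk1 (qY _ _) nk.
  rewrite /= -eYk -eYk1 -LO -(Y2 j k) -(Y2 j k.+1) doubleS.
  move=> /(_ (Yr1 _ _) (Yr1 _ _))[h1 [h2 h3]].
  split=> //; first by rewrite LE Y2.
  by rewrite -doubleS !LE doubleS.
have Vlt j k : nu ((L j k)^-1 * L j k.+1) < r ->
    Num.max (lam * nu ((L j k)^-1 * L j k.+1))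
        (C * Num.max (quot_dist (Y j.+1 k.*2) (Y j.+1 k.*2.+1))
                     (quot_dist (Y j.+1 k.*2.+1) (Y j.+1 k.*2.+2))) < r.
  move=> nk; rewrite gt_max; apply/andP; split.
    by rewrite (le_lt_trans _ nk) // ler_piMl ?nu_ge0 // ltW.
  rewrite maxr_pMr ?(ltW C0) // gt_max.
  have lt' k' : C * quot_dist (Y j.+1 k') (Y j.+1 k'.+1) < r.
    by rewrite (le_lt_trans _ (Yr2 j.+1 k')) // ler_wpM2r // lerDl ltW.
  by rewrite !lt'.
have inv j : forall k, Y j k (L j k) /\ nu ((L j k)^-1 * L j k.+1) < r.
  elim: j => [|j IH] k.
    have [h1 h2] := h0 k; split=> //; rewrite (le_lt_trans h2) //.
    by rewrite (le_lt_trans _ (Yr2 0%N k)) // ler_wpM2r // lerDr ltW.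
  have [h1 h2 [h3 h4]] := step j IH k./2.
  have Vl := Vlt j k./2 (IH _).2.
  rewrite -(odd_double_half k); case: (odd k); rewrite ?add1n ?add0n; split=> //.
    exact: le_lt_trans h4 Vl.
  exact: le_lt_trans h3 Vl.
exists L; split=> //.
  by move=> j k; have [] := inv j k.
move=> j k V; have [_ _ [h3 h4]] := step j (inv j) k.
suff le : forall v : R, v <= Num.max (lam * nu ((L j k)^-1 * L j k.+1))
        (C * Num.max (quot_dist (Y j.+1 k.*2) (Y j.+1 k.*2.+1))
                     (quot_dist (Y j.+1 k.*2.+1) (Y j.+1 k.*2.+2))) -> v <= V.
  by split; apply: le.
move=> v hv; apply: (le_trans hv); rewrite /V ge_max !le_max lexx /=.
apply/orP; right; rewrite ler_wpM2r ?lerDl ?(ltW D0) //.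
by rewrite le_max Y0.
Qed.

End DyadicLift.

(** * Limits of chains *)

Section Chains.
Context {R : realType} {d N : nat}.
Local Notation TN := (tensor R d N).
Local Notation G := (@free_nilpotent_group R d N).
Implicit Types (h u v x y z : TN) (B C M V e r s t del mu : R).

Lemma geometric_small A mu del : 0 <= A -> 0 < mu -> mu < 1 -> 0 < del ->
  exists n0, forall n, (n0 <= n)%N -> A * mu ^+ n < del.
Proof.
move=> A0 mu0 mu1 d0.
have h : (fun n => mu ^+ n) @ \oo --> (0 : R).
  by apply: cvg_expr; rewrite ger0_norm // ltW.
have d1 : 0 < del / (A + 1) by rewrite divr_gt0 // ltr_wpDl.
move/cvgrPdist_lt : h => /(_ _ d1)[n0 _ hn]; exists n0 => n n0n.
have := hn n n0n; rewrite /= sub0r normrN ger0_norm ?exprn_ge0 ?(ltW mu0) //.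
rewrite ltr_pdivlMr ?ltr_wpDl // => h.
rewrite (le_lt_trans _ h) // mulrC ler_wpM2l ?exprn_ge0 ?(ltW mu0) //.
by rewrite lerDl.
Qed.

Lemma tnorm_dil_ge1 l (a : TN) : 1 <= l -> tnorm (dil l a) <= l ^+ N * tnorm a.
Proof.
move=> l1; have l0 : 0 <= l by rewrite (le_trans ler01).
apply: tnorm_leP => [|w sw]; first by rewrite mulr_ge0 ?exprn_ge0 ?tnorm_ge0.
rewrite tcoef_dil normrM ger0_norm ?exprn_ge0 // mulrCA.
by rewrite ler_pM ?exprn_ge0 ?mulr_ge0 ?tcoef_le_tnormM // ler_weXn2l.
Qed.

Lemma nu_bounded_tnorm B : exists2 D, 0 < D &
  forall h, G h -> nu h <= B -> tnorm h <= D.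
Proof.
have [D D1 hD] := @nu_ball_tnorm R d N.
pose l := Num.max 1 B; have l1 : 1 <= l by rewrite le_max lexx.
have l0 : 0 < l by rewrite (lt_le_trans ltr01).
exists (l ^+ N * D); first by rewrite mulr_gt0 ?exprn_gt0 // (lt_le_trans ltr01).
move=> h Gh hB; have [h' Gh' [eh nh]] := nu_normalize Gh l0.
rewrite eh (le_trans (tnorm_dil_ge1 _ l1)) // ler_wpM2l ?exprn_ge0 ?(ltW l0) //.
apply: hD => //; rewrite nh ler_pdivrMl // mulr1 (le_trans hB) //.
by rewrite le_max lexx orbT.
Qed.

(** Peeling off the first step of the chain multiplies the bound for the rest by
   1 + e only, thanks to nuM_l, so that the i-th step is amplified by (1 + e) ^ i. *)
Lemma nu_chain e : 0 < e -> exists2 C, 1 <= C & forall (g : nat -> TN) c,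
  (forall j, G (g j)) -> (forall j, nu ((g j)^-1 * g j.+1) <= c j) ->
  forall m V n, 0 < V -> (forall i, (i < m)%N -> C * (1 + e) ^+ i * c (n + i)%N < V) ->
  nu ((g n)^-1 * g (n + m)%N) < V.
Proof.
move=> e0; have [C C1 hC] := @nuM_l R d N e e0; exists C => // g c Gg gc.
have GVM i j : G ((g i)^-1 * g j) by apply: groupM => //; exact: groupV.
have e1 : 0 < 1 + e by rewrite addr_gt0.
elim=> [|m IH] V n V0 hV.
  by rewrite addn0 mulVr ?group_unit // nu1.
have -> : (g n)^-1 * g (n + m.+1)%N =
    ((g n)^-1 * g n.+1) * ((g n.+1)^-1 * g (n.+1 + m)%N).
  by rewrite addSnnS mulrA mulrK // group_unit.
rewrite (le_lt_trans (hC _ _ (GVM _ _) (GVM _ _))) // gt_max; apply/andP; split.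
  have := hV 0%N isT; rewrite expr0 mulr1 addn0.
  by apply: le_lt_trans; rewrite ler_wpM2l // (le_trans ler01).
rewrite mulrC -ltr_pdivlMr //; apply: IH => [|i im]; first by rewrite divr_gt0.
have := hV i.+1 im; rewrite ltr_pdivlMr // addSnnS exprS.
by congr (_ < V); ring.
Qed.

(** The distance to the limit is controlled by a single step, a form which is stable
   under p-th powers and sums. If it failed for all i, nu_chain would bound all the
   distances from g n to g m by less than the limiting distance. *)
Lemma chain_limit e : 0 < e -> exists2 C, 1 <= C &
  forall (g : nat -> TN) c mu M,
  (forall j, G (g j)) -> (forall j, nu ((g j)^-1 * g j.+1) <= c j) ->
  0 < mu -> mu < 1 -> (forall j, c j <= M * mu ^+ j) ->
  exists2 l, G l &
    (forall del, 0 < del -> exists m0, forall m, (m0 <= m)%N ->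
      nu ((g m)^-1 * l) < del) /\
    forall n, exists i, nu ((g n)^-1 * l) <= C * (1 + e) ^+ i * c (n + i)%N.
Proof.
move=> e0; have [C C1 hC] := nu_chain e0.
have [C2 C21 hC2] := @nuM_r R d N e e0.
have C20 : 0 < C2 by rewrite (lt_le_trans ltr01).
have e1 : 0 < 1 + e by rewrite addr_gt0.
exists ((1 + e) * C); first by rewrite mulr_ege1 // lerDl ltW.
move=> g c mu M Gg gc mu0 mu1 hc.
have GVM i h : G h -> G ((g i)^-1 * h) by move=> Gh; apply: groupM => //; exact: groupV.
have f0 : 0 < mu^-1 - 1 by rewrite subr_gt0 invf_gt1.
have [C' C'1 hC'] := nu_chain f0.
have C'0 : 0 < C' by rewrite (lt_le_trans ltr01).
have M0 : 0 <= M.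
  by have := hc 0%N; rewrite expr0 mulr1; apply: le_trans; apply: le_trans (gc 0%N); exact: nu_ge0.
pose A := C' * (M + 1).
have A0 : 0 < A by rewrite mulr_gt0 // ltr_wpDl.
have cauchy n m : nu ((g n)^-1 * g (n + m)%N) < A * mu ^+ n.
  apply: (hC' _ c) => // [|i im]; first by rewrite mulr_gt0 // exprn_gt0.
  rewrite addrC subrK exprVn /A.
  rewrite (@le_lt_trans _ _ (C' * M * mu ^+ n)) //; last first.
    by rewrite ltr_pM2r ?exprn_gt0 // ltr_pM2l // ltrDl.
  rewrite -mulrA -[leRHS]mulrA ler_wpM2l ?(ltW C'0) //.
  rewrite mulrC ler_pdivrMr ?exprn_gt0 // -mulrA -exprD; exact: hc.
have [E1 E11 hE1] := @nuM_crude R d N.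
move: (A) A0 cauchy => {}A A0 cauchy.
pose B := E1 * Num.max (nu (g 0%N)) A.
have gB n : nu (g n) <= B.
  have -> : g n = g 0%N * ((g 0%N)^-1 * g n) by rewrite mulVKr // group_unit.
  apply: hE1 => //; [exact: GVM|by rewrite le_max lexx|].
  by have := ltW (cauchy 0%N n); rewrite add0n expr0 mulr1 le_max orbC => ->.
have [D D0 hD] := nu_bounded_tnorm B.
have [E E0 hE] := @nu_ball_sub1 R d N.
have [l hl] := @tensor_cluster R d N g D (fun n => hD _ (Gg n) (gB n)).
have conv del : 0 < del -> exists m0, forall m, (m0 <= m)%N -> tnorm (g m - l) < del.
  move=> d0; have h2 : 0 < del / 2 by rewrite divr_gt0.
  have [n1 hn1] := geometric_small (ltW A0) mu0 mu1 ltr01.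
  have DE : 0 <= D * E * A by rewrite mulr_ge0 ?(ltW A0) // mulr_ge0 // ltW.
  have [n2 hn2] := geometric_small DE mu0 mu1 h2.
  exists (maxn n1 n2) => m; rewrite geq_max => /andP[m1 m2].
  have [n mn hn] := hl (del / 2) m h2.
  rewrite (le_lt_trans (tnorm_trans (g n) _ _)) // [del]splitr ltrD //.
  rewrite tnormC (le_lt_trans _ (hn2 m m2)) //.
  have -> : g n - g m = g m * ((g m)^-1 * g n - 1).
    by rewrite mulrBr mulr1 mulVKr // group_unit.
  rewrite (le_trans (tnormM _ _)) // -!mulrA ler_pM ?tnorm_ge0 ?hD //.
  apply: hE; first exact: GVM.
    apply/andP; split; last by apply/ltW/hn1.
    by rewrite mulr_ge0 ?exprn_ge0 ?(ltW A0) ?(ltW mu0).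
  by have := ltW (cauchy m (n - m)%N); rewrite subnKC.
have Gl : G l.
  apply: group_closed => del d0; have [m0 hm0] := conv del d0.
  by exists (g m0) => //; rewrite tnormC hm0.
have nconv del : 0 < del -> exists m0, forall m, (m0 <= m)%N ->
    nu ((g m)^-1 * l) < del.
  move=> d0; have h2 : 0 < del / 2 by rewrite divr_gt0.
  have [s s0 hs] := @nu_small R d N _ h2.
  have [|m0 hm0] := conv (s / D); first by rewrite divr_gt0.
  exists m0 => m mm0; apply: (@le_lt_trans _ _ (del / 2)); last by lra.
  apply: hs; first exact: GVM.
  have -> : (g m)^-1 * l - 1 = (g m)^-1 * (l - g m).
    by rewrite mulrBr mulVr // group_unit.
  rewrite (le_lt_trans (tnormM _ _)) // tnormC.
  rewrite (@le_lt_trans _ _ (D * tnorm (g m - l))) //.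
    by rewrite ler_wpM2r ?tnorm_ge0 // hD ?nuV //; exact: groupV.
  by rewrite mulrC -ltr_pdivlMr // hm0.
exists l => //; split=> // n.
apply: contrapT => hn; set v := nu ((g n)^-1 * l) in hn.
have hlt i : (1 + e) * C * (1 + e) ^+ i * c (n + i)%N < v.
  by rewrite ltNge; apply/negP => h; apply: hn; exists i.
have v0 : 0 < v.
  apply: le_lt_trans (hlt 0%N); rewrite mulr_ge0 //.
    by rewrite !mulr_ge0 ?exprn_ge0 ?(ltW e1) // (le_trans ler01).
  by apply: le_trans (gc _); exact: nu_ge0.
have [|m0 hm0] := nconv (v / C2); first by rewrite divr_gt0.
pose m := maxn m0 n.
have h1 : nu ((g n)^-1 * g m) < v / (1 + e).
  have -> : m = (n + (m - n))%N by rewrite subnKC // leq_maxr.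
  apply: (hC g c Gg gc); first by rewrite divr_gt0.
  move=> i _; rewrite ltr_pdivlMr //; apply: le_lt_trans (hlt i).
  by rewrite le_eqVlt; apply/orP; left; apply/eqP; ring.
have h2 := hm0 m (leq_maxl _ _).
have := hC2 _ _ (GVM n _ (Gg m)) (GVM m _ Gl).
have -> : (g n)^-1 * g m * ((g m)^-1 * l) = (g n)^-1 * l.
  by rewrite mulrA mulrK // group_unit.
rewrite -/v le_max leNgt [v <= C2 * _]leNgt.
rewrite ltr_pdivlMr // mulrC in h1; rewrite ltr_pdivlMr // mulrC in h2.
by rewrite h1 h2.
Qed.

End Chains.

(** * Integrals and rectangles *)

Section Rectangles.
Import HBNNSimple.
Context {R : realType}.
Local Notation mu := (@lebesgue_measure R).
Local Notation mu2 := (@lebesgue_measure R \x @lebesgue_measure R)%E.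
Implicit Types (f g : R * R -> R) (D : set (R * R)).

(** The integral of a nonnegative function is a supremum over simple functions,
   which gives its monotonicity for arbitrary functions. *)
Lemma ge0_le_integral_nomeas d (X : measurableType d)
    (m : {measure set X -> \bar R}) (D : set X) (f g : X -> \bar R) :
  (forall x, D x -> (0 <= f x)%E) -> (forall x, D x -> (f x <= g x)%E) ->
  (\int[m]_(x in D) f x <= \int[m]_(x in D) g x)%E.
Proof.
move=> f0 fg; have g0 x : D x -> (0 <= g x)%E.
  by move=> Dx; apply: le_trans (f0 x Dx) (fg x Dx).
rewrite !ge0_integralE //; apply: ereal_sup_le => _ [h hf <-].
exists h => // x.
apply: le_trans (hf x) _; rewrite /patch; case: ifPn => //.
by rewrite inE => /fg.
Qed.

(** Open, so that adjacent cells of a grid are disjoint. *)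
Definition rect (p : (R * R) * (R * R)) : set (R * R) :=
  [set` `]p.1.1, p.1.2[] `*` [set` `]p.2.1, p.2.2[].

Definition rect_area (p : (R * R) * (R * R)) : R :=
  (p.1.2 - p.1.1) * (p.2.2 - p.2.1).

Definition rect_ok (p : (R * R) * (R * R)) : Prop :=
  p.1.1 <= p.1.2 /\ p.2.1 <= p.2.2.

Lemma measurable_rect p : measurable (rect p).
Proof. by apply: measurableX; exact: measurable_itv. Qed.

Lemma measure_rect p : rect_ok p -> mu2 (rect p) = (rect_area p)%:E.
Proof.
case: p => [[a b] [c d]] [/= ab cd].
rewrite product_measure1E //=.
have itv (x y : R) : x <= y -> mu [set` `]x, y[] = (y - x)%:E.
  rewrite le_eqVlt => /orP[/eqP <-|xy].
    by rewrite lebesgue_measure_itv /= ltxx subrr.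
  by rewrite lebesgue_measure_itv /= lte_fin xy EFinB.
by rewrite !itv // -EFinM.
Qed.

Definition steps (I : Type) (r : seq I) (c : I -> R) (p : I -> (R * R) * (R * R))
  (z : R * R) : R := \sum_(i <- r) c i * \1_(rect (p i)) z.

Lemma measurable_step (c : R) p D : measurable_fun D (fun z => (c * \1_(rect p) z)%:E).
Proof.
apply/measurable_EFinP; apply: measurable_funM; first exact: measurable_cst.
by apply: measurable_indic; exact: measurable_rect.
Qed.

Lemma integral_steps (I : Type) (r : seq I) (c : I -> R)
    (p : I -> (R * R) * (R * R)) D :
  measurable D -> (forall i, 0 <= c i) ->
  (\int[mu2]_(z in D) (steps r c p z)%:E =
   \sum_(i <- r) ((c i)%:E * mu2 (rect (p i) `&` D)))%E.
Proof.
move=> mD c0; rewrite /steps.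
under eq_integral => z _ do rewrite -sumEFin.
rewrite ge0_integral_sum //.
- apply: eq_bigr => i _.
  have := @integralZl_indic _ _ _ mu2 _ mD (fun=> rect (p i)) (c i).
  rewrite /= => -> //; last exact: measurable_rect.
    by rewrite integral_indic //; exact: measurable_rect.
  by move=> ci; have := le_lt_trans (c0 i) ci; rewrite ltxx.
- by move=> i; exact: measurable_step.
- by move=> i z _; rewrite lee_fin mulr_ge0.
Qed.

Lemma integral_ge_steps (I : Type) (r : seq I) (c : I -> R)
    (p : I -> (R * R) * (R * R)) D f : measurable D ->
  (forall i, 0 <= c i) -> (forall i, rect_ok (p i)) ->
  (forall i, rect (p i) `<=` D) ->
  (forall z, D z -> steps r c p z <= f z) ->
  ((\sum_(i <- r) c i * rect_area (p i))%:E <= \int[mu2]_(z in D) (f z)%:E)%E.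
Proof.
move=> mD c0 pok pD hf.
apply: le_trans (ge0_le_integral_nomeas mu2 (f := fun z => (steps r c p z)%:E) _ _).
- rewrite integral_steps // -sumEFin le_eqVlt; apply/orP; left; apply/eqP.
  by apply: eq_bigr => i _; rewrite (setIidl (pD i)) measure_rect // EFinM.
- by move=> z _; rewrite lee_fin; apply: sumr_ge0 => i _; rewrite mulr_ge0.
- by move=> z Dz; rewrite lee_fin hf.
Qed.

(** The value of f at a point is bounded by one of the step functions, so f is below
   their sum, which is integrable by monotone convergence. *)
Lemma integral_le_steps (I : Type) (r : nat -> seq I) (c : nat -> I -> R)
    (p : nat -> I -> (R * R) * (R * R)) D f (B : R) : measurable D ->
  (forall n i, 0 <= c n i) -> (forall n i, rect_ok (p n i)) ->
  (forall z, D z -> 0 <= f z) ->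
  (forall z, D z -> exists n, f z <= steps (r n) (c n) (p n) z) ->
  (forall m, \sum_(n < m) \sum_(i <- r n) c n i * rect_area (p n i) <= B) ->
  (\int[mu2]_(z in D) (f z)%:E < +oo)%E.
Proof.
move=> mD c0 pok f0 hf hB.
have s0 n z : 0 <= steps (r n) (c n) (p n) z.
  by apply: sumr_ge0 => i _; rewrite mulr_ge0.
apply: (@le_lt_trans _ _ B%:E); last exact: ltry.
apply: (le_trans (ge0_le_integral_nomeas mu2
  (g := fun z => (\sum_(n <oo) (steps (r n) (c n) (p n) z)%:E)%E) _ _)).
- by move=> z /f0 fz; rewrite lee_fin.
- move=> z /hf[n fn]; apply: (@le_trans _ _ (steps (r n) (c n) (p n) z)%:E).
    by rewrite lee_fin.
  apply: le_trans (nneseries_lim_ge n.+1 _); last by move=> i _ _; rewrite lee_fin.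
  rewrite big_nat_recr //= leeDr //; apply: sume_ge0 => i _.
  by rewrite lee_fin.
rewrite integral_nneseries //; last 2 first.
- move=> n; apply/measurable_EFinP; rewrite /steps.
  apply: measurable_sum => i; apply/measurable_EFinP; exact: measurable_step.
- by move=> n z _; rewrite lee_fin.
apply: lime_le; first by apply: is_cvg_nneseries => n _ _; apply: integral_ge0 => z _; rewrite lee_fin.
apply: nearW => m; rewrite big_mkord.
apply: le_trans (_ : (\sum_(n < m) \sum_(i <- r n) c n i * rect_area (p n i))%:E <= _)%E; last by rewrite lee_fin.
rewrite -sumEFin; apply: lee_sum => n _; rewrite integral_steps // -sumEFin.
apply: lee_sum => i _; rewrite EFinM lee_wpmul2l ?lee_fin //.
rewrite -measure_rect //; apply: le_measure; rewrite ?inE //.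
- by apply: measurableI => //; exact: measurable_rect.
- exact: measurable_rect.
Qed.

End Rectangles.

(** * From the double integral to dyadic sums *)

Section DyadicSums.
Context {R : realType}.
Implicit Types (s t x y z e C T p a : R).

Lemma powR_add_le x y p : 0 <= x -> 0 <= y -> 0 <= p ->
  (x + y) `^ p <= 2 `^ p * (x `^ p + y `^ p).
Proof.
move=> x0 y0 p0.
have h (u v : R) : 0 <= u -> u <= v -> (u + v) `^ p <= 2 `^ p * (u `^ p + v `^ p).
  move=> u0 uv; have v0 := le_trans u0 uv.
  apply: (@le_trans _ _ ((2 * v) `^ p)).
    by rewrite ge0_ler_powR // ?nnegrE ?addr_ge0 ?mulr_ge0 //; lra.
  by rewrite powRM // ler_wpM2l ?powR_ge0 // lerDr powR_ge0.
have [xy|/ltW yx] := lerP x y; first exact: h.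
by rewrite addrC [x `^ p + _]addrC h.
Qed.

Lemma powR_exprn x n p : 0 <= x -> (x ^+ n) `^ p = (x `^ p) ^+ n.
Proof.
move=> x0; elim: n => [|n IH]; first by rewrite !expr0 powR1.
by rewrite !exprS powRM ?exprn_ge0 // IH.
Qed.

(** Reflection of the line onto [0, T]; it makes the path defined on shifted dyadic
   grids, which may leave [0, T]. *)
Definition fold T z : R := Num.max 0 (T - `|T - `|z| |).

Lemma fold_itv T z : 0 <= T -> 0 <= fold T z <= T.
Proof.
by move=> T0; rewrite /fold le_max lexx /= ge_max T0 /= gerBl.
Qed.

Lemma fold_id T z : 0 <= z <= T -> fold T z = z.
Proof.
move=> /andP[z0 zT]; rewrite /fold (ger0_norm z0) ger0_norm ?subr_ge0 //.
by rewrite opprB addrC subrK max_r.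
Qed.

Lemma fold_lip T y z : `|fold T y - fold T z| <= `|y - z|.
Proof.
have h1 : `| `|T - `|y| | - `|T - `|z| | | <= `|y - z|.
  apply: le_trans (ler_dist_dist _ _) _.
  have -> : T - `|y| - (T - `|z|) = - (`|y| - `|z|) by ring.
  by rewrite normrN; exact: ler_dist_dist.
rewrite /fold; move: h1; move: (`|T - `|y| |) (`|T - `|z| |) (`|y - z|) => b c D.
rewrite !ler_norml => /andP[h1 h2]; rewrite /Num.max.
by case: ltP => ?; case: ltP => ?; apply/andP; split; lra.
Qed.

(** The properties of the quotient distance along the path that the comparison of
   integrals and sums depends on. Being stable up to constants, they follow from the
   comparison of the quotient distance with nu. *)
Record quasi_metric_on T C (q : R -> R -> R) : Prop := QuasiMetricOn {
  qm_C : 1 <= C;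
  qm_ge0 : forall s t, 0 <= s <= T -> 0 <= t <= T -> 0 <= q s t;
  qm_xx : forall s, 0 <= s <= T -> q s s = 0;
  qm_sym : forall s t, 0 <= s <= T -> 0 <= t <= T -> q t s <= C * q s t;
  qm_tri : forall s t x, 0 <= s <= T -> 0 <= t <= T -> 0 <= x <= T ->
    q s x <= C * (q s t + q t x);
  qm_unif : forall e, 0 < e -> exists2 del, 0 < del & forall s t,
    0 <= s <= T -> 0 <= t <= T -> `|s - t| < del -> q s t < e }.

Lemma ler_sum_window (F : nat -> R) i m n l : (forall j, 0 <= F j) -> (i + n <= l)%N ->
  \sum_(m <= j < n) F (i + j)%N <= \sum_(0 <= j < l) F j.
Proof.
move=> F0 il; have [nm|/ltnW mn] := leqP n m; first by rewrite big_geq // sumr_ge0.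
have -> : \sum_(m <= j < n) F (i + j)%N = \sum_(i + m <= j < i + n) F j.
  by rewrite [(i + m)%N]addnC [(i + n)%N]addnC big_addn addnK; apply: eq_bigr => j _; rewrite addnC.
rewrite (@big_cat_nat _ _ _ (i + m) 0) //=; last by rewrite (leq_trans _ il) // leq_add2l.
rewrite [X in _ + X](@big_cat_nat _ _ _ (i + n)) ?leq_add2l //=.
by rewrite addrCA lerDl addr_ge0 ?sumr_ge0.
Qed.

Lemma ler_sum_sub (F : nat -> R) m m' n n' : (forall j, 0 <= F j) ->
  (m' <= m)%N -> (n <= n')%N -> \sum_(m <= j < n) F j <= \sum_(m' <= j < n') F j.
Proof.
move=> F0 mm nn; have [nm|/ltnW mn] := leqP n m; first by rewrite big_geq // sumr_ge0.
rewrite [leRHS](@big_cat_nat _ _ _ m) //=; last exact: leq_trans mn nn.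
rewrite [X in _ + X](@big_cat_nat _ _ _ n) //=.
by rewrite addrCA lerDl addr_ge0 ?sumr_ge0.
Qed.

Lemma dyadic_tiling (F : nat -> R) (e m : nat) : (m <= e.+1)%N ->
  \sum_(0 <= n < m) \sum_(0 <= l < 2 ^ (e - n)) F (2 ^ (e - n) + l)%N =
  \sum_(2 ^ (e.+1 - m) <= d < 2 ^ e.+1) F d.
Proof.
elim: m => [_|m IH me]; first by rewrite !big_geq.
rewrite big_nat_recr //= IH 1?ltnW // addrC [RHS](@big_cat_nat _ _ _ (2 ^ (e.+1 - m))) /=.
- congr (_ + _); rewrite subSS -[in RHS](add0n (2 ^ (e - m))%N) big_addn subSn //.
  by rewrite expnS mul2n -addnn addnK; apply: eq_bigr => j _; rewrite addnC.
- by rewrite leq_exp2l // leq_sub2l.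
- by rewrite leq_exp2l // leq_subr.
Qed.

Section Grid.
Context (T C p a : R) (q : R -> R -> R) (T0 : 0 < T) (p0 : 0 < p) (a1 : 1 < a)
  (hq : quasi_metric_on T C q).
Context (e : nat).

Let S : nat := (2 ^ e)%N.
Let delta : R := T / (2 * S%:R).
Let Z : nat := (5 * S)%N.

Let S0 : 0 < S%:R :> R.
Proof. by rewrite ltr0n expn_gt0. Qed.

Let delta0 : 0 < delta.
Proof. by rewrite divr_gt0 // mulr_gt0. Qed.

Let Sdelta : S%:R * delta = T / 2.
Proof. by rewrite /delta; field; rewrite gt_eqF. Qed.

Let C0 : 0 < C. Proof. exact: lt_le_trans ltr01 (qm_C hq). Qed.

Let Sp : (0 < S)%N. Proof. by rewrite expn_gt0. Qed.

(** Midpoints of the cells of size delta covering [-T/2, 2T]. *)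
Definition grid_pt (i : nat) : R := (i%:R + 2^-1) * delta - T / 2.

Definition grid_val i : R := fold T (grid_pt i).

Lemma grid_val_itv i : 0 <= grid_val i <= T.
Proof. exact/fold_itv/ltW. Qed.

(** The cell of [0, T] onto which the i-th cell is folded. *)
Definition cell (i : nat) : nat :=
  if (i < S)%N then (S.-1 - i)%N
  else if (i < 3 * S)%N then (i - S)%N else ((5 * S).-1 - i)%N.

Lemma cell_lt i : (cell i < 2 * S)%N.
Proof.
have := Sp; rewrite /cell; move: S => n n0.
by have [h1|h1] := ltnP i n; [lia|have [h2|h2] := ltnP i (3 * n); lia].
Qed.

(** The three cases are the parts of the grid to the left of 0, in [0, T] and to the
   right of T. *)
Lemma grid_valE i : (i < Z)%N -> grid_val i = ((cell i)%:R + 2^-1) * delta.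
Proof.
move=> iZ; have eT : T = 2 * S%:R * delta by rewrite -mulrA Sdelta; field.
have hd := delta0; have i0 : 0 <= i%:R :> R by []; have s0 := S0.
have cast (x y : nat) : (x <= y)%N -> x%:R <= y%:R :> R by rewrite ler_nat.
rewrite /grid_val /grid_pt /cell -Sdelta /fold.
case: ltnP => h1; [|case: ltnP => h2].
- have := cast _ _ h1; rewrite -natr1 => h1'.
  have -> : ((S.-1 - i)%N%:R : R) = S%:R - 1 - i%:R.
    have iS : (i <= S.-1)%N by rewrite -ltnS prednK.
    by rewrite natrB // -subn1 natrB.
  have -> : `|(i%:R + 2^-1) * delta - S%:R * delta| = (S%:R - i%:R - 2^-1) * delta.
    by rewrite ler0_norm; [ring|nra].
  rewrite ger0_norm; last by rewrite {1}eT; nra.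
  rewrite max_r; last by nra.
  by field.
- have h1' := cast _ _ h1; have := cast _ _ h2; rewrite -natr1 natrM => h2'.
  rewrite natrB // [`|_ - S%:R * _|]ger0_norm; last by nra.
  rewrite ger0_norm; last by rewrite {1}eT; nra.
  by rewrite max_r; [field|nra].
- have := cast _ _ iZ; have := cast _ _ h2; rewrite -natr1 /Z !natrM => h2' h3'.
  have -> : (((5 * S).-1 - i)%N%:R : R) = 5 * S%:R - 1 - i%:R.
    have h5 : (0 < 5 * S)%N by rewrite muln_gt0.
    have iS : (i <= (5 * S).-1)%N by rewrite -ltnS prednK.
    by rewrite natrB // -subn1 natrB // natrM.
  have -> : `|(i%:R + 2^-1) * delta - S%:R * delta| = (i%:R + 2^-1 - S%:R) * delta.
    by rewrite ger0_norm; [ring|nra].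
  rewrite ler0_norm; last by rewrite {1}eT; nra.
  rewrite max_r; last by rewrite {1}eT; nra.
  by rewrite {1 2}eT; field.
Qed.

Let box (i : nat) : R * R := ((cell i)%:R * delta, ((cell i).+1)%:R * delta).

Lemma count_cell x : (\sum_(0 <= i < Z) (x \in `](box i).1, (box i).2[) <= 3)%N.
Proof.
have [c hc] : exists c, forall i, x \in `](box i).1, (box i).2[ -> cell i = c.
  have [[j hj]|no] := pselect (exists j, x \in `](box j).1, (box j).2[).
    exists (cell j) => i hi; move: hi hj; rewrite !in_itv /= => /andP[h1 h2] /andP[h3 h4].
    have lt (u v : nat) : u%:R * delta < v.+1%:R * delta -> (u <= v)%N.
      by rewrite ltr_pM2r // ltr_nat ltnS.
    by apply/eqP; rewrite eqn_leq !lt //; [exact: lt_trans h3 h2|exact: lt_trans h1 h4].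
  by exists 0%N => i hi; case: no; exists i.
rewrite -big_mkcond /= sum1_count -size_filter.
apply: (@uniq_leq_size _ _ [:: (S.-1 - c)%N; (S + c)%N; ((5 * S).-1 - c)%N]).
  by rewrite filter_uniq // iota_uniq.
move=> i; rewrite mem_filter mem_index_iota => /andP[/hc <- /= iZ].
rewrite !inE /cell; case: ltnP => h1; [|case: ltnP => h2].
- by apply/orP; left; apply/eqP; lia.
- by apply/orP; right; apply/orP; left; apply/eqP; lia.
- by apply/orP; right; apply/orP; right; apply/eqP; rewrite /Z in iZ; lia.
Qed.

Local Notation square := (`[0, T]%classic `*` `[0, T]%classic).
Local Notation integrand := (fun z : R * R =>
  q z.1 z.2 `^ p / `|z.2 - z.1| `^ (a + 1)).
Local Notation mu2 := (@lebesgue_measure R \x @lebesgue_measure R)%E.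

Let pq (i j : nat) : R := q (grid_val i) (grid_val j).

Let pq_ge0 i j : 0 <= pq i j.
Proof. exact: qm_ge0 hq _ _ (grid_val_itv i) (grid_val_itv j). Qed.

(** The grid values of q bound q from below on the cells, up to the
   oscillation eta. *)
Let coef eta (i d : nat) : R := if (i + d < Z)%N then
  (Num.max 0 (pq i (i + d) - eta) / C ^+ 2) `^ p / (2 * d%:R * delta) `^ (a + 1)
  else 0.

Let box_grid x i : (i < Z)%N -> x \in `](box i).1, (box i).2[ ->
  [/\ 0 <= x <= T, `|grid_val i - x| < delta & `|x - grid_val i| <= delta / 2].
Proof.
move=> iZ; rewrite in_itv /= grid_valE // => /andP[h1 h2].
have eT : T = 2 * S%:R * delta by rewrite -mulrA Sdelta; field.
have := cell_lt i; rewrite -(ler_nat R) natrM -natr1 => h3.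
have hd := delta0; have c0 : 0 <= (cell i)%:R :> R by [].
move: h2; rewrite -natr1 => h2; split.
- apply/andP; split; first by nra.
  by rewrite eT; nra.
- by rewrite ltr_norml; apply/andP; split; nra.
- by rewrite ler_norml; apply/andP; split; nra.
Qed.

Let coef_le eps (z : R * R) i d : (0 < d)%N ->
  (forall s t, 0 <= s <= T -> 0 <= t <= T -> `|s - t| < delta -> q s t < eps) ->
  z.1 \in `](box i).1, (box i).2[ -> z.2 \in `](box (i + d)).1, (box (i + d)).2[ ->
  coef (2 * C ^+ 2 * eps) i d <= integrand z.
Proof.
move=> d0 unif hx hy; rewrite /coef; case: ifP => [idZ|_]; last first.
  by rewrite divr_ge0 // powR_ge0.
have iZ : (i < Z)%N by apply: leq_ltn_trans idZ; rewrite leq_addr.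
have [xT gx hx'] := box_grid iZ hx; have [yT gy hy'] := box_grid idZ hy.
have g1T := grid_val_itv i; have g2T := grid_val_itv (i + d).
set Q := Num.max 0 _.
have q0 : 0 <= q z.1 z.2 by exact: qm_ge0 hq _ _ xT yT.
have Cp : 0 < C ^+ 2 by rewrite exprn_gt0.
have hQ : Q / C ^+ 2 <= q z.1 z.2.
  rewrite ler_pdivrMr // /Q ge_max mulr_ge0 ?(ltW Cp) //= lerBlDr.
  have t1 := qm_tri hq g1T xT g2T; have t2 := qm_tri hq xT yT g2T.
  have u1 := unif _ _ g1T xT gx.
  have u2 : q z.2 (grid_val (i + d)) < eps by apply: unif => //; rewrite distrC.
  have C1 := qm_C hq.
  have t1' : pq i (i + d) <= C * (q (grid_val i) z.1 + C * (q z.1 z.2 +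
      q z.2 (grid_val (i + d)))).
    apply: le_trans t1 _; apply: ler_wpM2l; first exact: ltW.
    by rewrite lerD2l.
  apply: le_trans t1' _; rewrite expr2.
  have w0 : 0 <= q (grid_val i) z.1 by exact: qm_ge0 hq _ _ g1T xT.
  have w1 : 0 <= q z.2 (grid_val (i + d)) by exact: qm_ge0 hq _ _ yT g2T.
  have e0 : 0 <= eps := ltW (le_lt_trans w0 u1).
  have v1 : C * q (grid_val i) z.1 <= C * C * eps.
    apply: ler_pM => //; rewrite ?(ltW C0) ?(ltW u1) //.
    by rewrite ler_peMl ?(ltW C0).
  have v2 : C * C * q z.2 (grid_val (i + d)) <= C * C * eps.
    by rewrite ler_wpM2l ?(ltW u2) // -expr2 ltW.
  lra.
have Q0 : 0 <= Q / C ^+ 2 by rewrite divr_ge0 ?(ltW Cp) // /Q le_max lexx.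
have dd0 : 0 < 2 * d%:R * delta by rewrite mulr_gt0 ?delta0 // mulr_gt0 // ltr0n.
have [xy|xy] := eqVneq z.2 z.1.
  have -> : Q / C ^+ 2 = 0.
    by apply/eqP; rewrite eq_le Q0 andbT (le_trans hQ) // xy (qm_xx hq).
  by rewrite powR0 ?gt_eqF // mul0r divr_ge0 // powR_ge0.
have xy0 : 0 < `|z.2 - z.1| by rewrite normr_gt0 subr_eq0.
apply: ler_pM; rewrite ?powR_ge0 ?invr_ge0 ?powR_ge0 //.
  by rewrite ge0_ler_powR // ?(ltW p0) ?nnegrE.
rewrite lef_pV2 ?posrE ?powR_gt0 //.
rewrite ge0_ler_powR ?nnegrE ?(ltW dd0) ?(ltW xy0) //; first by have := a1; lra.
have step : `|grid_val (i + d) - grid_val i| <= d%:R * delta.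
  apply: le_trans (fold_lip _ _ _) _; rewrite /grid_pt natrD.
  have -> : (i%:R + d%:R + 2^-1) * delta - T / 2 - ((i%:R + 2^-1) * delta - T / 2) =
    d%:R * delta by ring.
  by rewrite ger0_norm // mulr_ge0 // ltW.
have d1 : 1 <= d%:R :> R by rewrite ler1n.
have hd : delta <= d%:R * delta by rewrite ler_peMl // ltW.
move: hx' hy' step; rewrite -mulrA !ler_norml => /andP[? ?] /andP[? ?] /andP[? ?].
by apply/andP; split; lra.
Qed.

Let coef_ge0 eta i d : 0 <= coef eta i d.
Proof. by rewrite /coef; case: ifP => // _; rewrite divr_ge0 ?powR_ge0. Qed.

(** On the cells, q is at least its value at the grid points up to an oscillation, and
   a point of the square lies in at most three by three of the cells. Hence the step
   function built from the coefficients, divided by 9, is below the integrand. *)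
Lemma grid_integral (I eps : R) (gap : nat) : (0 < gap)%N ->
  (\int[mu2]_(z in square) (integrand z)%:E <= I%:E)%E ->
  (forall s t, 0 <= s <= T -> 0 <= t <= T -> `|s - t| < delta -> q s t < eps) ->
  \sum_(gap <= d < 4 * S) \sum_(0 <= i < Z)
    coef (2 * C ^+ 2 * eps) i d * delta ^+ 2 <= 9 * I.
Proof.
move=> gap0 hI unif; set eta := 2 * C ^+ 2 * eps.
pose r := [seq (d, i) | d <- index_iota gap (4 * S), i <- index_iota 0 Z].
pose c (k : nat * nat) : R := if (0 < k.1)%N then coef eta k.2 k.1 / 9 else 0.
pose rc (k : nat * nat) := (box k.2, box (k.2 + k.1)).
have boxle i : (box i).1 <= (box i).2 by rewrite ler_pM2r // ler_nat.
have boxT x i : x \in `](box i).1, (box i).2[ -> 0 <= x <= T.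
  rewrite in_itv /= => /andP[h1 h2]; have := cell_lt i; rewrite -(ler_nat R) natrM.
  have eT : T = 2 * S%:R * delta by rewrite -mulrA Sdelta; field.
  move=> h3; have c0 : 0 <= (cell i)%:R :> R by [].
  by have hd := delta0; apply/andP; split; [|rewrite eT]; nra.
have c0 k : 0 <= c k by rewrite /c; case: ifP => // _; rewrite divr_ge0.
have hs (z : R * R) : square z -> steps r c rc z <= integrand z.
  move=> _; set F := (integrand z).
  have F0 : 0 <= F by rewrite /F divr_ge0 // powR_ge0.
  pose A i : R := (z.1 \in `](box i).1, (box i).2[)%:R.
  pose B i : R := (z.2 \in `](box i).1, (box i).2[)%:R.
  have A0 i : 0 <= A i by [].
  have B0 i : 0 <= B i by [].
  apply: (@le_trans _ _ (\sum_(gap <= d < 4 * S) \sum_(0 <= i < Z)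
      F / 9 * (A i * (if (i + d < Z)%N then B (i + d) else 0)))).
    rewrite /steps big_allpairs_dep /=; apply: ler_sum_nat => d /andP[gd _].
    have d0 := leq_trans gap0 gd.
    apply: ler_sum_nat => i _; rewrite /c /= d0 /A /B indicE.
    have [hx|hx] := boolP (z.1 \in _); last first.
      rewrite mul0r mulr0 memNset ?mulr0 // => -[/= h _].
      by move/negP: hx; apply.
    have [hy|hy] := boolP (z.2 \in _); last first.
      rewrite memNset ?mulr0 ?if_same ?mulr0 // => -[/= _ h].
      by move/negP: hy; apply.
    have [idZ|idZ] := ltnP (i + d) Z; last first.
      by rewrite /coef ltnNge idZ /= !mul0r mulr0 mulr0.
    by rewrite mem_set // !mulr1 ler_pM2r ?invr_gt0 // coef_le.
  rewrite exchange_big /=; under eq_bigr do rewrite -mulr_sumr -mulr_sumr.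
  rewrite -mulr_sumr.
  have hB i : \sum_(gap <= d < 4 * S) (if (i + d < Z)%N then B (i + d) else 0) <= 3.
    apply: le_trans (_ : \sum_(0 <= j < Z) B j <= _); last first.
      by rewrite -natr_sum ler_nat count_cell.
    pose B' j := if (j < Z)%N then B j else 0.
    have B'0 j : 0 <= B' j by rewrite /B'; case: ifP.
    have iZ : (i + 4 * S <= i + Z)%N by rewrite leq_add2l leq_mul2r orbT.
    apply: le_trans (ler_sum_window gap B'0 iZ) _.
    rewrite (@big_cat_nat _ _ _ Z 0) ?leq_addl //= [X in _ + X]big_nat_cond.
    rewrite [X in _ + X]big1 ?addr0; last first.
      by move=> j; rewrite andbT => /andP[Zj _]; rewrite /B' ltnNge Zj.
    by apply: ler_sum_nat => j /andP[_ jZ]; rewrite /B' jZ.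
  apply: (@le_trans _ _ (F / 9 * (3 * 3))); last by rewrite -mulrA -[leRHS]mulr1 ler_wpM2l //; lra.
  have F9 : 0 <= F / 9 by exact: (mulr_ge0 F0).
  apply: (ler_wpM2l F9).
  apply: (@le_trans _ _ (\sum_(0 <= i < Z) A i * 3)).
    by apply: ler_sum => i _; rewrite ler_wpM2l.
  by rewrite -mulr_suml ler_wpM2r // -natr_sum ler_nat count_cell.
have mS : measurable square by apply: measurableX; exact: measurable_itv.
have sub k : rect (rc k) `<=` square.
  by move=> [x y] /= [/boxT hx /boxT hy]; split; rewrite /= in_itv.
have := @integral_ge_steps R _ r c rc square _ mS c0 (fun k => conj (boxle _) (boxle _)) sub hs.
move/le_trans => /(_ _ hI); rewrite lee_fin /r big_allpairs_dep /= => hI'.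
rewrite -ler_pdivrMl //; apply: le_trans hI'; rewrite mulr_sumr.
apply: ler_sum_nat => d /andP[gd _]; rewrite mulr_sumr; apply: ler_sum => i _.
rewrite /c /= (leq_trans gap0 gd) /rect_area /= -!mulrBl -!natrB // !subSnn !mul1r.
by rewrite expr2 [leLHS]mulrA [9^-1 * coef _ _ _]mulrC lexx.
Qed.

(** The discrete double integral at distance d. *)
Let mass (d : nat) : R :=
  (\sum_(0 <= i < Z) (if (i + d < Z)%N then pq i (i + d) `^ p else 0)) *
  (delta ^+ 2 / (d%:R * delta) `^ (a + 1)).

(** Choosing the oscillation eps small with respect to the gap, the second term will
   be at most 1. *)
Lemma mass_integral (I eps : R) (gap : nat) : (0 < gap)%N -> 0 <= eps ->
  (\int[mu2]_(z in square) (integrand z)%:E <= I%:E)%E ->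
  (forall s t, 0 <= s <= T -> 0 <= t <= T -> `|s - t| < delta -> q s t < eps) ->
  \sum_(gap <= d < 4 * S) mass d <=
  2 `^ p * ((C ^+ 2) `^ p * 2 `^ (a + 1) * (9 * I) +
            (2 * C ^+ 2 * eps) `^ p * (5 * T ^+ 2 / (gap%:R * delta) `^ (a + 1))).
Proof.
move=> gap0 eps0 hI unif; set eta := 2 * C ^+ 2 * eps.
have Cp : 0 < C ^+ 2 by rewrite exprn_gt0.
have eta0 : 0 <= eta by rewrite /eta !mulr_ge0 // ltW.
have a0 : 0 <= a + 1 by have := a1; lra.
have gd0 : 0 < gap%:R * delta by rewrite mulr_gt0 ?ltr0n.
set w := (gap%:R * delta) `^ (a + 1).
have w0 : 0 < w by rewrite powR_gt0.
have dw0 : 0 <= delta ^+ 2 / w by exact: (divr_ge0 (sqr_ge0 _) (ltW w0)).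
set K1 := (C ^+ 2) `^ p * 2 `^ (a + 1).
have K10 : 0 <= K1 by rewrite mulr_ge0 ?powR_ge0.
apply: (@le_trans _ _ (\sum_(gap <= d < 4 * S) \sum_(0 <= i < Z)
    2 `^ p * (K1 * (coef eta i d * delta ^+ 2) + eta `^ p * (delta ^+ 2 / w)))).
  apply: ler_sum_nat => d /andP[gd _]; rewrite /mass mulr_suml.
  apply: ler_sum => i _; rewrite /coef.
  have d0 : 0 < d%:R * delta by rewrite mulr_gt0 ?ltr0n ?(leq_trans gap0 gd).
  case: ifP => _; last first.
    rewrite !mul0r mulr0 add0r.
    exact: (mulr_ge0 (powR_ge0 _ _) (mulr_ge0 (powR_ge0 _ _) dw0)).
  set Q := pq _ _; set M := Num.max _ _; set D := _ `^ (a + 1).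
  have D0 : 0 < D by rewrite powR_gt0.
  have M0 : 0 <= M by rewrite le_max lexx.
  have hQ : Q `^ p <= 2 `^ p * (M `^ p + eta `^ p).
    apply: le_trans (powR_add_le _ _ _) => //; last exact: ltW.
    rewrite ge0_ler_powR ?nnegrE ?addr_ge0 ?(ltW p0) ?pq_ge0 //.
    by rewrite -lerBlDr le_max lexx orbT.
  have -> : (2 * d%:R * delta) `^ (a + 1) = 2 `^ (a + 1) * D.
    by rewrite -mulrA powRM // ltW.
  have eM : M `^ p = (C ^+ 2) `^ p * (M / C ^+ 2) `^ p.
    rewrite -powRM ?divr_ge0 // ?(ltW Cp) //.
    by rewrite mulrCA divff ?mulr1 // gt_eqF.
  apply: le_trans (ler_wpM2r _ hQ) _.
    by rewrite divr_ge0 ?sqr_ge0 // ltW.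
  have t0 : 0 < 2 `^ (a + 1) :> R by rewrite powR_gt0.
  rewrite -[leLHS]mulrA; apply: ler_wpM2l; first exact: powR_ge0.
  rewrite [leLHS]mulrDl; apply: lerD.
    rewrite eM /K1 le_eqVlt; apply/orP; left; apply/eqP.
    by move: ((_ / _) `^ p) ((C ^+ 2) `^ p) => u v; field; rewrite !gt_eqF.
  rewrite ler_wpM2l ?powR_ge0 // ler_wpM2l ?sqr_ge0 // lef_pV2 ?posrE //.
  by rewrite ge0_ler_powR ?nnegrE ?(ltW gd0) ?(ltW d0) // ler_pM2r // ler_nat.
under eq_bigr do rewrite -mulr_sumr big_split /= -mulr_sumr.
rewrite -mulr_sumr big_split /= -mulr_sumr ler_wpM2l ?powR_ge0 // lerD //.
  by rewrite ler_wpM2l // grid_integral.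
set v := eta `^ p * (delta ^+ 2 / w).
have v0 : 0 <= v by rewrite mulr_ge0 ?powR_ge0 // divr_ge0 ?sqr_ge0 // ltW.
apply: (@le_trans _ _ (\sum_(gap <= d < 4 * S) Z%:R * v)).
  by apply: ler_sum => d _; rewrite sumr_const_nat subn0 mulr_natl.
rewrite sumr_const_nat.
apply: (@le_trans _ _ ((4 * S)%N%:R * (Z%:R * v))).
  have Zv : 0 <= Z%:R * v by exact: (mulr_ge0 (ler0n _ _) v0).
  by rewrite -[leLHS]mulr_natl; apply: (ler_wpM2r Zv); rewrite ler_nat leq_subr.
rewrite /v /Z !natrM le_eqVlt; apply/orP; left; apply/eqP.
have -> : T = 2 * S%:R * delta by rewrite -mulrA Sdelta; field.
by field; rewrite gt_eqF.
Qed.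

Let corr (d : nat) : R :=
  \sum_(0 <= i < Z) (if (i + d < Z)%N then pq i (i + d) `^ p else 0).

Let mass_ge0 d : 0 <= mass d.
Proof.
apply: mulr_ge0; last by rewrite divr_ge0 ?sqr_ge0 ?powR_ge0.
by apply: sumr_ge0 => i _; case: ifP => // _; exact: powR_ge0.
Qed.

Let corr_mass w n d : (0 < d)%N -> (d <= 3 * w)%N -> (w * 2 ^ n = S)%N ->
  corr d * (4 * 2 `^ (a - 1)) ^+ n <=
  3 `^ (a + 1) * (T / 2) `^ (a + 1) * (4 / T ^+ 2) * S%:R ^+ 2 * mass d.
Proof.
move=> d0 dw wn.
have dd0 : 0 < d%:R * delta by rewrite mulr_gt0 ?ltr0n.
have e1 : 4 * 2 `^ (a - 1) = 2 `^ (a + 1) :> R.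
  have -> : a + 1 = 2%:R + (a - 1) by ring.
  rewrite [RHS]powRD; last by rewrite pnatr_eq0 implybT.
  by rewrite (@powR_mulrn _ 2 2) // -natrX.
rewrite e1 -powR_exprn //.
set D := (d%:R * delta) `^ (a + 1); have D0 : 0 < D by rewrite powR_gt0.
have hD : D * (2 ^+ n) `^ (a + 1) <= 3 `^ (a + 1) * (T / 2) `^ (a + 1).
  rewrite /D -!powRM ?exprn_ge0 ?divr_ge0 ?(ltW dd0) ?(ltW T0) //.
  rewrite ge0_ler_powR ?nnegrE ?mulr_ge0 ?exprn_ge0 ?divr_ge0 ?(ltW delta0) ?(ltW T0) //.
    by have := a1; lra.
  rewrite -Sdelta -wn natrM natrX mulrAC [leRHS]mulrA ler_pM2r // mulrA ler_pM2r ?exprn_gt0 //.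
  by rewrite -natrM ler_nat.
have -> : corr d = D / delta ^+ 2 * mass d.
  rewrite /mass -/(corr d) -/D; move: (corr d) => c; field.
  by rewrite !gt_eqF.
rewrite -[X in _ <= X * _]mulrA; have -> : 4 / T ^+ 2 * S%:R ^+ 2 = (delta ^+ 2)^-1.
  have -> : T = 2 * S%:R * delta by rewrite -mulrA Sdelta; field.
  by field; rewrite !gt_eqF.
have -> : D / delta ^+ 2 * mass d * (2 ^+ n) `^ (a + 1) =
    D * (2 ^+ n) `^ (a + 1) * (mass d / delta ^+ 2) by ring.
have md : 0 <= mass d / delta ^+ 2 by rewrite divr_ge0 ?mass_ge0 ?sqr_ge0.
by apply: le_trans (ler_wpM2r md hD) _; rewrite [mass d / _]mulrC [leLHS]mulrA.
Qed.

(** Each increment over 4w cells is compared with those through a point of the second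
   quarter of the interval, and averaged over the w points there. For different
   levels n, the blocks of the gaps w + l are disjoint, and so are those of the gaps
   3w - l: this is why the sum over all levels is bounded by one double sum. *)
Lemma grid_level w n : (w * 2 ^ n = S)%N ->
  (2 `^ (a - 1)) ^+ n * \sum_(0 <= k < 2 ^ n) \sum_(0 <= s < S)
    pq (s + k * (4 * w)) (s + k.+1 * (4 * w)) `^ p <=
  S%:R * (2 `^ p * C `^ p * (3 `^ (a + 1) * (T / 2) `^ (a + 1) * (4 / T ^+ 2)) *
    (\sum_(0 <= l < w) mass (w + l) + \sum_(0 <= l < w) mass (3 * w - l))).
Proof.
move=> wn.
have w0 : (0 < w)%N by rewrite lt0n; apply/eqP => w0; move: Sp; rewrite -wn w0.
set c1 := _ * (4 / _).
have pq_mid i l : pq i (i + 4 * w) `^ p <=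
    2 `^ p * C `^ p * (pq i (i + (w + l)) `^ p + pq (i + (w + l)) (i + 4 * w) `^ p).
  have := qm_tri hq (grid_val_itv i) (grid_val_itv (i + (w + l))) (grid_val_itv (i + 4 * w)).
  move=> h; apply: (@le_trans _ _ ((C * (pq i (i + (w + l)) + pq (i + (w + l)) (i + 4 * w))) `^ p)).
    rewrite ge0_ler_powR ?nnegrE ?pq_ge0 ?(ltW p0) //.
    by rewrite mulr_ge0 ?addr_ge0 ?pq_ge0 ?(ltW C0).
  rewrite powRM ?addr_ge0 ?pq_ge0 ?(ltW C0) // [2 `^ p * _]mulrC -mulrA.
  by rewrite ler_wpM2l ?powR_ge0 // powR_add_le ?pq_ge0 // ltW.
have F0 d i : 0 <= (if (i + d < Z)%N then pq i (i + d) `^ p else 0).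
  by case: ifP => // _; exact: powR_ge0.
have hk k : (k < 2 ^ n)%N -> w%:R * \sum_(0 <= s < S)
    pq (s + k * (4 * w)) (s + k.+1 * (4 * w)) `^ p <= 2 `^ p * C `^ p *
    (\sum_(0 <= l < w) corr (w + l) + \sum_(0 <= l < w) corr (3 * w - l)).
  move=> kn; have kw : (k.+1 * (4 * w) <= 4 * S)%N.
    by rewrite -wn mulnCA [(w * _)%N]mulnC leq_mul2l /= leq_mul2r kn orbT.
  rewrite mulr_sumr -big_split /= mulr_sumr.
  apply: (@le_trans _ _ (\sum_(0 <= l < w) \sum_(0 <= s < S)
     2 `^ p * C `^ p * (pq (s + k * (4 * w)) (s + k * (4 * w) + (w + l)) `^ p +
        pq (s + k * (4 * w) + (w + l)) (s + k.+1 * (4 * w)) `^ p))).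
    rewrite exchange_big /=; apply: ler_sum => s _.
    rewrite mulr_natl -[X in _ *+ X](subn0 w) -sumr_const_nat.
    apply: ler_sum => l _; have := pq_mid (s + k * (4 * w))%N l.
    have -> // : (s + k.+1 * (4 * w) = s + k * (4 * w) + 4 * w)%N.
    by rewrite [(k.+1 * _)%N]mulSn; lia.
  apply: ler_sum_nat => l /andP[_ lw]; rewrite -mulr_sumr ler_wpM2l ?mulr_ge0 ?powR_ge0 //.
  rewrite big_split /= lerD //.
    apply: le_trans (ler_sum_window 0 (F0 (w + l)%N) (_ : (k * (4 * w) + S <= Z)%N)); last first.
      by rewrite /Z; move: kw; rewrite [(k.+1 * _)%N]mulSn; lia.
    apply: ler_sum_nat => s /andP[_ sS]; rewrite [(k * _ + s)%N]addnC ifT //.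
    by rewrite /Z; move: kw; rewrite [(k.+1 * _)%N]mulSn; lia.
  apply: le_trans (ler_sum_window 0 (F0 (3 * w - l)%N) (_ : (k * (4 * w) + (w + l) + S <= Z)%N)); last first.
    by rewrite /Z; move: kw; rewrite [(k.+1 * _)%N]mulSn; lia.
  apply: ler_sum_nat => s /andP[_ sS].
  have -> : (k * (4 * w) + (w + l) + s = s + k * (4 * w) + (w + l))%N by lia.
  have -> : (s + k * (4 * w) + (w + l) + (3 * w - l) = s + k.+1 * (4 * w))%N.
    by rewrite [(k.+1 * _)%N]mulSn; lia.
  by rewrite ifT // /Z; lia.
have wr : w%:R * 2 ^+ n = S%:R :> R by rewrite -wn natrM natrX.
have wr0 : 0 < w%:R :> R by rewrite ltr0n.
set om := 2 `^ (a - 1); have om0 : 0 <= om by exact: powR_ge0.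
set B := 2 `^ p * C `^ p in hk *; have B0 : 0 <= B by rewrite mulr_ge0 ?powR_ge0.
rewrite -(ler_pM2l wr0).
apply: (@le_trans _ _ (om ^+ n * (2 ^+ n * (B *
    (\sum_(0 <= l < w) corr (w + l) + \sum_(0 <= l < w) corr (3 * w - l)))))).
  rewrite mulrCA ler_wpM2l ?exprn_ge0 // mulr_sumr.
  rewrite -natrX mulr_natl -[X in _ <= _ *+ X]subn0 -[leRHS]sumr_const_nat.
  by apply: ler_sum_nat => k /andP[_ kn]; exact: hk.
have pw0 : 0 < 2 ^+ n :> R by rewrite exprn_gt0.
rewrite -(ler_pM2r pw0).
have key : (\sum_(0 <= l < w) corr (w + l) + \sum_(0 <= l < w) corr (3 * w - l)) *
    (4 * om) ^+ n <= c1 * S%:R ^+ 2 *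
    (\sum_(0 <= l < w) mass (w + l) + \sum_(0 <= l < w) mass (3 * w - l)).
  rewrite -!big_split /= mulr_suml mulr_sumr; apply: ler_sum_nat => l /andP[_ lw].
  rewrite mulrDl mulrDr lerD //; apply: (corr_mass _ _ wn).
  - by rewrite addn_gt0 w0.
  - by lia.
  - by lia.
  - by lia.
move: key; move: (\sum_(0 <= l < w) corr _ + _) (\sum_(0 <= l < w) mass _ + _) => X Y.
have -> : (4 * om) ^+ n = 2 ^+ n * 2 ^+ n * om ^+ n.
  by rewrite exprMn -[4]/((2 * 2)%N%:R) natrM exprMn.
move=> /(ler_wpM2l B0) key.
have -> : om ^+ n * (2 ^+ n * (B * X)) * 2 ^+ n = B * (X * (2 ^+ n * 2 ^+ n * om ^+ n)).
  by ring.
apply: le_trans key _; rewrite -wr le_eqVlt; apply/orP; left; apply/eqP.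
by ring.
Qed.

(** The average over the shifts s < S of the dyadic sums is bounded, so one of the
   shifts satisfies the bound. *)
Lemma grid_shift m : (m <= e.+1)%N ->
  exists2 tau : R, - (T / 2) <= tau <= 0 &
  \sum_(0 <= n < m) (2 `^ (a - 1)) ^+ n * \sum_(0 <= k < 2 ^ n)
    q (fold T (tau + k%:R * (2 * T / 2 ^+ n)))
      (fold T (tau + k.+1%:R * (2 * T / 2 ^+ n))) `^ p <=
  2 `^ p * C `^ p * (3 `^ (a + 1) * (T / 2) `^ (a + 1) * (4 / T ^+ 2)) *
    (2 * \sum_(2 ^ (e.+1 - m) <= d < 4 * S) mass d).
Proof.
move=> me; set c1 := _ * (_ * (4 / _)); set W := \sum_(_ <= d < _) _.
have c10 : 0 <= c1.
  by rewrite !mulr_ge0 ?powR_ge0 ?invr_ge0 ?sqr_ge0.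
pose om : R := 2 `^ (a - 1).
pose Phi (s : nat) := \sum_(0 <= n < m) om ^+ n * \sum_(0 <= k < 2 ^ n)
  pq (s + k * (4 * 2 ^ (e - n))) (s + k.+1 * (4 * 2 ^ (e - n))) `^ p.
have hPhi : \sum_(0 <= s < S) Phi s <= S%:R * (c1 * (2 * W)).
  rewrite /Phi exchange_big /=.
  apply: (@le_trans _ _ (\sum_(0 <= n < m) S%:R * (c1 *
    (\sum_(0 <= l < 2 ^ (e - n)) mass (2 ^ (e - n) + l) +
     \sum_(0 <= l < 2 ^ (e - n)) mass (3 * 2 ^ (e - n) - l))))).
    apply: ler_sum_nat => n /andP[_ nm]; rewrite -mulr_sumr exchange_big /=.
    by apply: grid_level; rewrite -expnD subnK // -ltnS (leq_trans nm).
  rewrite -mulr_sumr; apply: ler_wpM2l; first exact: ltW S0.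
  rewrite -mulr_sumr; apply: ler_wpM2l; first exact: c10.
  rewrite big_split /= mulr2n mulrDl mul1r lerD //.
    rewrite dyadic_tiling //; apply: (ler_sum_sub mass_ge0) => //.
    by rewrite expnS leq_mul2r orbT.
  apply: (@le_trans _ _ (\sum_(0 <= n < m) \sum_(0 <= l < 2 ^ (e.+1 - n))
      mass (2 ^ (e.+1 - n) + l))).
    apply: ler_sum_nat => n /andP[_ nm].
    have ne : (n <= e)%N by rewrite -ltnS (leq_trans nm).
    rewrite subSn // expnS; set w := (2 ^ (e - n))%N.
    rewrite big_nat_rev /= add0n.
    apply: le_trans (ler_sum_window 0 (fun l => mass_ge0 (2 * w + l)) (_ : 1 + w <= 2 * w)%N); last first.
      by have : (0 < w)%N by [rewrite expn_gt0]; lia.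
    apply: ler_sum_nat => l /andP[_ lw].
    by have -> : (3 * w - (w - l.+1) = 2 * w + (1 + l))%N by lia.
  rewrite dyadic_tiling; last exact: leqW.
  apply: (ler_sum_sub mass_ge0).
    by rewrite leq_exp2l // leq_sub2r.
  by rewrite !expnS mulnA.
have [[s sS hs]|no] := pselect (exists2 s : nat, (s < S)%N & Phi s <= c1 * (2 * W)); last first.
  exfalso; have : \sum_(0 <= s < S) (c1 * (2 * W)) < \sum_(0 <= s < S) Phi s.
    apply: ltr_sum_nat => // s /andP[_ sS]; rewrite ltNge; apply/negP => h.
    by case: no; exists s.
  by rewrite sumr_const_nat subn0 -[X in X < _]mulr_natl ltNge hPhi.
exists (grid_pt s).
  rewrite /grid_pt -Sdelta; have := sS; rewrite -(ler_nat R) -natr1 => sS'.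
  have s0 : 0 <= s%:R :> R by [].
  by have hd := delta0; apply/andP; split; nra.
apply: le_trans hs; rewrite le_eqVlt; apply/orP; left; apply/eqP.
apply: eq_big_nat => n /andP[_ nm]; congr (_ * _); apply: eq_bigr => k _.
have ne : (n <= e)%N by rewrite -ltnS (leq_trans nm).
have pt k' : grid_pt (s + k' * (4 * 2 ^ (e - n))) = grid_pt s + k'%:R * (2 * T / 2 ^+ n).
  rewrite /grid_pt natrD !natrM natrX /delta.
  have -> : S%:R = 2 ^+ (e - n) * 2 ^+ n :> R by rewrite -exprD subnK // natrX.
  by field; rewrite !expf_neq0.
by rewrite /pq /grid_val !pt.
Qed.

End Grid.

End DyadicSums.

Section DyadicSumsBounded.
Context {R : realType}.
Implicit Types (s t x y z C T p a : R).

Lemma powR_small p c : 0 < p -> 0 <= c -> exists2 x, 0 < x & x `^ p * c <= 1.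
Proof.
move=> p0 c0; have c1 : 0 < c + 1 by rewrite ltr_wpDl.
exists ((c + 1)^-1 `^ p^-1); first by rewrite powR_gt0 // invr_gt0.
rewrite -powRrM mulVf ?gt_eqF // powRr1 ?invr_ge0 ?(ltW c1) //.
by rewrite ler_pdivrMl // mulr1 lerDl.
Qed.

Lemma real_cluster (u : nat -> R) lo hi : (forall n, lo <= u n <= hi) ->
  exists2 v, lo <= v <= hi &
  forall e m, 0 < e -> exists2 n, (m <= n)%N & `|u n - v| < e.
Proof.
move=> uB; pose F := u @ \oo.
have FA : F `[lo, hi]%classic by exists 0%N => // n _; rewrite /= in_itv /= uB.
have [v [vA cv]] := @segment_compact R lo hi F _ FA.
exists v => [|e m e0]; first by move: vA; rewrite /= in_itv.
have F1 : F (u @` [set n | (m <= n)%N]) by exists m => // n mn; exists n.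
have [_ [[n mn <-] hb]] := cv _ _ F1 (nbhsx_ballx v _ e0).
by exists n => //; rewrite distrC.
Qed.

Context (T C p a : R) (q : R -> R -> R).
Hypotheses (T0 : 0 < T) (p0 : 0 < p) (a1 : 1 < a) (hq : quasi_metric_on T C q).

Let dsum m tau : R := \sum_(0 <= n < m) (2 `^ (a - 1)) ^+ n *
  \sum_(0 <= k < 2 ^ n) q (fold T (tau + k%:R * (2 * T / 2 ^+ n)))
                          (fold T (tau + k.+1%:R * (2 * T / 2 ^+ n))) `^ p.

Lemma dyadic_shift :
  (\int[(@lebesgue_measure R \x @lebesgue_measure R)%E]_(z in
     `[0%R, T] `*` `[0%R, T])
     (q z.1 z.2 `^ p / `|z.2 - z.1| `^ (a + 1))%:E < +oo)%E ->
  exists B, forall m, exists2 tau : R, - (T / 2) <= tau <= 0 & dsum m tau <= B.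
Proof.
set J := (\int[_]_(z in _) _)%E => J1.
have J0 : (0 <= J)%E.
  by apply: integral_ge0 => z _; rewrite lee_fin divr_ge0 ?powR_ge0.
have hJ : (J <= (fine J)%:E)%E by rewrite fineK // ge0_fin_numE.
have C0 : 0 < C := lt_le_trans ltr01 (qm_C hq).
have C2 : 0 < 2 * C ^+ 2 by rewrite mulr_gt0 ?exprn_gt0.
exists (2 `^ p * C `^ p * (3 `^ (a + 1) * (T / 2) `^ (a + 1) * (4 / T ^+ 2)) *
  (2 * (2 `^ p * ((C ^+ 2) `^ p * 2 `^ (a + 1) * (9 * fine J) + 1)))) => m.
pose g := T / 2 ^+ m; have g0 : 0 < g by rewrite divr_gt0 ?exprn_gt0.
have [x x0 hx] := @powR_small p (5 * T ^+ 2 / g `^ (a + 1)) p0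
  (divr_ge0 (mulr_ge0 (ler0n _ 5) (sqr_ge0 _)) (powR_ge0 _ _)).
have [del del0 unif] := qm_unif hq (divr_gt0 x0 C2).
pose e := maxn m (Num.truncn (T / del)).
have dele : T / (2 * (2 ^ e)%N%:R) <= del.
  rewrite ler_pdivrMr ?mulr_gt0 ?ltr0n ?expn_gt0 // mulrC -ler_pdivrMr //.
  apply: le_trans (ltW (truncnS_gt _)) _; rewrite -natrM ler_nat -expnS.
  have h := ltn_expl e (isT : (1 < 2)%N).
  have h' : (Num.truncn (T / del) <= e)%N by rewrite leq_maxr.
  by apply: leq_ltn_trans h' (ltn_trans h _); rewrite ltn_exp2l.
have me : (m <= e)%N by rewrite leq_maxl.
have [tau ht hs] := grid_shift (q := q) T0 p0 a1 hq (leqW me).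
exists tau => //; apply: le_trans hs _; apply: ler_wpM2l.
  by rewrite !mulr_ge0 ?powR_ge0 ?invr_ge0 ?sqr_ge0.
apply: ler_wpM2l => //.
have gap0 : (0 < 2 ^ (e.+1 - m))%N by rewrite expn_gt0.
apply: le_trans (mass_integral T0 p0 a1 hq gap0 (ltW (divr_gt0 x0 C2)) hJ _) _.
  by move=> s t sT tT st; apply: unif => //; apply: lt_le_trans dele.
apply: ler_wpM2l; first exact: powR_ge0.
rewrite lerD2l [2 * C ^+ 2 * _]mulrC divfK ?gt_eqF //.
have -> : (2 ^ (e.+1 - m))%N%:R * (T / (2 * (2 ^ e)%N%:R)) = g.
  have -> : (2 * (2 ^ e)%N%:R : R) = 2 ^+ (e.+1 - m) * 2 ^+ m.
    by rewrite -exprD subnK 1?leqW // exprS natrX.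
  by rewrite /g natrX; field; rewrite !expf_neq0.
exact: hx.
Qed.

(** The shifts found at finite precision accumulate at a shift that works for all
   levels, by uniform continuity. *)
Lemma dyadic_sums :
  (\int[(@lebesgue_measure R \x @lebesgue_measure R)%E]_(z in
     `[0%R, T] `*` `[0%R, T])
     (q z.1 z.2 `^ p / `|z.2 - z.1| `^ (a + 1))%:E < +oo)%E ->
  exists2 tau : R, - (T / 2) <= tau <= 0 & exists B, forall m, dsum m tau <= B.
Proof.
move=> /dyadic_shift[B hB].
have [u hu] := choice (fun m => let: ex_intro2 tau h1 h2 := hB m in
  ex_intro (fun tau : R => - (T / 2) <= tau <= 0 /\ dsum m tau <= B) tau (conj h1 h2)).
have [v hv vu] := real_cluster (fun n => (hu n).1).
exists v => //; exists ((C ^+ 2) `^ p * 2 `^ p * (B + 1)) => m.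
have C0 : 0 < C := lt_le_trans ltr01 (qm_C hq).
have om0 : 0 <= 2 `^ (a - 1) :> R by exact: powR_ge0.
pose M : R := \sum_(0 <= n < m) (2 `^ (a - 1)) ^+ n * \sum_(0 <= k < 2 ^ n) 1.
have M0 : 0 <= M.
  by apply: sumr_ge0 => n _; rewrite mulr_ge0 ?exprn_ge0 // sumr_ge0.
have [x x0 hx] := powR_small p0 M0.
have [del del0 unif] := qm_unif hq (divr_gt0 x0 (ltr0n R 2)).
have [n mn un] := vu del m del0.
have fT z : 0 <= fold T z <= T by exact/fold_itv/ltW.
apply: (@le_trans _ _ ((C ^+ 2) `^ p * 2 `^ p * (dsum m (u n) + x `^ p * M))).
  have hk n' k : q (fold T (v + k%:R * (2 * T / 2 ^+ n')))
      (fold T (v + k.+1%:R * (2 * T / 2 ^+ n'))) `^ p <=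
    (C ^+ 2) `^ p * 2 `^ p * (q (fold T (u n + k%:R * (2 * T / 2 ^+ n')))
      (fold T (u n + k.+1%:R * (2 * T / 2 ^+ n'))) `^ p + x `^ p * 1).
    have near z : q (fold T (v + z)) (fold T (u n + z)) < x / 2 /\
        q (fold T (u n + z)) (fold T (v + z)) < x / 2.
      have hz : `|u n + z - (v + z)| < del.
        by rewrite (_ : u n + z - (v + z) = u n - v) //; ring.
      split; apply: unif => //; apply: le_lt_trans (fold_lip _ _ _) _ => //.
      by rewrite distrC.
    move: (k%:R * _) (k.+1%:R * _) => y z.
    have [n1 _] := near y; have [_ n2] := near z.
    set Q := q (fold T (u n + y)) _.
    have Q0 : 0 <= Q by exact: qm_ge0 hq _ _ _ _.
    have C1 := qm_C hq.
    apply: (@le_trans _ _ ((C ^+ 2 * (Q + x)) `^ p)); last first.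
      rewrite powRM ?addr_ge0 ?sqr_ge0 ?(ltW x0) // mulr1 -mulrA ler_wpM2l ?powR_ge0 //.
      by rewrite powR_add_le // ltW.
    have Qx : 0 <= C ^+ 2 * (Q + x).
      exact: (mulr_ge0 (sqr_ge0 _) (addr_ge0 Q0 (ltW x0))).
    rewrite ge0_ler_powR ?nnegrE ?(ltW p0) //.
      exact: qm_ge0 hq _ _ _ _.
    apply: le_trans (qm_tri hq (fT (v + y)) (fT (u n + y)) (fT (v + z))) _.
    rewrite expr2 -mulrA ler_wpM2l ?(ltW C0) //.
    have := ler_wpM2l (ltW C0) (ltW n2).
    have := qm_tri hq (fT (u n + y)) (fT (u n + z)) (fT (v + z)); rewrite -/Q.
    nra.
  rewrite [x `^ p * M]mulr_sumr /dsum -big_split mulr_sumr /=.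
  apply: ler_sum => i _.
  apply: (@le_trans _ _ ((2 `^ (a - 1)) ^+ i * (\sum_(0 <= k < 2 ^ i)
     (C ^+ 2) `^ p * 2 `^ p * (q (fold T (u n + k%:R * (2 * T / 2 ^+ i)))
      (fold T (u n + k.+1%:R * (2 * T / 2 ^+ i))) `^ p + x `^ p * 1)))).
    by apply: ler_wpM2l; [exact: exprn_ge0 | apply: ler_sum => k _; exact: hk].
  rewrite -mulr_sumr big_split /= -mulr_sumr le_eqVlt; apply/orP; left; apply/eqP.
  by ring.
apply: ler_wpM2l; first by rewrite mulr_ge0 ?powR_ge0.
apply: lerD => //; apply: le_trans (hu n).2; apply: ler_sum_sub => // i.
by rewrite mulr_ge0 ?exprn_ge0 // sumr_ge0 // => k _; exact: powR_ge0.
Qed.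

End DyadicSumsBounded.

(** * Lifting a path at the dyadic times *)

Section PathLift.
Context {R : realType} {d N : nat}.
Local Notation TN := (tensor R d N).
Context (K : set TN) (hcK : closed_normal_subgroup K).
Context (T : R) (X : R -> set TN).
Hypotheses (T0 : 0 < T) (hX : continuous_path (quot_group K) quot_dist T X).

Lemma path_quot_group s : 0 <= s <= T -> quot_group K (X s).
Proof. by move=> sT; apply: (proj1 hX); rewrite in_itv. Qed.

Lemma path_quasi : exists C, quasi_metric_on T C (fun s t => quot_dist (X s) (X t)).
Proof.
have [C C0 hC] := quot_dist_quasi hcK; exists (1 + C).
have q := path_quot_group.
have C1 x : 0 <= x -> C * x <= (1 + C) * x by move=> x0; rewrite ler_wpM2r // lerDr.
split=> [|s t sT tT|s sT|s t sT tT|s t x sT tT xT|e e0].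
- by rewrite lerDl.
- by have [] := hC _ _ _ (q _ sT) (q _ tT) (q _ tT).
- by have [] := hC _ _ _ (q _ sT) (q _ sT) (q _ sT).
- have [h0 _ h _] := hC _ _ _ (q _ sT) (q _ tT) (q _ tT).
  exact: le_trans h (C1 _ h0).
- have [h0 _ _ h] := hC _ _ _ (q _ sT) (q _ tT) (q _ xT).
  have [h1 _ _ _] := hC _ _ _ (q _ tT) (q _ xT) (q _ xT).
  exact: le_trans h (C1 _ (addr_ge0 h0 h1)).
apply: contrapT => no.
have bad n : exists st : R * R, [/\ 0 <= st.1 <= T, 0 <= st.2 <= T,
    `|st.1 - st.2| < n.+1%:R^-1 & e <= quot_dist (X st.1) (X st.2)].
  apply: contrapT => no'; apply: no; exists n.+1%:R^-1; first by rewrite invr_gt0.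
  move=> s t sT tT st; rewrite ltNge; apply/negP => h; apply: no'.
  by exists (s, t).
have [u hu] := choice bad.
have [v vT vu] := real_cluster (u := fun n => (u n).1) (fun n => let: And4 h _ _ _ := hu n in h).
have e1 : 0 < e / (2 * (1 + C) ^+ 2).
  by rewrite divr_gt0 // mulr_gt0 // exprn_gt0 // ltr_wpDr.
have vI : v \in `[0, T] by rewrite in_itv.
have [del del0 hdel] := (proj2 hX) v vI _ e1.
have [n mn un] := vu (del / 2) (Num.truncn (2 / del)) (divr_gt0 del0 (ltr0n _ 2)).
have [sT tT st he] := hu n.
have small : n.+1%:R^-1 < del / 2.
  rewrite -[del / 2]invrK invf_div ltf_pV2 ?posrE ?divr_gt0 //.
  by apply: lt_le_trans (truncnS_gt _) _; rewrite ler_nat ltnS.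
have h1 : quot_dist (X (u n).1) (X v) < e / (2 * (1 + C) ^+ 2).
  by apply: hdel; rewrite ?in_itv //; lra.
have h2 : quot_dist (X (u n).2) (X v) < e / (2 * (1 + C) ^+ 2).
  apply: hdel; rewrite ?in_itv //.
  have -> : (u n).2 - v = ((u n).1 - v) - ((u n).1 - (u n).2) by ring.
  apply: le_lt_trans (ler_normB _ _) _; rewrite [del]splitr.
  exact: ltrD un (lt_trans st small).
have [_ _ h3 _] := hC _ _ _ (q _ tT) (q _ vT) (q _ vT).
have [_ _ _ h4] := hC _ _ _ (q _ sT) (q _ vT) (q _ tT).
have : e < e; last by rewrite ltxx.
apply: le_lt_trans he _; apply: le_lt_trans h4 _.
set r := e / _ in h1 h2 e1.
have er : e = 2 * (1 + C) ^+ 2 * r.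
  by rewrite /r mulrC divfK // gt_eqF // mulr_gt0 // exprn_gt0 // ltr_wpDr.
have h5 : C * quot_dist (X (u n).2) (X v) <= C * r by rewrite ler_wpM2l // ltW.
rewrite [X in _ < X]er expr2; nra.
Qed.

Definition dyadic_pt tau n k : R := tau + k%:R * (2 * T / 2 ^+ n).

Lemma dyadic_pt_refine tau n i k :
  dyadic_pt tau (n + i) (k * 2 ^ i) = dyadic_pt tau n k.
Proof.
by rewrite /dyadic_pt natrM natrX exprD; congr (_ + _); field; rewrite !expf_neq0.
Qed.

Definition dyadic_path tau n k : set TN := X (fold T (dyadic_pt tau n k)).

(** The increments of a lift at the dyadic times are dominated by those one
   level up, damped by lam, and by those of the path. *)
Definition lift_recursion lam tau C n0 (L : nat -> nat -> TN) : Prop :=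
  let a n k := nu ((L n k)^-1 * L n k.+1) in
  let b n k := quot_dist (dyadic_path tau n k) (dyadic_path tau n k.+1) in
  [/\ forall n k, dyadic_path tau n k (L n k),
      forall n k, L n.+1 k.*2 = L n k &
      forall n k, (n0 <= n)%N ->
        let V := Num.max (lam * a n k)
                         (C * Num.max (b n.+1 k.*2) (b n.+1 k.*2.+1)) in
        a n.+1 k.*2 <= V /\ a n.+1 k.*2.+1 <= V].

(** The levels from n0 on are lifted by dyadic_lift, n0 being such that the increments
   are small; the coarser levels are subfamilies of the level n0. *)
Lemma lift_levels lam tau :
  (0 < N)%N -> 0 < lam -> lam < 1 -> 2^-1 < lam ^+ N ->
  exists2 C, 1 <= C & exists n0 L, lift_recursion lam tau C n0 L.
Proof.
move=> N0 lam0 lam1 hlam.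
have [C C1 [r r0 hC]] := dyadic_lift hcK N0 lam0 lam1 hlam.
exists C => //; have [D hD] := path_quasi.
have [del del0 unif] := qm_unif hD r0.
have [n0 _ hn0] : exists2 n0 : nat, True & 2 * T / 2 ^+ n0 < del.
  exists (Num.truncn (2 * T / del)) => //.
  rewrite ltr_pdivrMr ?exprn_gt0 // [del * _]mulrC -ltr_pdivrMr //.
  apply: lt_le_trans (truncnS_gt _) _; rewrite -natrX ler_nat.
  exact: ltn_expl.
have fT z : 0 <= fold T z <= T by exact/fold_itv/ltW.
have [||j k|L0 [h1 h2 h4]] := hC (fun j => dyadic_path tau (n0 + j)).
- by move=> j k; exact: path_quot_group.
- by move=> j k; rewrite /dyadic_path addnS -muln2 -(dyadic_pt_refine tau (n0 + j) 1) addn1.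
- apply: unif => //; apply: le_lt_trans (fold_lip _ _ _) _.
  rewrite /dyadic_pt -[k.+1%:R]natr1; apply: le_lt_trans hn0.
  set x := 2 * T / 2 ^+ (n0 + j).
  have -> : tau + k%:R * x - (tau + (k%:R + 1) * x) = - x by ring.
  have T2 : 0 <= 2 * T by rewrite mulr_ge0 // ltW.
  rewrite normrN ger0_norm; last by rewrite divr_ge0 ?exprn_ge0.
  rewrite /x ler_wpM2l // lef_pV2 ?posrE ?exprn_gt0 //.
  by rewrite exprD ler_peMr ?exprn_ge0 // -natrX ler1n expn_gt0.
exists n0, (fun n k => L0 (n - n0)%N (k * 2 ^ (n0 - n))%N); split.
- move=> n k; have := h1 (n - n0)%N (k * 2 ^ (n0 - n))%N.
  rewrite /dyadic_path; have -> : (n0 + (n - n0) = n + (n0 - n))%N by lia.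
  by rewrite dyadic_pt_refine.
- move=> n k; have [nn|nn] := leqP n0 n.
    have -> : (n0 - n.+1 = n0 - n)%N by lia.
    have -> : (n0 - n = 0)%N by lia.
    by rewrite !muln1 subSn.
  have -> : (n.+1 - n0 = n - n0)%N by lia.
  have -> : (n0 - n = (n0 - n.+1).+1)%N by lia.
  by rewrite -muln2 -mulnA -expnS.
- move=> n k nn.
  have -> : (n0 - n.+1 = 0)%N by lia.
  have -> : (n0 - n = 0)%N by lia.
  rewrite !muln1 subSn //; have := h4 (n - n0)%N k.
  by rewrite addnS subnKC.
Qed.

End PathLift.

(** * Dyadic increments of the lift *)

Section Recursion.
Context {R : realType}.
Implicit Types (lam C p om rho B beta M : R) (a b : nat -> nat -> R) (x y : nat -> R).

Lemma max_powR (u v p : R) : Num.max u v `^ p <= u `^ p + v `^ p.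
Proof. by rewrite maxEle; case: ifP => _; [rewrite lerDr powR_ge0|rewrite lerDl powR_ge0]. Qed.

Lemma sum_double (F : nat -> R) n :
  \sum_(0 <= k < n.*2) F k = \sum_(0 <= k < n) (F k.*2 + F k.*2.+1).
Proof.
elim: n => [|n IH]; first by rewrite !big_geq.
by rewrite doubleS !big_nat_recr //= IH addrA.
Qed.

Lemma ler_sum_term (F : nat -> R) k n : (forall j, 0 <= F j) -> (k < n)%N ->
  F k <= \sum_(0 <= j < n) F j.
Proof. by move=> F0 kn; have := ler_sum_sub F0 (leq0n k) kn; rewrite big_nat1. Qed.

Lemma geometric_recursion_sum x y rho n0 B : 0 <= rho < 1 ->
  (forall n, 0 <= x n) -> (forall n, 0 <= y n) ->
  (forall n, (n0 <= n)%N -> x n.+1 <= rho * x n + y n.+1) ->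
  (forall m, \sum_(0 <= n < m) y n <= B) ->
  exists B', forall m, \sum_(0 <= n < m) x n <= B'.
Proof.
move=> /andP[r0 r1] x0 y0 hx hB; have r1' : 0 < 1 - rho by rewrite subr_gt0.
pose A := \sum_(0 <= n < n0.+1) x n.
have A0 : 0 <= A by exact: sumr_ge0.
have Ax : x n0 <= A by rewrite /A big_nat_recr //= lerDr sumr_ge0.
have key m : (1 - rho) * \sum_(0 <= n < (n0 + m).+1) x n + rho * x (n0 + m)%N <=
    A + \sum_(0 <= n < (n0 + m).+1) y n.
  elim: m => [|m IH].
    rewrite addn0 -/A mulrBl mul1r -addrA lerD2l.
    have h : 0 <= \sum_(0 <= n < n0.+1) y n by exact: sumr_ge0.
    by apply: le_trans h; rewrite addrC subr_le0 ler_wpM2l.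
  rewrite addnS big_nat_recr //= [\sum_(0 <= i < (n0 + m).+2) _]big_nat_recr //=.
  by have := hx (n0 + m)%N (leq_addr _ _); nra.
exists ((A + B) / (1 - rho)) => m; rewrite ler_pdivlMr // mulrC.
apply: (@le_trans _ _ ((1 - rho) * \sum_(0 <= n < (n0 + m).+1) x n)).
  by rewrite ler_wpM2l ?(ltW r1') // ler_sum_sub //; lia.
have h := mulr_ge0 r0 (x0 (n0 + m)%N).
by have := key m; have := hB (n0 + m).+1; lra.
Qed.

Context (a b : nat -> nat -> R) (lam C : R) (n0 : nat).
Hypotheses (a0 : forall n k, 0 <= a n k) (b0 : forall n k, 0 <= b n k).
Hypotheses (lam0 : 0 < lam) (C0 : 0 <= C).
Hypothesis rec : forall n k, (n0 <= n)%N ->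
  let V := Num.max (lam * a n k) (C * Num.max (b n.+1 k.*2) (b n.+1 k.*2.+1)) in
  a n.+1 k.*2 <= V /\ a n.+1 k.*2.+1 <= V.

(** Two increments of level n + 1 come from one of level n, and the weight om is spent
   once more: the damping wins as soon as 2 om lam ^ p < 1. *)
Lemma recursion_sum p om B : 0 < p -> 0 <= om -> 2 * om * lam `^ p < 1 ->
  (forall m, \sum_(0 <= n < m) om ^+ n * \sum_(0 <= k < 2 ^ n) b n k `^ p <= B) ->
  exists B', forall m,
    \sum_(0 <= n < m) om ^+ n * \sum_(0 <= k < 2 ^ n) a n k `^ p <= B'.
Proof.
move=> p0 om0 hrho hB.
have s0 (F : nat -> nat -> R) n : 0 <= om ^+ n * \sum_(0 <= k < 2 ^ n) F n k `^ p.
  by rewrite mulr_ge0 ?exprn_ge0 // sumr_ge0 // => k _; exact: powR_ge0.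
apply: (@geometric_recursion_sum _ (fun n => 2 * C `^ p *
  (om ^+ n * \sum_(0 <= k < 2 ^ n) b n k `^ p)) (2 * om * lam `^ p) n0 (2 * C `^ p * B)) => //.
- by rewrite hrho !mulr_ge0 ?powR_ge0.
- by move=> n; exact: (mulr_ge0 (mulr_ge0 (ler0n _ 2) (powR_ge0 _ _)) (s0 b n)).
- move=> n nn; rewrite !expnS !mul2n !sum_double.
  apply: (@le_trans _ _ (om ^+ n.+1 * \sum_(0 <= k < 2 ^ n)
    (2 * (lam `^ p * a n k `^ p + C `^ p * (b n.+1 k.*2 `^ p + b n.+1 k.*2.+1 `^ p))))).
    apply: ler_wpM2l; first exact: exprn_ge0.
    apply: ler_sum => k _; have [h1 h2] := rec k nn.
    have hV : Num.max (lam * a n k) (C * Num.max (b n.+1 k.*2) (b n.+1 k.*2.+1)) `^ p <=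
      lam `^ p * a n k `^ p + C `^ p * (b n.+1 k.*2 `^ p + b n.+1 k.*2.+1 `^ p).
      apply: le_trans (max_powR _ _ _) _; rewrite !powRM ?(ltW lam0) //; last first.
        by rewrite le_max b0.
      by rewrite lerD2l ler_wpM2l ?powR_ge0 // max_powR.
    have mono u : 0 <= u -> u <= Num.max (lam * a n k)
        (C * Num.max (b n.+1 k.*2) (b n.+1 k.*2.+1)) -> u `^ p <=
        lam `^ p * a n k `^ p + C `^ p * (b n.+1 k.*2 `^ p + b n.+1 k.*2.+1 `^ p).
      move=> u0 uV; apply: le_trans hV.
      by rewrite ge0_ler_powR ?nnegrE ?(ltW p0) // (le_trans u0).
    by rewrite mulr2n mulrDl mul1r lerD // mono.
  rewrite -mulr_sumr big_split /= -!mulr_sumr exprS le_eqVlt; apply/orP; left; apply/eqP.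
  by ring.
by move=> m; rewrite -mulr_sumr ler_wpM2l // mulr_ge0 ?powR_ge0.
Qed.

Lemma recursion_sup beta B : 0 < beta -> lam <= beta -> 0 <= B ->
  (forall n k, b n k <= B * beta ^+ n) ->
  exists2 M : R, 0 <= M & forall n k, (k < 2 ^ n)%N -> a n k <= M * beta ^+ n.
Proof.
move=> be0 lb B0 hB.
pose A := \sum_(0 <= n < n0.+1) \sum_(0 <= k < 2 ^ n) a n k / beta ^+ n.
have t0 n k : 0 <= a n k / beta ^+ n by rewrite divr_ge0 // exprn_ge0 // ltW.
have s0 n : 0 <= \sum_(0 <= k < 2 ^ n) a n k / beta ^+ n by exact: sumr_ge0.
have A0 : 0 <= A by exact: sumr_ge0.
have CB0 : 0 <= C * B by exact: mulr_ge0.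
have hA n k : (n <= n0)%N -> (k < 2 ^ n)%N -> a n k <= A * beta ^+ n.
  move=> nn kn; rewrite -ler_pdivrMr ?exprn_gt0 //.
  apply: le_trans (ler_sum_term (t0 n) kn) _; exact: (ler_sum_term s0 (nn : (n < n0.+1)%N)).
exists (A + C * B) => [|n]; first exact: addr_ge0.
elim: n => [|n IH] k kn.
  by apply: le_trans (hA _ _ _ kn) _; rewrite // ler_wpM2r ?exprn_ge0 ?(ltW be0) // lerDl.
have [nn|nn] := leqP n.+1 n0.
  by apply: le_trans (hA _ _ nn kn) _; rewrite ler_wpM2r ?exprn_ge0 ?(ltW be0) // lerDl.
have k2 : (k./2 < 2 ^ n)%N by move: kn; rewrite expnS; lia.
have [h1 h2] := rec k./2 nn.
have hV : Num.max (lam * a n k./2)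
    (C * Num.max (b n.+1 k./2.*2) (b n.+1 k./2.*2.+1)) <= (A + C * B) * beta ^+ n.+1.
  rewrite ge_max; apply/andP; split.
    rewrite exprS mulrCA; apply: ler_pM (IH _ k2) => //; exact: ltW.
  rewrite mulrDl -mulrA; apply: (@le_trans _ _ (C * (B * beta ^+ n.+1))).
    by rewrite ler_wpM2l // ge_max !hB.
  by rewrite lerDr mulr_ge0 // exprn_ge0 // ltW.
rewrite -(odd_double_half k); case: (odd k) => /=; first exact: le_trans h2 hV.
exact: le_trans h1 hV.
Qed.

End Recursion.

(** * The limit path *)

Section LimitPath.
Context {R : realType} {d N : nat}.
Local Notation TN := (tensor R d N).
Local Notation G := (@free_nilpotent_group R d N).
Implicit Types (x y : R) (n m k j : nat).

Definition bin_cell n x : nat := Num.truncn (2 ^+ n * x).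

Lemma bin_cell_itv n x : 0 <= x ->
  (bin_cell n x)%:R <= 2 ^+ n * x < (bin_cell n x).+1%:R.
Proof. by move=> x0; apply: truncn_itv; rewrite mulr_ge0 ?exprn_ge0. Qed.

Lemma bin_cell_lt n x : 0 <= x < 1 -> (bin_cell n x < 2 ^ n)%N.
Proof.
move=> /andP[x0 x1]; have /andP[h _] := bin_cell_itv n x0.
by rewrite -(ltr_nat R) natrX (le_lt_trans h) // gtr_pMr ?exprn_gt0.
Qed.

Lemma bin_cellS n x : 0 <= x ->
  bin_cell n.+1 x = (bin_cell n x).*2 \/ bin_cell n.+1 x = (bin_cell n x).*2.+1.
Proof.
move=> x0; have /andP[h1 h2] := bin_cell_itv n x0.
have /andP[h3 h4] := bin_cell_itv n.+1 x0; rewrite exprS -mulrA in h3 h4.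
have l1 : ((bin_cell n x).*2 < (bin_cell n.+1 x).+1)%N.
  by rewrite -(ltr_nat R) -muln2 natrM (le_lt_trans _ h4) // mulrC ler_pM2l.
have l2 : (bin_cell n.+1 x < (bin_cell n x).*2.+2)%N.
  by rewrite -doubleS -(ltr_nat R) -muln2 natrM (le_lt_trans h3) // mulrC ltr_pM2r.
by have [->|h] := eqVneq (bin_cell n.+1 x) (bin_cell n x).*2; [left|right; lia].
Qed.

Context (L : nat -> nat -> TN) (mu M e : R).
Let a n k := nu ((L n k)^-1 * L n k.+1).
Hypotheses (GL : forall n k, G (L n k)) (L2 : forall n k, L n.+1 k.*2 = L n k).
Hypotheses (mu0 : 0 < mu) (mu1 : mu < 1) (e0 : 0 < e).
Hypothesis aM : forall n k, (k < 2 ^ n)%N -> a n k <= M * mu ^+ n.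

Let g n x := L n (bin_cell n x).

Lemma bin_limit : exists2 C, 1 <= C & exists l : R -> TN,
  forall x, 0 <= x < 1 ->
  [/\ G (l x), forall del : R, 0 < del -> exists m0, forall m, (m0 <= m)%N ->
        nu ((g m x)^-1 * l x) < del &
      forall n, exists i, nu ((g n x)^-1 * l x) <=
        C * (1 + e) ^+ i * a (n + i).+1 (bin_cell (n + i) x).*2].
Proof.
have [C C1 hC] := @chain_limit R d N e e0; exists C => //.
suff : forall x, exists l : TN, 0 <= x < 1 -> [/\ G l,
    forall del : R, 0 < del -> exists m0, forall m, (m0 <= m)%N -> nu ((g m x)^-1 * l) < del &
    forall n, exists i, nu ((g n x)^-1 * l) <=
        C * (1 + e) ^+ i * a (n + i).+1 (bin_cell (n + i) x).*2].
  by move/choice=> [l hl]; exists l.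
move=> x; have [x01|_] := boolP (0 <= x < 1); last by exists 1.
have /andP[x0 x1] := x01.
have [|||||l Gl [h1 h2]] := hC (fun n => g n x) (fun n => a n.+1 (bin_cell n x).*2) mu (M * mu).
- by move=> n; exact: GL.
- move=> n; rewrite /g -(L2 n); case: (bin_cellS n x0) => ->; rewrite -/(a _ _) //.
  by rewrite mulVr ?group_unit // nu1 nu_ge0.
- by [].
- by [].
- move=> n; rewrite -mulrA -exprS; apply: aM.
  by rewrite expnS mul2n ltn_double bin_cell_lt.
by exists l.
Qed.

(** With dyadic approximations of x and y at the level n of their distance, the points
   are at most one cell apart, and each of the three distances that compare l x with
   l y is bounded by a single increment of the lift next to x or to y. *)
Lemma bin_limit_dist (C : R) (l : R -> TN) : 1 <= C ->
  (forall x, 0 <= x < 1 -> G (l x) /\ forall n, exists i, nu ((g n x)^-1 * l x) <=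
        C * (1 + e) ^+ i * a (n + i).+1 (bin_cell (n + i) x).*2) ->
  exists2 D : R, 0 <= D & forall (x y : R) n, 0 <= x -> x < y -> y < 1 -> y - x <= 2 ^- n ->
    exists m j, [/\ (n <= m)%N, (j < 2 ^ m)%N,
      exists2 z : R, (z = x \/ z = y) & j%:R <= 2 ^+ m * z < j.+2%:R &
      nu ((l x)^-1 * l y) <= D * (1 + e) ^+ (m - n) * a m j].
Proof.
move=> C1 hl; have [E E1 hE] := @nuM_crude R d N.
have C0 : 0 < C := lt_le_trans ltr01 C1.
have E0 : 0 < E := lt_le_trans ltr01 E1.
exists (E * E * C); first by rewrite !mulr_ge0 // ltW.
move=> x y n x0 xy y1 yx.
have x01 : 0 <= x < 1 by rewrite x0 (lt_trans xy).
have y01 : 0 <= y < 1 by rewrite y1 (le_trans x0) // ltW.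
have y0 : 0 <= y by case/andP: y01.
have [Gx hx] := hl _ x01; have [Gy hy] := hl _ y01.
have [i hi] := hx n; have [i' hi'] := hy n.
pose V m j : R := C * (1 + e) ^+ (m - n) * a m j.
pose good m j := [/\ (n <= m)%N, (j < 2 ^ m)%N &
  exists2 z : R, (z = x \/ z = y) & j%:R <= 2 ^+ m * z < j.+2%:R].
have a0 m j : 0 <= a m j by exact: nu_ge0.
have e1 m : 1 <= (1 + e) ^+ m by rewrite exprn_ege1 // lerDl ltW.
have fine_cell z i0 : 0 <= z < 1 -> (z = x \/ z = y) -> good (n + i0).+1 (bin_cell (n + i0) z).*2.
  move=> z01 zxy; split.
  - by rewrite -addnS leq_addr.
  - by rewrite expnS mul2n ltn_double bin_cell_lt.
  - exists z => //; have /andP[h1 h2] := bin_cell_itv (n + i0) (proj1 (andP z01)).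
    rewrite -doubleS -!muln2 !natrM exprS -mulrA [2 * (_ * z)]mulrC.
    by rewrite ler_pM2r // ltr_pM2r // h1.
have fineV z i0 : nu ((g n z)^-1 * l z) <= C * (1 + e) ^+ i0 * a (n + i0).+1 (bin_cell (n + i0) z).*2 ->
    nu ((g n z)^-1 * l z) <= V (n + i0).+1 (bin_cell (n + i0) z).*2.
  move=> h; apply: le_trans h _; rewrite /V -addnS addKn.
  apply: ler_wpM2r => //; apply: ler_wpM2l; first exact: ltW.
  by apply: ler_weXn2l => //; rewrite lerDl ltW.
pose V3 := V n (bin_cell n x).
have good3 : good n (bin_cell n x).
  split=> //; first exact: bin_cell_lt.
  exists x; [by left|]; have /andP[-> h2] := bin_cell_itv n x0.
  by rewrite (lt_trans h2) // ltr_nat.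
have mid : nu ((g n x)^-1 * g n y) <= V3.
  rewrite /V3 /V subnn expr0 mulr1.
  have /andP[h1 h2] := bin_cell_itv n x0; have /andP[h3 h4] := bin_cell_itv n y0.
  have pn : 0 < 2 ^+ n :> R by rewrite exprn_gt0.
  have hyx : 2 ^+ n * y <= 2 ^+ n * x + 1.
    by rewrite -lerBlDl -mulrBr mulrC -ler_pdivlMr // div1r.
  have hxy : 2 ^+ n * x < 2 ^+ n * y by rewrite ltr_pM2l.
  have le1 : (bin_cell n x < (bin_cell n y).+1)%N.
    by rewrite -(ltr_nat R) (le_lt_trans h1) // (lt_trans hxy).
  have le2 : (bin_cell n y < (bin_cell n x).+2)%N.
    by rewrite -(ltr_nat R) (le_lt_trans h3) // (le_lt_trans hyx) // -[ltRHS]natr1 ltrD2r.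
  have : bin_cell n y = bin_cell n x \/ bin_cell n y = (bin_cell n x).+1.
    by move: le1 le2; clear; lia.
  rewrite /g; case=> ->.
    by rewrite mulVr ?group_unit // nu1 mulr_ge0 // ltW.
  by rewrite -/(a _ _) ler_peMl.
have total W : nu ((g n x)^-1 * l x) <= W -> V3 <= W -> nu ((g n y)^-1 * l y) <= W ->
    nu ((l x)^-1 * l y) <= E * E * W.
  move=> w1 w2 w3; have W0 : 0 <= W by apply: le_trans w1; exact: nu_ge0.
  have Ug m z : G (g m z) by exact: GL.
  have -> : (l x)^-1 * l y = ((g n x)^-1 * l x)^-1 * ((g n x)^-1 * g n y) * ((g n y)^-1 * l y).
    rewrite invrM ?unitrV ?group_unit // invrK -!mulrA.
    by rewrite mulVKr ?group_unit // mulVKr ?group_unit // mulKr ?group_unit.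
  have GV u v : G u -> G v -> G (u^-1 * v) by move=> ? ?; apply: groupM => //; exact: groupV.
  have hE2 := hE _ _ W (GV _ _ (Ug n x) (Ug n y)) (GV _ _ (Ug n y) Gy) (le_trans mid w2) w3.
  have GV1 := GV _ _ (Ug n x) Gx.
  rewrite -mulrA -[leRHS]mulrA; apply: hE.
  - exact: groupV.
  - by apply: groupM; exact: GV.
  - by rewrite nuV // (le_trans w1) // ler_peMl.
  - exact: hE2.
have D3 m j W : W <= V m j -> E * E * W <= E * E * C * (1 + e) ^+ (m - n) * a m j.
  by move=> h; rewrite -!mulrA mulrA [leRHS]mulrA ler_pM2l ?mulr_gt0 // mulrA.
have gx := fine_cell x i x01 (or_introl erefl); have gy := fine_cell y i' y01 (or_intror erefl).
have vx := fineV x i hi; have vy := fineV y i' hi'.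
set V1 := V _ _ in vx; set V2 := V _ _ in vy.
have [m [j [[h1 h2 h3] h4]]] : exists m j, good m j /\ Num.max V1 (Num.max V3 V2) <= V m j.
  rewrite !maxEle; case: ifP => _; [case: ifP => _|].
  - by exists (n + i').+1, (bin_cell (n + i') y).*2.
  - by exists n, (bin_cell n x).
  - by exists (n + i).+1, (bin_cell (n + i) x).*2.
exists m, j; split=> //; apply: le_trans (D3 _ _ _ h4).
by apply: total; rewrite !le_max ?vx ?vy ?lexx ?orbT.
Qed.

End LimitPath.

(** * Regularity of the lift *)

Section LiftedPath.
Context {R : realType} {d N : nat}.
Local Notation TN := (tensor R d N).
Local Notation G := (@free_nilpotent_group R d N).
Context (K : set TN) (hcK : closed_normal_subgroup K).
Context (T : R) (X : R -> set TN).
Hypotheses (T0 : 0 < T) (hX : continuous_path (quot_group K) quot_dist T X).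
Implicit Types (s t z tau mu M e : R).

Lemma coset_of_quot_dist A l : quot_group K A -> G l ->
  quot_dist A (quot_proj K l) <= 0 -> quot_proj K l = A.
Proof.
move=> qA Gl h0; have [C C0 hC] := quot_dist_attained hcK.
have [g Gg eA] := qA; rewrite -eA in h0 *.
have [h lh] := hC g (quot_proj K l) Gg (ex_intro2 _ _ l Gl erefl).
have Gh : G h := coset_group hcK Gl lh.
move=> hh; have e : g^-1 * h = 1.
  apply: nu_eq0; first by apply: groupM => //; exact: groupV.
  by apply: le_trans hh _; rewrite pmulr_rle0.
have <- : h = g by rewrite -[LHS](mulVKr (group_unit Gg)) e mulr1.
by rewrite (coset_eq hcK Gl lh).
Qed.

(** Control of a path by the increments of a dyadic lift: the scale of the
   increment may be finer than the distance of the times, at the price of the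
   factor mu ^- (m - n). *)
Definition controlled tau mu D (L : nat -> nat -> TN) (bX : R -> TN) : Prop :=
  forall s t n, 0 <= s <= T -> 0 <= t <= T -> s != t -> `|s - t| <= 2 * T / 2 ^+ n ->
    exists m j, [/\ (n <= m)%N, (j < 2 ^ m)%N,
      exists2 z, (z = s \/ z = t) & dyadic_pt T tau m j <= z < dyadic_pt T tau m j.+2 &
      nu ((bX s)^-1 * bX t) <= D * mu ^- (m - n) * nu ((L m j)^-1 * L m j.+1)].

(** The limits of the dyadic lift lie over X by continuity of X and closedness of K. *)
Lemma path_lift tau mu M (L : nat -> nat -> TN) :
  - (T / 2) <= tau <= 0 -> 0 < mu -> mu < 1 ->
  (forall n k, dyadic_path T X tau n k (L n k)) ->
  (forall n k, L n.+1 k.*2 = L n k) ->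
  (forall n k, (k < 2 ^ n)%N -> nu ((L n k)^-1 * L n k.+1) <= M * mu ^+ n) ->
  exists (bX : R -> TN) (D : R), [/\ 0 <= D, (forall t, 0 <= t <= T -> G (bX t) /\ quot_proj K (bX t) = X t) &
    controlled tau mu D L bX].
Proof.
move=> /andP[tau0 tau1] mu0 mu1 YL L2 aM.
have fT z : 0 <= fold T z <= T by exact/fold_itv/ltW.
have qY n k : quot_group K (dyadic_path T X tau n k) by apply: (path_quot_group hX).
have GL n k : G (L n k) by have [] := quot_groupP hcK (qY n k) (YL n k).
have e0 : 0 < mu^-1 - 1 by rewrite subr_gt0 invf_gt1.
have [C C1 [l hl]] := bin_limit GL L2 mu0 mu1 e0 aM.
have [|D D0 hD] := bin_limit_dist GL e0 (l := l) C1.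
  by move=> x x01; have [] := hl x x01.
have T2 : 0 < 2 * T by rewrite mulr_gt0.
pose x t := (t - tau) / (2 * T).
have x01 t : 0 <= t <= T -> 0 <= x t < 1.
  move=> /andP[t0 tT]; rewrite /x divr_ge0 ?(ltW T2) ?subr_ge0 ?(le_trans tau1) //=.
  by rewrite ltr_pdivrMr // mul1r; move: T0 tau0; lra.
have xK t : t = tau + x t * (2 * T) by rewrite /x divfK ?gt_eqF //; ring.
have pt m j t : 2 ^+ m * x t < j%:R <-> t < dyadic_pt T tau m j.
  have pm : 0 < 2 ^+ m :> R by rewrite exprn_gt0.
  have e : dyadic_pt T tau m j - t = (j%:R - 2 ^+ m * x t) * (2 * T / 2 ^+ m).
    by rewrite [X in _ - X = _]xK /dyadic_pt; field; rewrite gt_eqF.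
  by rewrite -subr_gt0 -[X in _ <-> is_true X]subr_gt0 e pmulr_lgt0 // divr_gt0.
exists (fun t => l (x t)), D; split=> //.
- move=> t tT; have [Gl hlim _] := hl _ (x01 t tT); split=> //.
  have qt := path_quot_group hX tT.
  apply: coset_of_quot_dist => //; rewrite leNgt; apply/negP => q0.
  have [E hE] := path_quasi hcK hX; have [E2 E20 hE2] := quot_dist_le_nu hcK.
  have [E3 E30 hE3] := quot_dist_quasi hcK.
  have ql : quot_group K (quot_proj K (l (x t))) by exists (l (x t)).
  set Q := quot_dist _ _ in q0.
  have c0 : 0 < E3 * (1 + E2) + 1 by rewrite ltr_wpDl // mulr_ge0 // addr_ge0.
  pose del := Q / (E3 * (1 + E2) + 1); have del0 : 0 < del by rewrite divr_gt0.
  have [m0 hm0] := hlim _ del0; have [eta eta0 unif] := qm_unif hE del0.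
  have h12 : 0 < 2^-1 :> R by []. have h121 : 2^-1 < 1 :> R by rewrite invf_lt1 // ltr1n.
  have [m1 hm1] := geometric_small (ltW T2) h12 h121 eta0.
  pose m := maxn m0 m1; have h1 := hm0 m (leq_maxl _ _); have h2 := hm1 m (leq_maxr _ _).
  set k := bin_cell m (x t) in h1.
  have h3 : quot_dist (X t) (dyadic_path T X tau m k) < del.
    rewrite -{1}(fold_id tT); apply: unif => //.
    apply: le_lt_trans (fold_lip _ _ _) _; apply: le_lt_trans h2.
    have x0 : 0 <= x t by case/andP: (x01 t tT).
    have /andP[k1 k2] := bin_cell_itv m x0; rewrite -/k in k1 k2.
    have h4 : t < dyadic_pt T tau m k.+1 by apply/pt.
    have h5 : dyadic_pt T tau m k <= t by rewrite leNgt; apply/negP => /pt; rewrite ltNge k1.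
    rewrite ger0_norm ?subr_ge0 // exprVn.
    move: h4; rewrite /dyadic_pt -[k.+1%:R]natr1; move: (2 * T / 2 ^+ m) => w; lra.
  have [_ _ _ h4] := hE3 _ _ _ qt (qY m k) ql.
  have h5 := hE2 _ _ _ _ (qY m k) ql (YL m k) (coset_refl hcK _).
  have h6 : quot_dist (dyadic_path T X tau m k) (quot_proj K (l (x t))) <= E2 * del.
    by apply: le_trans h5 _; rewrite ler_wpM2l // ltW.
  have : Q < Q; last by rewrite ltxx.
  apply: le_lt_trans h4 _; apply: (@le_lt_trans _ _ (E3 * (del + E2 * del))).
    by rewrite ler_wpM2l // lerD // ltW.
  have eQ : Q = (E3 * (1 + E2) + 1) * del by rewrite /del mulrC divfK ?gt_eqF.
  by rewrite [X in _ < X]eQ; lra.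
have main s t n : 0 <= s <= T -> 0 <= t <= T -> s < t -> t - s <= 2 * T / 2 ^+ n ->
    exists m j, [/\ (n <= m)%N, (j < 2 ^ m)%N,
      exists2 z, (z = s \/ z = t) & dyadic_pt T tau m j <= z < dyadic_pt T tau m j.+2 &
      nu ((l (x s))^-1 * l (x t)) <= D * mu ^- (m - n) * nu ((L m j)^-1 * L m j.+1)].
  move=> sT tT st hst; have /andP[xs0 _] := x01 s sT; have /andP[_ xt1] := x01 t tT.
  have xst : x s < x t by rewrite ltr_pM2r ?invr_gt0 // ltrD2r.
  have xst2 : x t - x s <= 2 ^- n.
    rewrite -mulrBl ler_pdivrMr // mulrC; apply: le_trans hst.
    by rewrite le_eqVlt; apply/orP; left; apply/eqP; ring.
  have [m [j [h1 h2 [z hz /andP[z1 z2]] h4]]] := hD _ _ _ xs0 xst xt1 xst2.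
  exists m, j; split=> //; last by move: h4; rewrite addrC subrK exprVn.
  have [t' ht' ez] : exists2 t', (t' = s \/ t' = t) & z = x t'.
    by case: hz => ->; [exists s; [left|]|exists t; [right|]].
  exists t' => //; apply/andP; split; last by apply/pt; rewrite -ez.
  by rewrite leNgt; apply/negP => /pt; rewrite -ez ltNge z1.
move=> s t n sT tT st hst; have [lt_st|lt_ts|est] := ltgtP s t; last by rewrite est eqxx in st.
  by apply: main => //; rewrite -(ger0_norm (_ : 0 <= t - s)) ?subr_ge0 ?(ltW lt_st) // distrC.
have [|m [j [h1 h2 [z hz zz] h4]]] := main t s n tT sT lt_ts.
  by rewrite -(ger0_norm (_ : 0 <= s - t)) ?subr_ge0 // ltW.
exists m, j; split=> //; first by exists z => //; case: hz; [right|left].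
have Gs := (hl _ (x01 s sT)); have Gt := (hl _ (x01 t tT)).
have [Gls _ _] := Gs; have [Glt _ _] := Gt.
have -> : (l (x s))^-1 * l (x t) = ((l (x t))^-1 * l (x s))^-1.
  by rewrite invrM ?unitrV ?group_unit // invrK.
by rewrite nuV //; apply: groupM => //; exact: groupV.
Qed.

End LiftedPath.

Lemma half_powRE (R : realType) (x : R) : 2^-1 `^ x = (2 `^ x)^-1.
Proof. by rewrite -(powR_inv1 (ler0n R 2)) -powRrM mulN1r powRN. Qed.

Section Regularity.
Context {R : realType} {d N : nat}.
Local Notation TN := (tensor R d N).
Local Notation G := (@free_nilpotent_group R d N).
Context (T : R) (T0 : 0 < T) (tau mu M D : R) (L : nat -> nat -> TN) (bX : R -> TN).
Hypotheses (mu0 : 0 < mu) (mu1 : mu < 1) (D0 : 0 <= D).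
Hypothesis aM : forall n k, (k < 2 ^ n)%N -> nu ((L n k)^-1 * L n k.+1) <= M * mu ^+ n.
Hypothesis GbX : forall t : R, 0 <= t <= T -> G (bX t).
Hypothesis hctl : controlled T tau mu D L bX.
Implicit Types (s t : R).

Let T2 : 0 < 2 * T. Proof. by rewrite mulr_gt0. Qed.

Lemma dyadic_scale r : 0 < r <= 2 * T ->
  exists n, 2 * T / 2 ^+ n.+1 < r <= 2 * T / 2 ^+ n.
Proof.
move=> /andP[r0 rT].
have h12 : 0 < 2^-1 :> R by []. have h121 : 2^-1 < 1 :> R by rewrite invf_lt1 // ltr1n.
have [m0 hm0] := geometric_small (ltW T2) h12 h121 r0.
have ex : exists m, 2 * T / 2 ^+ m < r.
  by exists m0; rewrite -exprVn; exact: hm0.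
case: (ex_minnP ex) => -[|n] h1 h2.
  by move: h1; rewrite expr0 divr1 ltNge rT.
by exists n; rewrite h1 leNgt; apply/negP => h; have := h2 _ h; rewrite ltnn.
Qed.

Let M0 : 0 <= M.
Proof. by have := @aM 0%N 0%N isT; rewrite expr0 mulr1; apply: le_trans; exact: nu_ge0. Qed.

Lemma controlled_le s t n : 0 <= s <= T -> 0 <= t <= T -> `|s - t| <= 2 * T / 2 ^+ n ->
  nu ((bX s)^-1 * bX t) <= D * M * mu ^+ n.
Proof.
move=> sT tT st; have [<-|nst] := eqVneq s t.
  rewrite (mulVr (group_unit (GbX sT))) nu1.
  by rewrite !mulr_ge0 ?exprn_ge0 ?(ltW mu0).
have [m [j [nm jm _ h]]] := hctl sT tT nst st.
apply: le_trans h _; rewrite -!mulrA ler_wpM2l // -ler_pdivlMl ?invr_gt0 ?exprn_gt0 //.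
by rewrite invrK mulrCA -exprD subnK // aM.
Qed.

Let cc_le : exists2 C, 0 <= C & forall s t, 0 <= s <= T -> 0 <= t <= T ->
  cc_dist (bX s) (bX t) <= C * nu ((bX s)^-1 * bX t).
Proof.
have [C C0 hC] := @cc_norm_le_nu R d N; exists C => // s t sT tT.
by apply: hC; apply: groupM; [apply: groupV|]; exact: GbX.
Qed.

Let cc_ge0 s t : 0 <= s <= T -> 0 <= t <= T -> 0 <= cc_dist (bX s) (bX t).
Proof.
move=> sT tT; have [C C0 hC] := @nu_le_cc_norm R d N.
rewrite -(pmulr_rge0 _ C0); apply: le_trans (nu_ge0 _) (hC _ _).
by apply: groupM; [apply: groupV|]; exact: GbX.
Qed.

Lemma lift_continuous : continuous_path (free_nilpotent_group d N) cc_dist T bX.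
Proof.
have [C C0 hC] := cc_le.
split=> [t|t]; rewrite in_itv /= => tT; first exact: GbX.
move=> e e0; have [n0 hn0] := geometric_small (mulr_ge0 C0 (mulr_ge0 D0 M0)) mu0 mu1 e0.
exists (2 * T / 2 ^+ n0); first by rewrite divr_gt0 // exprn_gt0.
move=> s; rewrite in_itv /= => sT st; apply: le_lt_trans (hC _ _ sT tT) _.
apply: le_lt_trans (hn0 n0 (leqnn _)); rewrite -[leRHS]mulrA ler_wpM2l //.
exact: controlled_le (ltW st).
Qed.

Lemma lift_holder alpha : 0 < alpha -> mu = 2^-1 `^ alpha ->
  exists C : R, {in `[0, T] &, forall s t, cc_dist (bX s) (bX t) <= C * `|t - s| `^ alpha}.
Proof.
move=> al0 emu; have [C C0 hC] := cc_le.
exists (C * (D * M * T^-1 `^ alpha)) => s t; rewrite !in_itv /= => sT tT.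
apply: le_trans (hC _ _ sT tT) _; rewrite -[leRHS]mulrA ler_wpM2l //.
have [<-|nst] := eqVneq s t.
  rewrite (mulVr (group_unit (GbX sT))) nu1.
  exact: (mulr_ge0 (mulr_ge0 (mulr_ge0 D0 M0) (powR_ge0 _ _)) (powR_ge0 _ _)).
have [|n /andP[n1 n2]] := @dyadic_scale `|s - t|.
  rewrite normr_gt0 subr_eq0 nst /= ler_norml.
  by case/andP: sT => *; case/andP: tT => *; apply/andP; split; lra.
apply: le_trans (controlled_le sT tT n2) _; rewrite -[leRHS]mulrA ler_wpM2l ?mulr_ge0 //.
rewrite emu -powR_exprn // -powRM ?invr_ge0 ?(ltW T0) //.
rewrite ge0_ler_powR ?nnegrE ?(ltW al0) ?exprn_ge0 ?mulr_ge0 ?invr_ge0 ?(ltW T0) //.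
rewrite ler_pdivlMl // distrC; apply: le_trans (ltW n1).
by rewrite exprS exprVn invfM mulrACA divff // mul1r.
Qed.

Lemma ler_sum_mem (I : eqType) (r : seq I) (F : I -> R) i : (forall j, 0 <= F j) ->
  i \in r -> F i <= \sum_(j <- r) F j.
Proof. by move=> F0 ir; rewrite (big_rem i ir) /= lerDl sumr_ge0. Qed.

(** Off the diagonal the integrand is dominated by a multiple of the p-th power
   of a single increment, at a level m and at a place j next to one of the two
   times. The pairs of times with given m, j and given distance 2 ^- n are covered by
   two rectangles of area of order 2 ^- (m + n); the sum over n <= m is geometric
   and leaves the weight om ^+ m of the dyadic sums. *)
Lemma lift_sobolev p a B : 0 < p -> 1 < a -> (mu^-1) `^ p = 2 `^ (a - 1) ->
  (forall m, \sum_(0 <= n < m) (2 `^ (a - 1)) ^+ n *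
     \sum_(0 <= k < 2 ^ n) nu ((L n k)^-1 * L n k.+1) `^ p <= B) ->
  (\int[(@lebesgue_measure R \x @lebesgue_measure R)%E]_(z in
     `[0%R, T] `*` `[0%R, T])
     (cc_dist (bX z.1) (bX z.2) `^ p / `|z.2 - z.1| `^ (a + 1))%:E < +oo)%E.
Proof.
move=> p0 a1 emu hB; have [C C0 hC] := cc_le.
set om := 2 `^ (a - 1) in emu hB; have om0 : 0 < om by rewrite powR_gt0.
have ap : 0 < a + 1 by lra.
pose A m j := nu ((L m j)^-1 * L m j.+1).
have A0 m j : 0 <= A m j by exact: nu_ge0.
pose h m : R := 2 * T / 2 ^+ m; have h0 m : 0 < h m by rewrite divr_gt0 // exprn_gt0.
pose u m j := dyadic_pt T tau m j.
pose r m := [seq (nj, b) | nj <- [seq (n, j) | n <- index_iota 0 m.+1, j <- index_iota 0 (2 ^ m)],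
                           b <- [:: true; false]].
pose c m (i : nat * nat * bool) := (C * (D * mu^-1 ^+ (m - i.1.1) * A m i.1.2)) `^ p /
  (T / 2 ^+ i.1.1) `^ (a + 1).
pose P m (i : nat * nat * bool) :=
  let J := (u m i.1.2 - 3 * h m, u m i.1.2 + 3 * h m) in
  let J' := (u m i.1.2 - 4 * h i.1.1, u m i.1.2 + 4 * h i.1.1) in
  if i.2 then (J, J') else (J', J).
have c0 m i : 0 <= c m i by rewrite divr_ge0 ?powR_ge0.
have msq : measurable (`[0%R, T] `*` `[0%R, T] : set (R * R)).
  by apply: measurableX; exact: measurable_itv.
have area m i : rect_area (P m i) = 48 * (h m * h i.1.1).
  by rewrite /P /rect_area; case: i.2 => /=; ring.
pose K := 192 * (C * D) `^ p * (T ^+ 2 / T `^ (a + 1)).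
have K0 : 0 <= K.
  exact: (mulr_ge0 (mulr_ge0 (ler0n _ 192) (powR_ge0 _ _)) (divr_ge0 (sqr_ge0 _) (powR_ge0 _ _))).
apply: (integral_le_steps (r := r) (c := c) (p := P) (B := 4 * K * B) msq c0).
- move=> m i; have hm := h0 m; have hn := h0 i.1.1.
  by rewrite /P /rect_ok; case: i.2 => /=; split; lra.
- by move=> z _; rewrite divr_ge0 ?powR_ge0.
- move=> [s t] /= [+ +]; rewrite !in_itv /= => sT tT.
  have [<-|nst] := eqVneq s t.
    exists 0%N; rewrite subrr normr0 powR0 ?gt_eqF // invr0 mulr0.
    by apply: sumr_ge0 => i _; rewrite mulr_ge0.
  have [|n /andP[n1 n2]] := @dyadic_scale `|s - t|.
    rewrite normr_gt0 subr_eq0 nst /= ler_norml.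
    by case/andP: sT => *; case/andP: tT => *; apply/andP; split; lra.
  have [m [j [nm jm [z hz /andP[z1 z2]] hnu]]] := hctl sT tT nst n2.
  pose b := z == s.
  exists m; apply: (@le_trans _ _ (c m (n, j, b) * \1_(rect (P m (n, j, b))) (s, t))); last first.
    apply: (@ler_sum_mem _ (r m) (fun i => c m i * \1_(rect (P m i)) (s, t)) (n, j, b)).
      by move=> i; rewrite mulr_ge0.
    apply/allpairsP; exists ((n, j), b); split=> //; last by case: (b).
    by apply/allpairsP; exists (n, j); rewrite /= !mem_index_iota /= ltnS.
  have hmn : h m <= h n.
    rewrite /h ler_wpM2l ?(ltW T2) // lef_pV2 ?posrE ?exprn_gt0 //.
    by rewrite ler_weXn2l // ler1n.
  have hm := h0 m.
  have z2' : z < u m j + 2 * h m.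
    by move: z2; rewrite /dyadic_pt /u /dyadic_pt -/(h m) -[j.+2%:R]natr1 -[j.+1%:R]natr1; lra.
  rewrite indicE mem_set ?mulr1; last first.
    have n2' : `|s - t| <= h n by exact: n2.
    move: n2'; rewrite ler_norml => /andP[n3 n4].
    rewrite -/(u m j) in z1.
    rewrite /P /b; case: eqP => [ez|nz].
      by split; rewrite /= in_itv /=; apply/andP; split; lra.
    have ez : z = t by case: hz.
    by split; rewrite /= in_itv /=; apply/andP; split; lra.
  rewrite /c /=; apply: ler_pM; rewrite ?powR_ge0 ?invr_ge0 ?powR_ge0 //.
    have hn : nu ((bX s)^-1 * bX t) <= D * mu^-1 ^+ (m - n) * A m j by rewrite exprVn.
    rewrite ge0_ler_powR ?nnegrE ?(ltW p0) //.
    - exact: cc_ge0.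
    - by rewrite mulr_ge0 // !mulr_ge0 // exprn_ge0 // invr_ge0 ltW.
    - by apply: le_trans (hC _ _ sT tT) _; rewrite ler_wpM2l.
  rewrite lef_pV2 ?posrE ?powR_gt0 ?divr_gt0 ?exprn_gt0 ?normr_gt0 ?subr_eq0 1?eq_sym //.
  rewrite ge0_ler_powR ?nnegrE ?(ltW ap) ?divr_ge0 ?exprn_ge0 ?(ltW T0) //.
  rewrite distrC; apply: le_trans (ltW n1).
  by rewrite exprS invfM mulrACA divff // mul1r.
have cE m n j b : (n <= m)%N -> c m (n, j, b) * rect_area (P m (n, j, b)) =
    K * (om ^+ m / 2 ^+ m * A m j `^ p * 2 ^+ n).
  move=> nm; rewrite area /c /= /h.
  have e4 : 2 `^ (a + 1) = 4 * om.
    have -> : a + 1 = 2%:R + (a - 1) by ring.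
    rewrite [LHS]powRD; last by rewrite pnatr_eq0 implybT.
    by rewrite (@powR_mulrn _ 2 2) // -natrX.
  have mi0 : 0 <= mu^-1 by rewrite invr_ge0 ltW.
  have -> : C * (D * mu^-1 ^+ (m - n) * A m j) = C * D * mu^-1 ^+ (m - n) * A m j by ring.
  rewrite (powRM _ _ (A0 m j)); last by rewrite !mulr_ge0 // exprn_ge0.
  rewrite (powRM _ _ (exprn_ge0 _ mi0)); last exact: mulr_ge0.
  rewrite powR_exprn // emu -exprVn powRM ?exprn_ge0 ?(ltW T0) // powR_exprn //.
  rewrite half_powRE e4.
  have -> : om ^+ m = om ^+ (m - n) * om ^+ n by rewrite -exprD subnK.
  have -> : (4 * om)^-1 ^+ n = (2 ^+ n * 2 ^+ n * om ^+ n)^-1.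
    by rewrite -exprMn -exprMn exprVn -[4]/((2 * 2)%N%:R) natrM.
  have tp : 0 < T `^ (a + 1) by rewrite powR_gt0.
  have p2 i : 2 ^+ i != 0 :> R by rewrite expf_neq0.
  have on : om ^+ n != 0 by rewrite expf_neq0 ?gt_eqF.
  rewrite /K exprVn; move: (2 ^+ n) (2 ^+ m) (om ^+ n) (om ^+ (m - n)) (p2 n) (p2 m) on.
  by move=> x y v w x0 y0 v0; field; rewrite x0 y0 v0 gt_eqF.
have geo k : \sum_(0 <= n < k) 2 ^+ n <= 2 ^+ k :> R.
  elim: k => [|k IH]; first by rewrite big_geq.
  by rewrite big_nat_recr //= exprS; lra.
move=> k; apply: (@le_trans _ _ (4 * K * \sum_(0 <= m < k) om ^+ m * \sum_(0 <= j < 2 ^ m) A m j `^ p)).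
  rewrite big_mkord mulr_sumr; apply: ler_sum => m _.
  rewrite /r big_allpairs_dep big_allpairs_dep /=.
  have -> : \sum_(n <- index_iota 0 m.+1) \sum_(j <- index_iota 0 (2 ^ m)) \sum_(b <- [:: true; false])
      c m (n, j, b) * rect_area (P m (n, j, b)) =
      2 * K * (om ^+ m / 2 ^+ m) * (\sum_(0 <= j < 2 ^ m) A m j `^ p) * \sum_(0 <= n < m.+1) 2 ^+ n.
    rewrite mulr_sumr; apply: eq_big_nat => n /andP[_ nm].
    rewrite mulr_sumr mulr_suml; apply: eq_bigr => j _.
    by rewrite !big_cons big_nil addr0 !cE //; ring.
  set S := \sum_(0 <= j < _) _.
  have S0 : 0 <= S by apply: sumr_ge0 => j _; exact: powR_ge0.
  apply: (@le_trans _ _ (2 * K * (om ^+ m / 2 ^+ m) * S * 2 ^+ m.+1)).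
    have w0 : 0 <= om ^+ m / 2 ^+ m by rewrite divr_ge0 ?exprn_ge0 ?(ltW om0).
    apply: ler_wpM2l (geo _).
    exact: (mulr_ge0 (mulr_ge0 (mulr_ge0 (ler0n _ 2) K0) w0) S0).
  rewrite exprS le_eqVlt; apply/orP; left; apply/eqP; field.
  by rewrite expf_neq0.
by apply: ler_wpM2l (hB k); exact: (mulr_ge0 (ler0n _ 4) K0).
Qed.

End Regularity.

(** * Existence of the lift *)

Section Existence.
Context {R : realType}.
Implicit Types (alpha x y : R).

Lemma powR_lt1 x y : 0 <= x -> x < 1 -> 0 < y -> x `^ y < 1.
Proof.
move=> x0 x1 y0; have -> : 1 = 1 `^ y :> R by rewrite powR1.
by rewrite gt0_ltr_powR ?nnegrE.
Qed.

Lemma half_powR_lt x y : x < y -> 2^-1 `^ y < 2^-1 `^ x.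
Proof.
move=> xy; have h0 : 0 < 2^-1 :> R by [].
have -> : y = x + (y - x) by ring.
rewrite powRD; last by rewrite (gt_eqF h0) implybT.
by rewrite gtr_pMr ?powR_gt0 // powR_lt1 ?subr_gt0 ?ltW // invf_lt1 // ltr1n.
Qed.

(** This is where N must differ from the inverse of alpha: halving the time scale
   divides the increments of a path of regularity alpha by 2 ^ alpha, while halving
   the logarithm of an element of G divides its quasi-norm by 2 ^ (1 / N) at least.
   As alpha < 1 / N there is room for lam between 2 ^ (- 1 / N) and 2 ^ (- alpha). *)
Lemma damping_factor N alpha : (0 < N)%N -> 0 < alpha -> alpha * N%:R < 1 ->
  exists lam, [/\ 0 < lam, lam < 1, 2^-1 < lam ^+ N & lam < 2^-1 `^ alpha].
Proof.
move=> N0 al0 aN; have Nr : 0 < N%:R :> R by rewrite ltr0n.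
have h0 : 0 < 2^-1 :> R by [].
pose y := (alpha + N%:R^-1) / 2.
have aN' : alpha < N%:R^-1 by rewrite -[N%:R^-1]mul1r ltr_pdivlMr.
have ya : alpha < y by rewrite /y; lra.
have y0 : 0 < y by lra.
exists (2^-1 `^ y); split.
- exact: powR_gt0.
- by rewrite powR_lt1 ?(ltW h0) // invf_lt1 // ltr1n.
- rewrite -powR_mulrn ?powR_ge0 // -powRrM -{1}[2^-1]powRr1 ?(ltW h0) // half_powR_lt //.
  have : N%:R^-1 * N%:R = 1 :> R by rewrite mulVf ?gt_eqF.
  by rewrite /y; lra.
- exact: half_powR_lt.
Qed.

Lemma sum_sup (a : nat -> nat -> R) p om B : 0 < p -> 0 < om ->
  (forall n k, 0 <= a n k) ->
  (forall m, \sum_(0 <= n < m) om ^+ n * \sum_(0 <= k < 2 ^ n) a n k `^ p <= B) ->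
  forall n k, (k < 2 ^ n)%N -> a n k <= B `^ p^-1 * ((om `^ p^-1)^-1) ^+ n.
Proof.
move=> p0 om0 a0 hB n k kn.
have s0 i : 0 <= \sum_(0 <= j < 2 ^ i) a i j `^ p.
  by apply: sumr_ge0 => j _; exact: powR_ge0.
have h : om ^+ n * a n k `^ p <= B.
  apply: le_trans (hB n.+1).
  apply: (@le_trans _ _ (om ^+ n * \sum_(0 <= j < 2 ^ n) a n j `^ p)).
    apply: ler_wpM2l; first by rewrite exprn_ge0 // ltW.
    by apply: (ler_sum_term (F := fun j => a n j `^ p)) => // j; exact: powR_ge0.
  apply: (ler_sum_term (F := fun i => om ^+ i * \sum_(0 <= j < 2 ^ i) a i j `^ p)) => // i.
  by rewrite mulr_ge0 // exprn_ge0 // ltW.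
have q0 : 0 <= p^-1 by rewrite invr_ge0 ltW.
have B0 : 0 <= B by apply: le_trans h; rewrite mulr_ge0 ?powR_ge0 // exprn_ge0 // ltW.
have -> : a n k = (a n k `^ p) `^ p^-1 by rewrite -powRrM divff ?gt_eqF // powRr1.
rewrite exprVn -powR_exprn ?(ltW om0) // ler_pdivlMr ?powR_gt0 ?exprn_gt0 //.
by rewrite -powRM ?powR_ge0 ?exprn_ge0 ?(ltW om0) // ge0_ler_powR ?nnegrE ?mulr_ge0 ?powR_ge0 ?exprn_ge0 ?(ltW om0) // mulrC.
Qed.

Context (d N : nat) (K : set (tensor R d N)) (hcK : closed_normal_subgroup K).
Context (T alpha : R) (X : R -> set (tensor R d N)).
Hypotheses (T0 : 0 < T) (N0 : (0 < N)%N) (al0 : 0 < alpha) (aN : alpha * N%:R < 1).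
Hypothesis cX : continuous_path (quot_group K) quot_dist T X.

Let T2 : 0 < 2 * T. Proof. by rewrite mulr_gt0. Qed.

Let b_ge0 tau n k : 0 <= quot_dist (dyadic_path T X tau n k) (dyadic_path T X tau n k.+1).
Proof.
have [E hE] := path_quasi hcK cX.
by apply: (qm_ge0 hE); exact/fold_itv/ltW.
Qed.

(** With om = 2 ^ (alpha q - 1) and mu = om ^ (- 1 / q), the increments of the lift
   inherit the sums weighted by om ^ n of those of the path; in particular they decay
   like mu ^ n. *)
Lemma sobolev_lift q : 1 <= q -> 1 < alpha * q ->
  sobolev_path (quot_group K) quot_dist alpha q%:E T X ->
  exists bX, sobolev_path (free_nilpotent_group d N) cc_dist alpha q%:E T bX /\
    {in `[0, T], forall t, quot_proj K (bX t) = X t}.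
Proof.
move=> q1 aq [_ hX]; have q0 : 0 < q by lra.
have [E hE] := path_quasi hcK cX.
have [tau htau [B hB]] := dyadic_sums T0 q0 aq hE hX.
have [lam [lam0 lam1 hlam lal]] := damping_factor N0 al0 aN.
have [C C1 [n0 [L [YL L2 rec]]]] := lift_levels hcK T0 cX tau N0 lam0 lam1 hlam.
set om := 2 `^ (alpha * q - 1) in hB.
have om1 : 1 < om.
  rewrite -invf_lt1 ?powR_gt0 // -half_powRE powR_lt1 ?invr_ge0 ?subr_gt0 //.
  by rewrite invf_lt1 // ltr1n.
have om0 : 0 < om by lra.
have rho : 2 * om * lam `^ q < 1.
  have -> : 2 * om = (2 `^ alpha) `^ q.
    rewrite /om powRD ?pnatr_eq0 ?implybT // powRN powRr1 // mulrCA divff // mulr1.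
    by rewrite powRrM.
  have h2 : 0 < 2 `^ alpha :> R by rewrite powR_gt0.
  rewrite -powRM ?powR_ge0 ?(ltW lam0) // powR_lt1 ?mulr_ge0 ?(ltW lam0) ?(ltW h2) //.
  by rewrite mulrC -ltr_pdivlMr // div1r -half_powRE.
pose a n k := nu ((L n k)^-1 * L n k.+1).
have a0 n k : 0 <= a n k by exact: nu_ge0.
have [B' hB'] := recursion_sum a0 (b_ge0 tau) lam0 (le_trans ler01 C1) rec q0 (ltW om0) rho hB.
have aM := sum_sup q0 om0 a0 hB'.
have oq : 1 < om `^ q^-1.
  have -> : 1 = 1 `^ q^-1 :> R by rewrite powR1.
  by rewrite gt0_ltr_powR ?invr_gt0 ?nnegrE // ltW.
have mu0 : 0 < (om `^ q^-1)^-1 by rewrite invr_gt0 powR_gt0.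
have mu1 : (om `^ q^-1)^-1 < 1 by rewrite invf_lt1 ?powR_gt0.
have [bX [D [D0 hbX hctl]]] := path_lift hcK T0 cX htau mu0 mu1 YL L2 aM.
have GbX t (tT : 0 <= t <= T) := proj1 (hbX t tT).
exists bX; split; last by move=> t; rewrite in_itv /= => /hbX[].
split; first exact: lift_continuous mu0 mu1 D0 aM GbX hctl.
apply: (lift_sobolev T0 mu0 D0 GbX hctl q0 aq _ hB').
by rewrite invrK -powRrM mulVf ?gt_eqF // powRr1 // ltW.
Qed.

(** Here the dyadic grid needs no shift, and suprema replace sums. *)
Lemma holder_lift :
  sobolev_path (quot_group K) quot_dist alpha +oo%E T X ->
  exists bX, sobolev_path (free_nilpotent_group d N) cc_dist alpha +oo%E T bX /\
    {in `[0, T], forall t, quot_proj K (bX t) = X t}.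
Proof.
move=> [_ [H hX]].
have [lam [lam0 lam1 hlam lal]] := damping_factor N0 al0 aN.
have [C C1 [n0 [L [YL L2 rec]]]] := lift_levels hcK T0 cX 0 N0 lam0 lam1 hlam.
pose a n k := nu ((L n k)^-1 * L n k.+1).
have a0 n k : 0 <= a n k by exact: nu_ge0.
have mu0 : 0 < 2^-1 `^ alpha :> R by rewrite powR_gt0 // invr_gt0.
have mu1 : 2^-1 `^ alpha < 1 :> R by rewrite powR_lt1 ?invr_ge0 // invf_lt1 // ltr1n.
have fT z : 0 <= fold T z <= T by exact/fold_itv/ltW.
have hb n k : quot_dist (dyadic_path T X 0 n k) (dyadic_path T X 0 n k.+1) <=
    `|H| * (2 * T) `^ alpha * (2^-1 `^ alpha) ^+ n.
  apply: le_trans (hX _ _ _ _) _; rewrite ?in_itv //=.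
  apply: (@le_trans _ _ (`|H| * `|fold T (dyadic_pt T 0 n k.+1) - fold T (dyadic_pt T 0 n k)| `^ alpha)).
    by rewrite ler_wpM2r ?powR_ge0 // ler_norm.
  rewrite -mulrA ler_wpM2l // -powR_exprn // -powRM ?exprn_ge0 ?(ltW T2) //.
  rewrite ge0_ler_powR ?nnegrE ?(ltW al0) ?mulr_ge0 ?exprn_ge0 ?(ltW T0) //.
  apply: le_trans (fold_lip _ _ _) _.
  rewrite /dyadic_pt -[k.+1%:R]natr1 !add0r mulrDl mul1r addrC addKr exprVn ger0_norm //.
  by rewrite divr_ge0 ?exprn_ge0 // ltW.
have [M M0 aM] := recursion_sup a0 lam0 (le_trans ler01 C1) rec mu0 (ltW lal)
  (mulr_ge0 (normr_ge0 H) (powR_ge0 _ _)) hb.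
have htau : (- (T / 2) <= 0 :> R) && (0 <= 0 :> R) by rewrite lexx oppr_le0 divr_ge0 // ltW.
have [bX [D [D0 hbX hctl]]] := path_lift hcK T0 cX htau mu0 mu1 YL L2 aM.
have GbX t (tT : 0 <= t <= T) := proj1 (hbX t tT).
exists bX; split; last by move=> t; rewrite in_itv /= => /hbX[].
split; first exact: lift_continuous mu0 mu1 D0 aM GbX hctl.
by have := lift_holder T0 mu0 D0 aM GbX hctl al0 erefl.
Qed.

End Existence.

Theorem theorem2p4 (R : realType) (T : R) (d : nat) (alpha : R) (p : \bar R)
  (K : set (tensor R d (Num.truncn alpha^-1)))
  (X : R -> set (tensor R d (Num.truncn alpha^-1))) :
  0 < T -> 0 < alpha < 1 -> (1 <= p)%E -> (p^-1 < alpha%:E)%E ->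
  (forall n : nat, n <> 1%N -> alpha^-1 <> n%:R) ->
  closed_normal_subgroup K ->
  sobolev_path (quot_group K) quot_dist alpha p T X ->
  exists bX : R -> tensor R d (Num.truncn alpha^-1),
    sobolev_path (free_nilpotent_group d (Num.truncn alpha^-1)) cc_dist
      alpha p T bX /\
    {in `[0, T], forall t, quot_proj K (bX t) = X t}.
Proof.
move=> T0 /andP[al0 al1] p1 pal hal hK hX.
set N := Num.truncn alpha^-1 in K X hK hX *.
have ai1 : 1 < alpha^-1 by rewrite invf_gt1.
have N0 : (0 < N)%N by rewrite truncn_ge_nat ?(ltW ai1) // (le_trans ler01) // ltW.
have aN : alpha * N%:R < 1.
  have /andP[h _] := truncn_itv (le_trans ler01 (ltW ai1)).
  rewrite -ltr_pdivlMl // mulr1 lt_neqAle -/N h andbT; apply/eqP => e.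
  have [e1|/eqP/hal] := eqVneq N 1%N; last by rewrite e.
  by move: ai1; rewrite -e e1 ltxx.
case: p p1 pal hX => [q| |] //= p1 pal hX; last exact: (holder_lift hK T0 N0 al0 aN hX.1 hX).
apply: (sobolev_lift hK T0 N0 al0 aN hX.1 _ _ hX) => //.
move: pal; rewrite lee_fin in p1.
have q0 : 0 < q by apply: lt_le_trans p1.
by rewrite inver gt_eqF // lte_fin -[q^-1]mul1r ltr_pdivrMr.
Qed.
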